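(* Let $\mu>0$, $K_a=\mu n$, $M_1>2$, let $M=K_aM_1$ be the codebook size, and let $0<\epsilon\le1-\frac{K_a}{M}=1-\frac1{M_1}$. Then $$\mathcal{E}^*(M_1,\mu,\epsilon)\ge\mathcal{E}_{conv},\qquad \mathcal{E}_{conv}=\max\{\mathcal{E}_{conv,1},\mathcal{E}_{conv,2}\},$$ where: (1) $\displaystyle\mathcal{E}_{conv,1}=\inf\frac{P_{tot}}{\mu\log_2M_1}$, the infimum being over all $P_{tot}>0$ that satisfy $$\mu\theta\log_2M_1-\epsilon\mu\log_2(M_1-1)-\mu h_2(\epsilon)\le\log_2\left(1+\alpha(1-\theta,1)P_{tot}\right)\qquad\text{for all }\theta\in[0,1],$$ with $\alpha(a,b)=a\ln a-b\ln b+b-a$; (2) $\displaystyle\mathcal{E}_{conv,2}=\inf\frac{P_{tot}}{\mu\log_2M_1}$, the infimum being over all $P_{tot}>0$ that satisfy $$\epsilon\ge1-\mathbb{E}\left[\mathcal{Q}\left(\mathcal{Q}^{-1}\left(\frac1{M_1}\right)-\sqrt{\frac{2P_{tot}}{\mu}|H|^2}\right)\right],$$ where $H\sim\mathcal{CN}(0,1)$ and $\mathcal{Q}$ is the complementary cumulative distribution function of the standard normal distribution.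
   Context: $h_2(p)=-p\log_2p-(1-p)\log_2(1-p)$; $0\ln0=0$ throughout. $\mathcal{CN}(0,1)$ is the standard circularly symmetric complex normal distribution. Integer-rounding of $\mu n$ and $K_aM_1$ is ignored (these are treated as integers). The $K_a$-user quasi-static Rayleigh fading MAC of blocklength $n$: for inputs $X_1,\dots,X_{K_a}\in\mathbb{C}^n$ the output is $Y=\sum_{i=1}^{K_a}H_iX_i+Z$, with $Z\sim\mathcal{CN}(0,I_n)$ and $H_1,\dots,H_{K_a}$ i.i.d. $\mathcal{CN}(0,1)$ scalars, with $(H_i)_i$, $Z$ and the inputs independent; the $H_i$ are unknown to transmitters and receiver. An $(M,n,\epsilon)$ random-access code (asymptotic-section version) is a pair of (possibly randomized) maps $f:[M]\to\mathbb{C}^n$ (common encoder) and $g:\mathbb{C}^n\to\binom{[M]}{K_a}$ (decoder, outputting a $K_a$-subset of $[M]=\{1,\dots,M\}$) such that, if $W_1,\dots,W_{K_a}$ are sampled uniformly without replacement from $[M]$ and $X_j=f(W_j)$, then the per-user probability of error satisfies $\frac1{K_a}\sum_{j=1}^{K_a}\mathbb{P}[W_j\notin g(Y)]\le\epsilon$. An $(n,M,\epsilon,\mathcal{E},K_a)$-code is such an $(M,n,\epsilon)$ random-access code for the $K_a$-user MAC all of whose codewords $c$ satisfy $\|c\|^2\le nP=\mathcal{E}\log_2M_1$, where $M_1=M/K_a$. (Thus with total power $P_{tot}=K_aP$ one has $\mathcal{E}=P_{tot}/(\mu\log_2M_1)$.) The fundamental limit is $$\mathcal{E}^*(M_1,\mu,\epsilon)=\limsup_{n\to\infty}\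 \inf\left\{\mathcal{E}:\ \text{there exists an }(n,M=K_aM_1,\epsilon,\mathcal{E},K_a=\mu n)\text{-code}\right\}.$$ *)

(* Defs.v *)
From HB Require Import structures.
From mathcomp Require Import all_boot all_order all_algebra.
From mathcomp Require Import complex.
From mathcomp Require Import all_classical all_reals all_analysis.

Set Implicit Arguments.
Unset Strict Implicit.
Unset Printing Implicit Defensive.

Import Order.TTheory GRing.Theory Num.Theory.
Import numFieldNormedType.Exports.

Local Open Scope classical_set_scope.
Local Open Scope ring_scope.

(* R[i] carries the Borel sigma-algebra of R * R, transported along
   z |-> (Re z, Im z). *)
Section complex_measurable.
Context {R : realType}.

Definition complex_coords (z : R[i]) : measurableTypeR R * measurableTypeR R :=
  (complex.Re z, complex.Im z).

Definition complex_measurable : set (set R[i]) :=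
  preimage_set_system setT complex_coords measurable.

Let complex_measurable_sigma : sigma_algebra setT complex_measurable.
Proof. exact/sigma_algebra_preimage/sigma_algebra_measurable. Qed.

Let complex_measurable0 : complex_measurable set0.
Proof. by case: complex_measurable_sigma. Qed.

Let complex_measurableC A :
  complex_measurable A -> complex_measurable (~` A).
Proof.
by case: complex_measurable_sigma => _ + _; rewrite -setTD; apply.
Qed.

Let complex_measurable_bigcup (F : (set R[i])^nat) :
  (forall i, complex_measurable (F i)) -> complex_measurable (\bigcup_i F i).
Proof. by case: complex_measurable_sigma => _ _; apply. Qed.

HB.instance Definition _ := isPointed.Build R[i] 0.
HB.instance Definition _ := @isMeasurable.Build default_measure_display R[i]
  complex_measurable complex_measurable0 complex_measurableC
  complex_measurable_bigcup.

End complex_measurable.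

Section complex_normal.
Context {R : realType}.

Definition mkcomplex (p : measurableTypeR R * measurableTypeR R) : R[i] := Complex p.1 p.2.

Lemma measurable_mkcomplex : measurable_fun setT mkcomplex.
Proof.
move=> _ _ [B mB <-]; rewrite setTI.
suff -> : mkcomplex @^-1` ([set: R[i]] `&` complex_coords @^-1` B) = B by [].
by apply/seteqP; split=> -[a b] /=; [case|split].
Qed.

HB.instance Definition _ := @isMeasurableFun.Build _ _
  (measurableTypeR R * measurableTypeR R)%type R[i] mkcomplex measurable_mkcomplex.

(* CN(0, 1): independent real and imaginary parts of variance 1/2 each
   (the second argument of normal_prob is the standard deviation). *)
Definition cnormal_prob : probability R[i] R :=
  distribution
    (normal_prob 0 (Num.sqrt 2^-1) \x normal_prob 0 (Num.sqrt 2^-1))%E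
    mkcomplex.

End complex_normal.

(* The law of n i.i.d. draws from P: the n-fold product measure, as a
   probability on n.-tuple T. *)
Section iid_prob.
Context d (T : measurableType d) (R : realType) (P : probability T R).

Definition tcons n (p : T * n.-tuple T) : n.+1.-tuple T := [tuple of p.1 :: p.2].

Lemma measurable_tcons n : measurable_fun setT (@tcons n).
Proof. exact: measurable_cons measurable_fst measurable_snd. Qed.

HB.instance Definition _ n := @isMeasurableFun.Build _ _
  (T * n.-tuple T)%type (n.+1.-tuple T) (@tcons n) (@measurable_tcons n).

Fixpoint iid_prob n : probability (n.-tuple T) R :=
  if n is n'.+1 then distribution (P \x iid_prob n')%E (@tcons n')
  else dirac [tuple].

End iid_prob.

Section model.
Context {R : realType}.
Implicit Types (n K M : nat).

(* Private randomization: each user applies [enc] with its own seed of law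
   [Penc], and the decoder uses an independent seed of law [Pdec].
   Messages are numbered from 0. *)
Record ra_code n M K := RACode {
  denc : measure_display ;
  Tenc : measurableType denc ;
  Penc : probability Tenc R ;
  enc : 'I_M -> Tenc -> n.-tuple R[i] ;
  ddec : measure_display ;
  Tdec : measurableType ddec ;
  Pdec : probability Tdec R ;
  dec : n.-tuple R[i] -> Tdec -> {set 'I_M} ;
  measurable_enc : forall m, measurable_fun setT (enc m) ;
  measurable_dec : forall A : {set 'I_M},
    measurable [set yv : n.-tuple R[i] * Tdec | dec yv.1 yv.2 = A] ;
  card_dec : forall y v, #|dec y v| = K }.

Arguments enc {n M K} r m u : rename.
Arguments dec {n M K} r y v : rename.

(* Y = \sum_i H_i X_i + Z *)
Definition mac_output n K (x : 'I_K -> n.-tuple R[i]) (h : K.-tuple R[i])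
    (z : n.-tuple R[i]) : n.-tuple R[i] :=
  [tuple \sum_(i < K) tnth h i * tnth (x i) t + tnth z t | t < n].

(* The joint law of encoder seeds, fading coefficients, noise and decoder seed;
   all of them are independent, and independent of the messages. *)
Definition ra_law n M K (c : ra_code n M K) :
    probability (K.-tuple (Tenc c) * K.-tuple R[i] * n.-tuple R[i] * Tdec c)%type R :=
  (iid_prob (Penc c) K \x iid_prob cnormal_prob K \x iid_prob cnormal_prob n
     \x Pdec c)%E.

(* The event W_j \notin g(Y) when the message vector (W_1, ..., W_K) is w. *)
Definition missed n M K (c : ra_code n M K) (w : {ffun 'I_K -> 'I_M})
    (j : 'I_K) :
    set (K.-tuple (Tenc c) * K.-tuple R[i] * n.-tuple R[i] * Tdec c) :=
  [set o | let: (u, h, z, v) := o in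
    w j \notin
      dec c (mac_output (fun i => enc c (w i) (tnth u i)) h z) v].

Arguments missed {n M K} c w j.

(* P[W_j \notin g(Y)]: sampling without replacement makes (W_1, ..., W_K)
   uniform on the injective vectors. *)
Definition miss_prob n M K (c : ra_code n M K) (j : 'I_K) : R :=
  (\sum_(w : {ffun 'I_K -> 'I_M} | injectiveb w) fine (ra_law c (missed c w j)))
    / #|[pred w : {ffun 'I_K -> 'I_M} | injectiveb w]|%:R.

Definition per_user_error n M K (c : ra_code n M K) : R :=
  K%:R^-1 * \sum_(j < K) miss_prob c j.

Definition log2 (x : R) : R := ln x / ln 2.

Definition sqnorm n (x : n.-tuple R[i]) : R :=
  \sum_(t < n) Normc.normc (tnth x t) ^+ 2.

(* [c] is an (n, M, eps, E, K)-code. *)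
Definition is_code n M (eps E : R) K (c : ra_code n M K) : Prop :=
  per_user_error c <= eps /\
  forall m u, sqnorm (enc c m u) <= E * log2 (M%:R / K%:R).

(* For real mu and M1, K_a = mu n and M = K_a M1 are rounded down. *)
Definition num_users (mu : R) n : nat := Num.truncn (mu * n%:R).

Definition codebook_size (mu M1 : R) n : nat :=
  Num.truncn ((num_users mu n)%:R * M1).

Definition Estar (M1 mu eps : R) : \bar R :=
  limn_esup (fun n => ereal_inf [set E%:E | E in
    [set E : R | exists c : ra_code n (codebook_size mu M1 n) (num_users mu n),
       is_code eps E c]]).

Definition h2 (p : R) : R := - p * log2 p - (1 - p) * log2 (1 - p).

Definition alpha (a b : R) : R := a * ln a - b * ln b + b - a.

(* The standard normal complementary cdf and its inverse, the latter for
   arguments in ]0, 1[. *)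
Definition Qfun (x : R) : R := fine (normal_prob 0 1 `]x, +oo[).

Definition Qinv (p : R) : R := [get x | Qfun x = p].

Definition Econv1 (M1 mu eps : R) : \bar R :=
  ereal_inf [set (Ptot / (mu * log2 M1))%:E | Ptot in
    [set Ptot : R | 0 < Ptot /\
      forall theta : R, 0 <= theta <= 1 ->
        mu * theta * log2 M1 - eps * mu * log2 (M1 - 1) - mu * h2 eps
          <= log2 (1 + alpha (1 - theta) 1 * Ptot)]].

Definition Econv2 (M1 mu eps : R) : \bar R :=
  ereal_inf [set (Ptot / (mu * log2 M1))%:E | Ptot in
    [set Ptot : R | 0 < Ptot /\
      (1 - 'E_cnormal_prob[fun H : R[i] =>
         Qfun (Qinv M1^-1 - Num.sqrt (2 * Ptot / mu * Normc.normc H ^+ 2))]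
       <= eps%:E)%E]].

Definition Econv (M1 mu eps : R) : \bar R :=
  Order.max (Econv1 M1 mu eps) (Econv2 M1 mu eps).

End model.

Arguments enc {R n M K} r m u : rename.
Arguments dec {R n M K} r y v : rename.
Arguments missed {R n M K} c w j.

(* Main.v *)
Require Import Defs.
From mathcomp Require Import all_boot all_order all_algebra.
From mathcomp Require Import all_classical all_reals all_analysis.
From HB Require Import structures.
From mathcomp Require Import perm complex ring lra.
From mathcomp Require Import measurable_realfun gauss_integral.

(* Assume that codes of energy below [e] exist for all large [n]; both constraints hold at
   [Ptot = e * mu * log2 M1], hence [Econv <= e].  For fixed seeds the inequalities below are
   affine in the number of undecoded users, so they survive averaging over the seeds.

   Constraint (1).  Let [S] be the users whose fading lies in a centred disc of probability
   [theta], reveal the messages of the others, and compare the output with a Gaussian vector of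
   variance [sg^2] centred at the conditional mean.  Under this reference law the decoded list is
   independent of the messages of [S], so that
     [score = #|S| ln (M / K) + K ln A - (number of undecoded users) * ln c]
   satisfies [E (exp score) <= 1], and [x + 1 <= e^x] with [x = score + ln (dQ / dP)] bounds the
   mean score.  The disc keeps the energy [E [|H|^2; S]] as small as possible, namely
   [alpha (1 - theta) 1].  The optimal [c] is [(1 - eps) (M1 - 1) / eps].

   Constraint (2).  Delete the signal of user [j]: its message becomes uniform on the [M - K + 1]
   values not taken by the other users, and the decoder hits it with probability at most
   [(K err + 1) / (M - K + 1)], which in the limit is at most [1 / M1] because
   [eps <= 1 - 1 / M1].  Neyman--Pearson then bounds the true hit probability.  Here [err] is the
   error of the system with one user deleted; it is compared with the true error through the
   users in a deep fade [|H|^2 <= delta], whose deletion is hardly visible and whose number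
   concentrates around a positive fraction of [K]. *)

Set Implicit Arguments.
Unset Strict Implicit.
Unset Printing Implicit Defensive.

Import Order.TTheory GRing.Theory Num.Theory.
Import numFieldNormedType.Exports.

Local Open Scope classical_set_scope.
Local Open Scope ring_scope.

(** * Gaussian laws on the line *)

(** The factor [A = c / (c + M1 - 1)] in the score is a normalization: a weight [c^-1] per missed
    user has mean [1 / (M1 * A)] when a hit has probability [1 / M1]. Two things prevent a mere
    product over users. Messages are drawn without replacement, so the hits are dependent; and the
    list has the fixed size [K], so every miss outside [S] frees an entry for a guess inside [S]. A
    comparison of moment generating functions settles the former; the penalty paid for the miss
    itself settles the latter.

    The Neyman--Pearson curve enters through its tangent at level [1 / M1]. A tangent is affine, so
    it survives averaging over fading, messages, users and seeds.

    Deleting a strong user may change the whole list, hence the detour through deep fades, where the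
    change is bounded by a total variation distance of order [sqrt delta]. The loss, however,
    depends on the same coefficients that decide who is weak; only the number of weak users can be
    decoupled from it, at a cost [sqrt K] per user deleted, to be compared with a loss of order [K].
    Therefore [n] tends to infinity before the fade threshold tends to 0. *)

Section lebesgue_affine.
Context {R : realType}.
Local Notation mu := (@lebesgue_measure R).
Local Open Scope ereal_scope.

Let affine (a b : R) (x : measurableTypeR R) : measurableTypeR R := (a * x + b)%R.

Let measurable_affine a b : measurable_fun setT (affine a b).
Proof. by apply: measurable_funD => //; exact: measurable_funM. Qed.

(** By uniqueness of Lebesgue measure it is enough to compare both sides on half-open intervals; a
    negative slope moves the closed end to the left, which does not change the length. *)
Lemma lebesgue_measure_affine (a b : R) (A : set (measurableTypeR R)) :
  a != 0%R -> measurable A ->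
  mu A = `|a|%R%:E * mu ((fun x => a * x + b)%R @^-1` A).
Proof.
move=> a0 mA.
pose phi : {mfun measurableTypeR R >-> measurableTypeR R} :=
  HB.pack (affine a b) (isMeasurableFun.Build _ _ _ _ _ (measurable_affine a b)).
have aK : (0 <= `|a|)%R by [].
pose nu : {measure set (measurableTypeR R) -> \bar R} :=
  mscale (NngNum aK) (pushforward mu phi).
rewrite (_ : _ * _ = nu (measurable_affine a b) A)//.
apply: lebesgue_measure_unique => // _ [[p q]] _ <-.
rewrite /nu /mscale/= /pushforward/=.
have [a_gt0|a_lt0|] := ltgtP 0%R a; last by move/esym/eqP; rewrite (negbTE a0).
- rewrite [X in _ = _ * lebesgue_measure X](_ : _ = `](p - b) / a, (q - b) / a]%classic)%R; last first.
    apply/seteqP; split => x /=; rewrite !in_itv/= /affine ltr_pdivrMr// ler_pdivlMr//;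
    by rewrite (mulrC x) ltrBlDr lerBrDr.
  rewrite !lebesgue_measure_itv/= !lte_fin ltr_pM2r ?invr_gt0// ltrD2r gtr0_norm//.
  case: ifP => _; last by rewrite mule0.
  by rewrite -!EFinD -EFinM; congr (_%:E); field.
- rewrite [X in _ = _ * lebesgue_measure X](_ : _ = `[(q - b) / a, (p - b) / a[%classic)%R; last first.
    apply/seteqP; split => x /=; rewrite !in_itv/= /affine ltr_ndivlMr// ler_ndivrMr//;
    by rewrite (mulrC x) ltrBlDr lerBrDr andbC.
  rewrite !lebesgue_measure_itv/= !lte_fin ltr_nM2r ?invr_lt0// ltrD2r ltr0_norm//.
  case: ifP => _; last by rewrite mule0.
  by rewrite -!EFinD -EFinM; congr (_%:E); field.
Qed.

Lemma ge0_integral_affine (a b : R) (f : R -> \bar R) : a != 0%R ->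
  measurable_fun setT f -> (forall x, 0 <= f x) ->
  `|a|%R%:E * \int[mu]_x f (a * x + b)%R = \int[mu]_x f x.
Proof.
move=> a0 mf f0.
pose phi : {mfun measurableTypeR R >-> measurableTypeR R} :=
  HB.pack (affine a b) (isMeasurableFun.Build _ _ _ _ _ (measurable_affine a b)).
have aK : (0 <= `|a|)%R by [].
pose nu : {measure set (measurableTypeR R) -> \bar R} :=
  mscale (NngNum aK) (pushforward mu phi).
transitivity (\int[nu (measurable_affine a b)]_x f x).
  rewrite /nu ge0_integral_mscale//= ge0_integral_pushforward//.
apply: eq_measure_integral => A mA _.
exact/esym/(lebesgue_measure_affine b a0 mA).
Qed.

End lebesgue_affine.

Section normal.
Context {R : realType}.
Local Notation mu := (@lebesgue_measure R).
Local Open Scope ereal_scope.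

(** The Radon--Nikodym derivative and [normal_pdf] have the same integral over every measurable set,
    so they agree almost everywhere. *)
Lemma ge0_integral_normal (m s : R) (f : R -> \bar R) :
  measurable_fun setT f -> (forall x, 0 <= f x) ->
  \int[normal_prob m s]_x f x = \int[mu]_x (f x * (normal_pdf m s x)%:E).
Proof.
move=> mf f0.
have dom := @normal_prob_dominates R m s.
rewrite -(Radon_Nikodym_SigmaFinite.change_of_variables dom)//.
apply: ae_eq_integral => //.
- by apply: emeasurable_funM => //; apply: measurable_int;
    exact: Radon_Nikodym_SigmaFinite.f_integrable.
- apply: emeasurable_funM => //; apply/measurable_EFinP.
  exact: measurable_normal_pdf.
- apply: ae_eqe_mul2l; apply: integral_ae_eq => //.
  + exact: Radon_Nikodym_SigmaFinite.f_integrable.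
  + by apply/measurable_EFinP; exact: measurable_normal_pdf.
  + by move=> E _ mE; rewrite -Radon_Nikodym_SigmaFinite.f_integral.
Qed.

End normal.

Lemma integral_prob_cst d (T : measurableType d) (R : realType)
  (P : probability T R) (c : \bar R) : (\int[P]_x c = c)%E.
Proof.
transitivity (c * 1)%E; last by rewrite mule1.
by rewrite -[1%E](probability_setT P); exact: integral_cst.
Qed.

Section normal_laws.
Context {R : realType}.
Local Notation mu := (@lebesgue_measure R).

Lemma normal_pdf_expR (s x : R) : 0 < s ->
  normal_pdf 0 s x = normal_peak s * expR (- (x ^+ 2) / (s ^+ 2 *+ 2)).
Proof. by move=> s0; rewrite normal_pdfE ?gt_eqF// /normal_fun subr0. Qed.

Lemma normal_pdf_gt0 (s x : R) : 0 < s -> 0 < normal_pdf 0 s x.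
Proof.
by move=> s0; rewrite normal_pdf_expR// mulr_gt0 ?expR_gt0// normal_peak_gt0 ?gt_eqF.
Qed.

Lemma normal_pdf1_expR (x : R) :
  normal_pdf 0 1 x = normal_peak 1 * expR (- (x ^+ 2) / 2).
Proof. by rewrite normal_pdf_expR// expr1n. Qed.

Lemma normal_peakE (s : R) : 0 < s -> normal_peak s = normal_peak 1 / s.
Proof.
move=> s0; rewrite /normal_peak -mulrnAr sqrtrM ?sqr_ge0// sqrtr_sqr gtr0_norm//.
by rewrite expr1n mul1r invfM mulrC.
Qed.

Lemma measurable_scale (c : R) : measurable_fun setT (fun x : R => c * x).
Proof. exact: measurable_funM. Qed.

Lemma measurable_affine (a b : R) : measurable_fun setT (fun x : R => a * x + b).
Proof. by apply: measurable_funD => //; exact: measurable_funM. Qed.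

Local Open Scope ereal_scope.

Lemma ge0_integral_normal_scale (s : R) (f : R -> \bar R) : (0 < s)%R ->
  measurable_fun setT f -> (forall x, 0 <= f x) ->
  \int[normal_prob 0 s]_x f x = \int[normal_prob 0 1]_x f (s * x)%R.
Proof.
move=> s0 mf f0.
have mfs : measurable_fun setT (fun x => f (s * x)%R).
  exact: (measurableT_comp mf (measurable_scale s)).
rewrite (ge0_integral_normal 0 s mf f0).
rewrite (ge0_integral_normal 0 1 mfs (fun x => f0 _)).
rewrite -[LHS](@ge0_integral_affine _ s 0); last 3 first.
- by rewrite gt_eqF.
- by apply: emeasurable_funM => //; apply/measurable_EFinP; exact: measurable_normal_pdf.
- by move=> x; rewrite mule_ge0// lee_fin normal_pdf_ge0.
rewrite -ge0_integralZl_EFin//; last 2 first.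
- by move=> x _; rewrite mule_ge0// lee_fin normal_pdf_ge0.
- apply: (measurableT_comp (f := fun x => f x * (normal_pdf 0 s x)%:E)).
    apply: emeasurable_funM => //; apply/measurable_EFinP; exact: measurable_normal_pdf.
  exact: measurable_affine.
apply: eq_integral => x _; rewrite addr0 gtr0_norm// muleCA -EFinM; congr (_ * _%:E).
rewrite normal_pdf_expR// normal_pdf1_expR normal_peakE//.
have -> : (- (s * x) ^+ 2 / (s ^+ 2 *+ 2) = - (x ^+ 2) / 2)%R by field; rewrite gt_eqF.
by field; rewrite gt_eqF.
Qed.

Lemma ge0_integral_normalN (s : R) (f : R -> \bar R) : (0 < s)%R ->
  measurable_fun setT f -> (forall x, 0 <= f x) ->
  \int[normal_prob 0 s]_x f (- x)%R = \int[normal_prob 0 s]_x f x.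
Proof.
move=> s0 mf f0.
rewrite (ge0_integral_normal 0 s mf f0).
rewrite (ge0_integral_normal 0 s
  (measurableT_comp mf (@oppr_measurable _ _)) (fun x => f0 _)).
rewrite -[RHS](@ge0_integral_affine _ (-1) 0); last 3 first.
- by rewrite oppr_eq0 oner_eq0.
- by apply: emeasurable_funM => //; apply/measurable_EFinP; exact: measurable_normal_pdf.
- by move=> x; rewrite mule_ge0// lee_fin normal_pdf_ge0.
rewrite normrN1 mul1e; apply: eq_integral => x _.
by rewrite addr0 mulN1r !normal_pdf_expR// sqrrN.
Qed.

(** Likelihood ratio for a shift combined with a change of variance. Equal variances give the shifts
    of the testing part, different ones the reference law of the Fano part. *)
Lemma normal_change (s0 s m : R) (f : R -> \bar R) : (0 < s0)%R -> (0 < s)%R ->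
  measurable_fun setT f -> (forall x, 0 <= f x) ->
  \int[normal_prob 0 s0]_x
     (f (x + m)%R * (normal_pdf 0 s (x + m) / normal_pdf 0 s0 x)%:E) =
  \int[normal_prob 0 s]_x f x.
Proof.
move=> s00 ss0 mf f0.
have mfm : measurable_fun setT (fun x : R => f (x + m)%R).
  by apply: (measurableT_comp mf); exact: measurable_funD.
have mpm : measurable_fun setT (fun x : R => normal_pdf 0 s (x + m)%R).
  by apply: (measurableT_comp (measurable_normal_pdf _ _)); exact: measurable_funD.
have mpV : measurable_fun setT (fun x : R => (normal_pdf 0 s0 x)^-1%R).
  rewrite (_ : (fun _ => _) = (fun x => (normal_peak s0)^-1 * expR (x ^+ 2 / (s0 ^+ 2 *+ 2)))%R).
    apply: measurable_funM => //; apply: (measurableT_comp (@measurable_expR _)).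
    by apply: measurable_funM => //; exact: measurable_funX.
  by apply/funext => x; rewrite normal_pdf_expR// invfM mulNr -expRN opprK.
rewrite (ge0_integral_normal 0 s mf f0).
rewrite (ge0_integral_normal 0 s0 (f := fun x => f (x + m)%R * _)); last 2 first.
- apply: emeasurable_funM => //; apply/measurable_EFinP; exact: measurable_funM.
- by move=> x; rewrite mule_ge0// lee_fin mulr_ge0 ?invr_ge0 ?normal_pdf_ge0.
rewrite -[RHS](@ge0_integral_affine _ 1 m)//; last 2 first.
- by apply: emeasurable_funM => //; apply/measurable_EFinP; exact: measurable_normal_pdf.
- by move=> x; rewrite mule_ge0// lee_fin normal_pdf_ge0.
rewrite normr1 mul1e; apply: eq_integral => x _; rewrite mul1r -muleA -EFinM divfK//.
by rewrite gt_eqF// normal_pdf_gt0.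
Qed.

(* Completing the square: [phi x * phi ((r u - a x) / b) = phi u * phi ((r x - a u) / b)]
   when [r ^ 2 = a ^ 2 + b ^ 2], and the last factor integrates to [|b| / r] in [x]. *)
Lemma normal_convolution (a b : R) (f : R -> \bar R) :
  measurable_fun setT f -> (forall x, 0 <= f x) ->
  \int[normal_prob 0 1]_x \int[normal_prob 0 1]_y f (a * x + b * y)%R =
  \int[normal_prob 0 1]_x f (Num.sqrt (a ^+ 2 + b ^+ 2) * x)%R.
Proof.
move=> mf f0; have mscale c : measurable_fun setT (fun x : R => f (c * x)%R).
  exact: (measurableT_comp mf (measurable_scale c)).
have [->|b0] := eqVneq b 0%R.
  under eq_integral do (under eq_integral do rewrite mul0r addr0;
    rewrite integral_prob_cst).
  rewrite expr0n addr0 sqrtr_sqr.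
  have [a0|a0] := leP 0%R a; first by rewrite ger0_norm.
  rewrite ltr0_norm// -(ge0_integral_normalN ltr01 (mscale a) (fun x => f0 _)).
  by apply: eq_integral => x _; rewrite mulrN mulNr.
have m1 c : measurable_fun setT (fun p : R * R => c * p.1)%R.
  exact: (measurableT_comp (measurable_scale c) measurable_fst).
have m2 c : measurable_fun setT (fun p : R * R => c * p.2)%R.
  exact: (measurableT_comp (measurable_scale c) measurable_snd).
set r := Num.sqrt _.
have r0 : (0 < r)%R by rewrite sqrtr_gt0 ltr_wpDl ?sqr_ge0// exprn_even_gt0.
have r2 : (r ^+ 2 = a ^+ 2 + b ^+ 2)%R by rewrite sqr_sqrtr// addr_ge0 ?sqr_ge0.
have r_neq0 : r != 0%R by rewrite gt_eqF.
pose phi := normal_pdf (0 : R) 1.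
have mphi := @measurable_normal_pdf R 0 1.
have phi0 x : (0 <= phi x)%R by exact: normal_pdf_ge0.
(* [K (x, u)] is the conditional density at [u] of [(a * x + b * y) / r] given [x], for [y] standard
   normal; it exists because [b] is nonzero here. *)
pose K (p : R * R) : R := (`|r / b| * phi (r / b * p.2 + - (a / b) * p.1))%R.
have K0 p : (0 <= K p)%R by rewrite mulr_ge0.
have mK : measurable_fun setT K.
  apply: measurable_funM => //; apply: (measurableT_comp mphi).
  by apply: measurable_funD.
have mF : measurable_fun setT (fun p : R * R => f (r * p.2)%R * (K p)%:E * (phi p.1)%:E).
  apply: emeasurable_funM; [apply: emeasurable_funM|].
  - exact: (measurableT_comp mf (m2 r)).
  - exact/measurable_EFinP.
  - by apply/measurable_EFinP; exact: (measurableT_comp mphi measurable_fst).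
transitivity (\int[mu]_x \int[mu]_u (f (r * u)%R * (K (x, u))%:E * (phi x)%:E)).
  have mL : measurable_fun setT (fun p : R * R => f (a * p.1 + b * p.2)%R).
    by apply: (measurableT_comp mf); exact: measurable_funD.
  rewrite (ge0_integral_normal 0 1 (f := fun x => \int[normal_prob 0 1]_y f (a * x + b * y)%R)); last 2 first.
  - exact: (measurable_fun_fubini_tonelli_F (m2 := normal_prob 0 1) _ mL).
  - by move=> x; exact: integral_ge0.
  apply: eq_integral => x _.
  have mLx : measurable_fun setT (fun y : R => f (a * x + b * y)%R).
    by apply: (measurableT_comp mf); apply: measurable_funD => //; exact: measurable_funM.
  rewrite (ge0_integral_normal 0 1 mLx (fun y => f0 _)).
  rewrite ge0_integralZr//; last 3 first.
  - apply: emeasurable_funM; first exact: mscale.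
    apply/measurable_EFinP; apply: (measurableT_comp mK); exact: pair1_measurable.
  - by move=> u _; rewrite mule_ge0 ?lee_fin.
  - by rewrite lee_fin.
  congr (_ * _).
  rewrite -(@ge0_integral_affine _ (r / b) (- (a / b) * x)); last 3 first.
  - by rewrite mulf_neq0// invr_eq0.
  - by apply: emeasurable_funM => //; apply/measurable_EFinP.
  - by move=> y; rewrite mule_ge0// lee_fin.
  rewrite -ge0_integralZl_EFin//; last 2 first.
  - by move=> u _; rewrite mule_ge0// lee_fin.
  - apply: (measurableT_comp (f := fun y => f (a * x + b * y)%R * (phi y)%:E)).
      by apply: emeasurable_funM => //; apply/measurable_EFinP.
    exact: measurable_affine.
  apply: eq_integral => u _; rewrite muleCA -EFinM; congr (f _ * _).
  by field.
transitivity (\int[mu]_u \int[mu]_x (f (r * u)%R * (K (x, u))%:E * (phi x)%:E)).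
  apply: (fubini_tonelli (m1 := mu) (m2 := mu)
    (fun p : R * R => f (r * p.2)%R * (K p)%:E * (phi p.1)%:E)) => // p.
  by rewrite !mule_ge0 ?lee_fin.
rewrite (ge0_integral_normal 0 1 (mscale r) (fun u => f0 _)).
apply: eq_integral => u _.
have KE x : (K (x, u) * phi x = phi u * (`|r / b| * phi (r / b * x + - (a / b) * u)))%R.
  rewrite /K /= -[LHS]mulrA [RHS]mulrCA; congr (_ * _)%R.
  rewrite /phi !normal_pdf1_expR.
  rewrite mulrACA [in RHS]mulrACA -!expRD; congr (_ * expR _)%R.
  have e y z : ((r / b * y + - (a / b) * z) ^+ 2 =
      (r ^+ 2 * y ^+ 2 - 2 * r * a * y * z + a ^+ 2 * z ^+ 2) / b ^+ 2)%R by field.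
  by rewrite !e r2; field.
under eq_integral do rewrite -muleA -EFinM KE EFinM muleA.
rewrite ge0_integralZl//; last 3 first.
- apply/measurable_EFinP; apply: measurable_funM => //.
  by apply: (measurableT_comp mphi); exact: measurable_affine.
- by move=> x _; rewrite lee_fin mulr_ge0.
- by rewrite mule_ge0 ?lee_fin.
rewrite [X in _ * X](_ : _ = 1) ?mule1//.
under eq_integral do rewrite EFinM.
rewrite ge0_integralZl_EFin//; last 2 first.
- by move=> x _; rewrite lee_fin.
- by apply/measurable_EFinP; apply: (measurableT_comp mphi); exact: measurable_affine.
rewrite (@ge0_integral_affine _ _ _ (EFin \o phi)).
- exact: integral_normal_pdf.
- by rewrite mulf_neq0// invr_eq0.
- exact/measurable_EFinP.
- by move=> x; rewrite lee_fin.
Qed.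

End normal_laws.

(** * The Gaussian tail function and the likelihood ratio test *)

Section gaussian_tail.
Context {R : realType}.
Local Notation N1 := (normal_prob (0 : R) 1).

Definition step (t x : R) : R := (t < x)%R%:R.

Lemma stepE t : step t = \1_`]t, +oo[%classic :> (R -> R).
Proof.
apply/funext => x; rewrite indicE /step; congr (_%:R); congr nat_of_bool.
by apply/idP/idP; rewrite inE/= in_itv/= andbT.
Qed.

Lemma measurable_step t : measurable_fun setT (step t).
Proof. by rewrite stepE; exact: measurable_indic. Qed.

Lemma step_ge0 t x : 0 <= step t x. Proof. exact: ler0n. Qed.

Lemma step_le1 t x : step t x <= 1. Proof. by rewrite /step; case: (_ < _). Qed.

Lemma QfunE t : (Qfun t)%:E = (\int[N1]_x (step t x)%:E)%E.
Proof.
rewrite stepE (integral_indic N1 measurableT)//= setIT /Qfun fineK//.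
by apply: fin_num_measure.
Qed.

Lemma Qfun_ge0 (t : R) : 0 <= Qfun t. Proof. exact: fine_ge0. Qed.

Lemma Qfun_le1 (t : R) : Qfun t <= 1.
Proof.
rewrite -lee_fin QfunE -(integral_prob_cst N1 1%:E); apply: ge0_le_integral => //.
- by move=> x _; rewrite lee_fin step_ge0.
- by apply/measurable_EFinP; exact: measurable_step.
- by move=> x _; rewrite lee_fin step_le1.
Qed.

Lemma Qfun_nonincreasing (s t : R) : s <= t -> Qfun t <= Qfun s.
Proof.
move=> st; rewrite -lee_fin !QfunE; apply: ge0_le_integral => //.
- by move=> x _; rewrite lee_fin step_ge0.
- by apply/measurable_EFinP; exact: measurable_step.
- by apply/measurable_EFinP; exact: measurable_step.
- move=> x _; rewrite lee_fin /step ler_nat; case: (ltP t x) => // tx.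
  by rewrite (le_lt_trans st tx).
Qed.

Lemma Qfun_lipschitz (s t : R) : s <= t ->
  Qfun s - Qfun t <= normal_peak 1 * (t - s).
Proof.
move=> st; rewrite lerBlDl -lee_fin EFinD.
have -> : (normal_peak 1 * (t - s))%:E =
    (\int[@lebesgue_measure R]_(x in `]s, t]) (normal_peak (1 : R))%:E)%E.
  rewrite integral_cst//= lebesgue_measure_itv/= lte_fin EFinM; case: ltP => // ts.
  have /eqP -> : t == s by rewrite eq_le st ts.
  by rewrite subrr mule0.
have -> : (Qfun s)%:E = ((Qfun t)%:E + N1 `]s, t]%classic)%E.
  rewrite /Qfun !fineK; [|exact: fin_num_measure..].
  rewrite -measureU//; last first.
    rewrite -subset0 => x [/=]; rewrite !in_itv/= andbT => tx /andP[_].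
    by rewrite leNgt tx.
  congr (N1 _); rewrite setUC -itv_bndbnd_setU// bnd_simp//.
apply: leeD2l; rewrite [leLHS]/(normal_prob _ _ _); apply: ge0_le_integral => //.
- by move=> x _; rewrite lee_fin normal_pdf_ge0.
- by apply/measurable_EFinP/measurable_funTS; exact: measurable_normal_pdf.
- by move=> x _; rewrite lee_fin normal_pdf_ub// oner_eq0.
Qed.

Lemma continuous_Qfun : continuous (@Qfun R).
Proof.
move=> x; apply/cvgrPdist_lt => e e0.
have p0 : 0 < normal_peak (1 : R) by rewrite normal_peak_gt0// oner_eq0.
near=> y.
have lip : `|Qfun x - Qfun y| <= normal_peak 1 * `|x - y|.
  have [xy|/ltW yx] := leP x y.
    rewrite ger0_norm ?subr_ge0 ?Qfun_nonincreasing//.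
    by rewrite distrC (ger0_norm (x := y - x)) ?subr_ge0// Qfun_lipschitz.
  rewrite distrC ger0_norm ?subr_ge0 ?Qfun_nonincreasing//.
  by rewrite (ger0_norm (x := x - y)) ?subr_ge0// Qfun_lipschitz.
apply: le_lt_trans lip _; rewrite mulrC -ltr_pdivlMr//.
by near: y; apply: cvgr_dist_lt => //; rewrite divr_gt0.
Unshelve. all: by end_near. Qed.

(** [Qinv] selects a preimage by choice, so the point is that one exists: the tail is continuous and
    tends to 1 and 0 at the two ends of the line. *)
Lemma QfunK (p : R) : 0 < p < 1 -> Qfun (Qinv p) = p.
Proof.
move=> /andP[p0 p1].
pose X : {mfun measurableTypeR R >-> R} :=
  HB.pack (idfun : measurableTypeR R -> R)
    (@isMeasurableFun.Build _ _ (measurableTypeR R) R (idfun : measurableTypeR R -> R)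
       (@measurable_id _ (measurableTypeR R) setT)).
have ccdfE x : ccdf (X : {RV N1 >-> R}) x = (Qfun x)%:E.
  by rewrite /ccdf /Qfun fineK//; apply: fin_num_measure.
have [a Qa] : exists a, Qfun a < p.
  have hU : nbhs (0%E : \bar R) [set y | (y < p%:E)%E].
    by apply: open_nbhs_nbhs; split; [exact: open_ereal_lt_ereal|rewrite /= lte_fin].
  have h : \forall x \near +oo%R, (ccdf (X : {RV N1 >-> R}) x < p%:E)%E :=
    cvg_ccdfy0 (X : {RV N1 >-> R}) hU.
  have [a] := filter_ex h.
  by move=> ha; exists a; rewrite -lte_fin -ccdfE.
have [b Qb] : exists b, p < Qfun b.
  have hU : nbhs (1%E : \bar R) [set y | (p%:E < y)%E].
    by apply: open_nbhs_nbhs; split; [exact: open_ereal_gt_ereal|rewrite /= lte_fin].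
  have h : \forall x \near -oo%R, (p%:E < ccdf (X : {RV N1 >-> R}) x)%E :=
    cvg_ccdfNy1 (X : {RV N1 >-> R}) hU.
  have [b] := filter_ex h.
  by move=> hb; exists b; rewrite -lte_fin -ccdfE.
have ba : b <= a.
  rewrite leNgt; apply/negP => ab.
  by have := le_lt_trans (Qfun_nonincreasing (ltW ab)) Qa; rewrite ltNge (ltW Qb).
have [c _ Qc] : exists2 c, c \in `[b, a] & Qfun c = p.
  apply: IVT => //; first by apply: continuous_subspaceT => x; exact: continuous_Qfun.
  by rewrite min_r ?max_l ?Qfun_nonincreasing// !ltW.
by rewrite /Qinv; apply: (@getPex _ (fun x => Qfun x = p)); exists c.
Qed.

Local Open Scope ereal_scope.

(** One-dimensional Cameron--Martin formula: the exponential is the density of [N(-d, 1)] relative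
    to [N(0, 1)]. *)
Lemma normal_shift (d : R) (f : R -> R) :
  measurable_fun setT f -> (forall x, 0 <= f x)%R ->
  \int[N1]_x (f (x + d) * expR (- d * x - d ^+ 2 / 2))%:E = \int[N1]_x (f x)%:E.
Proof.
move=> mf f0; rewrite -(@normal_change _ 1 1 d (EFin \o f))//; last exact/measurable_EFinP.
apply: eq_integral => x _; rewrite -EFinM; congr (_ * _)%:E.
rewrite !normal_pdf1_expR invfM mulrACA divff ?mul1r ?gt_eqF ?normal_peak_gt0 ?oner_eq0//.
by rewrite -expRN -expRD; congr expR; field.
Qed.

Lemma normal_shift_tail (d t : R) :
  \int[N1]_x (step t x * expR (- d * x - d ^+ 2 / 2))%:E = (Qfun (t + d))%:E.
Proof.
rewrite QfunE -(@normal_shift d); [|exact: measurable_step|exact: step_ge0].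
by apply: eq_integral => x _; rewrite /step ltrD2r.
Qed.

Lemma measurable_expR_affine (a b : R) :
  measurable_fun setT (fun x : R => expR (a * x + b)).
Proof. exact: (measurableT_comp (@measurable_expR R) (measurable_affine a b)). Qed.

(* The half line [x > tau - D] is the likelihood ratio test of [N(-D, 1)]
   against [N(0, 1)] at level [Qfun tau]. *)
Lemma likelihood_test (tau D lam : R) (b : R -> R) : (0 <= D)%R ->
  lam = expR (tau * D - D ^+ 2 / 2) ->
  measurable_fun setT b -> (forall x, 0 <= b x <= 1)%R ->
  \int[N1]_x (b x)%:E + (lam * Qfun tau)%:E <=
  (Qfun (tau - D))%:E + lam%:E * \int[N1]_x (b x * expR (- D * x - D ^+ 2 / 2))%:E.
Proof.
move=> D0 lamd mb b01.
have b0 x : (0 <= b x)%R by case/andP: (b01 x).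
have b1 x : (b x <= 1)%R by case/andP: (b01 x).
have lam0 : (0 <= lam)%R by rewrite lamd expR_ge0.
have mE := measurable_expR_affine (- D) (- (D ^+ 2 / 2)).
have mbE : measurable_fun setT (fun x => b x * expR (- D * x - D ^+ 2 / 2))%R.
  exact: measurable_funM.
have msE : measurable_fun setT (fun x => step (tau - D) x * expR (- D * x - D ^+ 2 / 2))%R.
  by apply: measurable_funM => //; exact: measurable_step.
rewrite QfunE EFinM -{1}(subrK D tau) -normal_shift_tail.
rewrite -!ge0_integralZl_EFin//; last 4 first.
- by move=> x _; rewrite lee_fin mulr_ge0 ?expR_ge0.
- exact/measurable_EFinP.
- by move=> x _; rewrite lee_fin mulr_ge0 ?expR_ge0 ?step_ge0.
- exact/measurable_EFinP.
have mlb : measurable_fun setT (fun x => lam%:E * (b x * expR (- D * x - D ^+ 2 / 2))%:E).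
  by apply: emeasurable_funM => //; exact/measurable_EFinP.
have mls : measurable_fun setT (fun x => lam%:E * (step (tau - D) x * expR (- D * x - D ^+ 2 / 2))%:E).
  by apply: emeasurable_funM => //; exact/measurable_EFinP.
have mst := measurable_step (tau - D).
rewrite -!ge0_integralD//; try exact/measurable_EFinP;
  try by [move=> x _; rewrite lee_fin ?step_ge0];
  try by [move=> x _; rewrite -EFinM lee_fin !mulr_ge0 ?expR_ge0 ?step_ge0].
apply: ge0_le_integral => //.
- move=> x _; rewrite adde_ge0// -?EFinM lee_fin// !mulr_ge0 ?expR_ge0 ?step_ge0//.
- by apply: emeasurable_funD => //; exact/measurable_EFinP.
- by apply: emeasurable_funD => //; exact/measurable_EFinP.
move=> x _; rewrite -!EFinM -!EFinD lee_fin.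
(* This is why [lam] has its form: [lam] times the likelihood ratio crosses 1 exactly at
   [tau - D]. *)
have lamE : (lam * expR (- D * x - D ^+ 2 / 2) = expR (D * ((tau - D) - x)))%R.
  by rewrite lamd -expRD; congr expR; field.
rewrite [X in (_ + X <= _)%R]mulrCA [X in (_ <= _ + X)%R]mulrCA lamE /step.
case: ltP => h.
  set e := expR _; have e1 : (e <= 1)%R.
    by rewrite -expR0 ler_expR mulr_ge0_le0// subr_le0 ltW.
  have : (0 <= (1 - b x) * (1 - e))%R by rewrite mulr_ge0// subr_ge0.
  by rewrite /= mulr1n mul1r; lra.
rewrite /= mulr0n mul0r addr0 add0r ler_peMr//.
by rewrite -expR0 ler_expR mulr_ge0// subr_ge0.
Qed.

(** Over all tests of [N(-d, 1)] against [N(0, 1)], the left side is the largest value of the power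
    minus [lam] times the level; the right side is that value for the shift [D]. It grows with the
    shift: the half line that is optimal for [d], moved by [d - D], has the same level against the
    shift [D] and at least the same power. *)
Lemma likelihood_excess (tau D d lam : R) : (0 <= d <= D)%R ->
  lam = expR (tau * D - D ^+ 2 / 2) ->
  \int[N1]_x (Num.max 0 (1 - lam * expR (- d * x - d ^+ 2 / 2)))%:E <=
  (Qfun (tau - D) - lam * Qfun tau)%:E.
Proof.
move=> /andP[d0 dD] lamd.
have D0 : (0 <= D)%R by exact: le_trans dD.
have lam0 : (0 < lam)%R by rewrite lamd expR_gt0.
(* Without a shift the likelihood ratio is constant and has no threshold; the constant tests 0 and 1
   bound the two arguments of the maximum. *)
have [/eqP de0|d_neq0] := boolP (d == 0%R).
  rewrite de0; under eq_integral do rewrite oppr0 mul0r expr0n mul0r subr0 expR0 mulr1.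
  rewrite integral_prob_cst lee_fin ge_max; apply/andP; split.
    have b01 (x : R) : (0 <= (0 : R) <= 1)%R by rewrite lexx ler01.
    have := @likelihood_test tau D lam (fun=> 0%R) D0 lamd (measurable_cst _) b01.
    have -> : \int[N1]_x (0 * expR (- D * x - D ^+ 2 / 2))%:E = 0.
      by under eq_integral do rewrite mul0r; rewrite integral_prob_cst.
    rewrite integral_prob_cst.
    by rewrite mule0 adde0 add0e lee_fin subr_ge0.
  have b01 (x : R) : (0 <= (1 : R) <= 1)%R by rewrite lexx ler01.
  have := @likelihood_test tau D lam (fun=> 1%R) D0 lamd (measurable_cst _) b01.
  have -> : \int[N1]_x (1 * expR (- D * x - D ^+ 2 / 2))%:E = 1.
    by rewrite (@normal_shift D (fun=> 1%R))//= integral_prob_cst.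
  rewrite integral_prob_cst mule1 -!EFinD lee_fin => h; clear b01; lra.
have d_gt0 : (0 < d)%R by rewrite lt_neqAle eq_sym d_neq0.
(* The point where [lam] times the likelihood ratio for the shift [d] equals 1. *)
pose t := ((tau * D - D ^+ 2 / 2 - d ^+ 2 / 2) / d)%R.
have lamE x : (lam * expR (- d * x - d ^+ 2 / 2) = expR (d * (t - x)))%R.
  by rewrite lamd -expRD; congr expR; rewrite /t; field.
have maxE x : (Num.max 0 (1 - lam * expR (- d * x - d ^+ 2 / 2)) +
    lam * (step t x * expR (- d * x - d ^+ 2 / 2)) = step t x)%R.
  rewrite mulrCA lamE /step; case: ltP => h.
    have : (expR (d * (t - x)) <= 1)%R.
      by rewrite -expR0 ler_expR mulr_ge0_le0// subr_le0 ltW.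
    by move=> e1; rewrite max_r ?subr_ge0// mul1r subrK.
  have : (1 <= expR (d * (t - x)))%R by rewrite -expR0 ler_expR mulr_ge0// subr_ge0.
  by move=> e1; rewrite max_l ?subr_le0// mul0r addr0.
have mE := measurable_expR_affine (- d) (- (d ^+ 2 / 2)).
have mmax : measurable_fun setT (fun x => Num.max 0 (1 - lam * expR (- d * x - d ^+ 2 / 2)))%R.
  by apply: measurable_maxr => //; apply: measurable_funB => //; exact: measurable_funM.
have eq : \int[N1]_x (Num.max 0 (1 - lam * expR (- d * x - d ^+ 2 / 2)))%:E +
    (lam * Qfun (t + d))%:E = (Qfun t)%:E.
  rewrite EFinM -normal_shift_tail -ge0_integralZl_EFin//; last 3 first.
  - by move=> x _; rewrite lee_fin mulr_ge0 ?expR_ge0 ?step_ge0.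
  - by apply/measurable_EFinP; apply: measurable_funM => //; exact: measurable_step.
  - exact: ltW.
  rewrite -ge0_integralD//.
  - by rewrite QfunE; apply: eq_integral => x _; rewrite -EFinM -EFinD maxE.
  - by move=> x _; rewrite lee_fin le_max lexx.
  - exact/measurable_EFinP.
  - by move=> x _; rewrite -EFinM lee_fin !mulr_ge0 ?expR_ge0 ?step_ge0 ?ltW.
  - apply: emeasurable_funM => //; apply/measurable_EFinP.
    by apply: measurable_funM => //; exact: measurable_step.
have b01 x : (0 <= step (t + d - D) x <= 1)%R by rewrite step_ge0 step_le1.
have := @likelihood_test tau D lam _ D0 lamd (measurable_step _) b01.
rewrite -QfunE normal_shift_tail subrK -EFinM -!EFinD lee_fin => test.
have Qt : (Qfun t <= Qfun (t + d - D))%R.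
  by apply: Qfun_nonincreasing; rewrite -addrA gerDl subr_le0.
rewrite -(leeD2rE (x := (lam * Qfun (t + d))%:E))// eq -EFinD lee_fin.
by clear b01; lra.
Qed.

End gaussian_tail.

(** * Complex Gaussian vectors *)

Section complex_parts.
Context {R : realType}.
Local Notation C := R[i].
Local Notation Re := (@complex.Re R).
Local Notation Im := (@complex.Im R).

Lemma Re_complexD (x y : C) : Re (x + y) = Re x + Re y. Proof. by case: x; case: y. Qed.
Lemma Im_complexD (x y : C) : Im (x + y) = Im x + Im y. Proof. by case: x; case: y. Qed.
Lemma Re_complexB (x y : C) : Re (x - y) = Re x - Re y. Proof. by case: x; case: y. Qed.
Lemma Im_complexB (x y : C) : Im (x - y) = Im x - Im y. Proof. by case: x; case: y. Qed.
Lemma Re_complexM (x y : C) : Re (x * y) = Re x * Re y - Im x * Im y.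
Proof. by case: x; case: y. Qed.
Lemma Im_complexM (x y : C) : Im (x * y) = Re x * Im y + Im x * Re y.
Proof. by case: x => a b; case: y => c e. Qed.

Lemma Re_sum (I : Type) (s : seq I) (P : pred I) (F : I -> C) :
  Re (\sum_(i <- s | P i) F i) = \sum_(i <- s | P i) Re (F i).
Proof. by apply: (big_morph Re Re_complexD). Qed.

Lemma Im_sum (I : Type) (s : seq I) (P : pred I) (F : I -> C) :
  Im (\sum_(i <- s | P i) F i) = \sum_(i <- s | P i) Im (F i).
Proof. by apply: (big_morph Im Im_complexD). Qed.

End complex_parts.

Section complex_measurability.
Context {R : realType}.

Lemma measurable_complex_coords : measurable_fun setT (@complex_coords R).
Proof.
move=> _ B mB; rewrite setTI.
by exists B => //; rewrite setTI.
Qed.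

Lemma measurable_Re : measurable_fun setT (fun z : R[i] => complex.Re z : R).
Proof. exact: (measurableT_comp measurable_fst measurable_complex_coords). Qed.

Lemma measurable_Im : measurable_fun setT (fun z : R[i] => complex.Im z : R).
Proof. exact: (measurableT_comp measurable_snd measurable_complex_coords). Qed.

Context d (T : measurableType d).
Implicit Types f g : T -> R[i].

Lemma measurable_complexP f :
  measurable_fun setT (fun x => complex.Re (f x) : R) ->
  measurable_fun setT (fun x => complex.Im (f x) : R) -> measurable_fun setT f.
Proof.
move=> mr mi; rewrite (_ : f = fun x => mkcomplex (complex.Re (f x), complex.Im (f x))).
  apply: (measurableT_comp (@measurable_mkcomplex R)).
  by apply/measurable_fun_pairP; split.
by apply/funext => x /=; rewrite /mkcomplex /=; case: (f x).
Qed.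

Lemma measurable_complexD f g : measurable_fun setT f -> measurable_fun setT g ->
  measurable_fun setT (fun x => f x + g x).
Proof.
move=> mf mg; apply: measurable_complexP.
- under eq_fun do rewrite Re_complexD; apply: measurable_funD; exact: (measurableT_comp measurable_Re).
- under eq_fun do rewrite Im_complexD; apply: measurable_funD; exact: (measurableT_comp measurable_Im).
Qed.

Lemma measurable_complexM f g : measurable_fun setT f -> measurable_fun setT g ->
  measurable_fun setT (fun x => f x * g x).
Proof.
move=> mf mg.
have mRf := measurableT_comp measurable_Re mf; have mIf := measurableT_comp measurable_Im mf.
have mRg := measurableT_comp measurable_Re mg; have mIg := measurableT_comp measurable_Im mg.
apply: measurable_complexP.
- by under eq_fun do rewrite Re_complexM; apply: measurable_funB; exact: measurable_funM.
- by under eq_fun do rewrite Im_complexM; apply: measurable_funD; exact: measurable_funM.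
Qed.

Lemma measurable_complex_sum (I : Type) (s : seq I) (f : I -> T -> R[i]) :
  (forall i, measurable_fun setT (f i)) ->
  measurable_fun setT (fun x => \sum_(i <- s) f i x).
Proof.
move=> mf; elim: s => [|i s IHs].
  by rewrite (_ : (fun _ => _) = cst 0)//; apply/funext => x; rewrite big_nil.
rewrite (_ : (fun _ => _) = fun x => f i x + \sum_(j <- s) f j x).
  exact: measurable_complexD.
by apply/funext => x; rewrite big_cons.
Qed.

End complex_measurability.

Lemma measurable_fin_valued d (T : measurableType d) (R : realType) (I : finType)
  (D : T -> I) (F : I -> R) : (forall i, measurable [set y | D y = i]) ->
  measurable_fun setT (fun y => F (D y)).
Proof.
move=> mD; rewrite (_ : (fun _ => _) = fun y => \sum_i F i * \1_[set y | D y = i] y).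
  by apply: measurable_sum => i; apply: measurable_funM => //; exact: measurable_indic.
apply/funext => y; rewrite (bigD1 (D y))//= big1 ?addr0.
  by rewrite indicE mem_set//= mulr1.
by move=> i iD; rewrite indicE memNset ?mulr0//= => e; move/eqP: iD; apply.
Qed.

Section complex_gaussian.
Context {R : realType}.
Local Notation C := R[i].

Definition sqc (z : C) : R := complex.Re z ^+ 2 + complex.Im z ^+ 2.

Lemma sqc_normc z : sqc z = Normc.normc z ^+ 2.
Proof.
by case: z => a b; rewrite /sqc /Normc.normc/= sqr_sqrtr// addr_ge0 ?sqr_ge0.
Qed.

Lemma sqc_ge0 z : 0 <= sqc z.
Proof. by rewrite addr_ge0 ?sqr_ge0. Qed.

Lemma sqcM (z w : C) : sqc (z * w) = sqc z * sqc w.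
Proof. by case: z => a b; case: w => e f; rewrite /sqc /=; ring. Qed.

Lemma measurable_sqc : measurable_fun setT sqc.
Proof.
by apply: measurable_funD; apply: measurable_funX;
  [exact: measurable_Re|exact: measurable_Im].
Qed.

(* [CN(0, 2 * s ^ 2)]. *)
Definition cgauss (s : R) : probability C R :=
  distribution (normal_prob 0 s \x normal_prob 0 s)%E mkcomplex.

(* The density of [CN(0, sg^2)] at [z + m] relative to that of [CN(0, 1)] at [z]. *)
Definition cdens (sg : R) (m z : C) : R :=
  expR (sqc z - sqc (m + z) / sg ^+ 2 - 2 * ln sg).

Lemma measurable_cdens sg m : measurable_fun setT (cdens sg m).
Proof.
apply: (measurableT_comp (@measurable_expR R)).
apply: measurable_funB => //; apply: measurable_funB; first exact: measurable_sqc.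
apply: measurable_funM => //; apply: (measurableT_comp measurable_sqc).
exact: measurable_complexD.
Qed.

Definition sd0 : R := Num.sqrt 2^-1.

Lemma sd0_gt0 : 0 < sd0. Proof. by rewrite sqrtr_gt0 invr_gt0. Qed.

Lemma sqr_sd0 : sd0 ^+ 2 = 2^-1. Proof. by rewrite sqr_sqrtr// invr_ge0. Qed.

Local Open Scope ereal_scope.

Lemma ge0_integral_cgauss s (f : C -> \bar R) :
  measurable_fun setT f -> (forall z, 0 <= f z) ->
  \int[cgauss s]_z f z =
  \int[normal_prob 0 s]_x \int[normal_prob 0 s]_y f (Complex x y).
Proof.
move=> mf f0; rewrite /cgauss ge0_integral_distribution//.
apply: (fubini_tonelli1 (fun p => f (mkcomplex p))) => //.
exact: (measurableT_comp mf (@measurable_mkcomplex R)).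
Qed.

Lemma ge0_integral_cnormal (f : C -> \bar R) :
  measurable_fun setT f -> (forall z, 0 <= f z) ->
  \int[cnormal_prob]_z f z =
  \int[normal_prob 0 sd0]_x \int[normal_prob 0 sd0]_y f (Complex x y).
Proof. exact: (@ge0_integral_cgauss sd0). Qed.

(** [normal_change] in each real coordinate. The variance 1/2 leaves plain squares in the exponent,
    and the two factors [sg^-1] make up the term [- 2 * ln sg] of [cdens]. *)
Lemma cgauss_change (sg : R) (m : C) (f : C -> \bar R) : (0 < sg)%R ->
  measurable_fun setT f -> (forall z, 0 <= f z) ->
  \int[cnormal_prob]_z (f (m + z)%R * (cdens sg m z)%:E) =
  \int[cgauss (sg * sd0)]_z f z.
Proof.
move=> sg0 mf f0; case: m => a b.
have s00 : (0 < sg * sd0)%R by rewrite mulr_gt0// sd0_gt0.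
pose q c (x : R) := (normal_pdf 0 (sg * sd0) (x + c) / normal_pdf 0 sd0 x)%R.
have q0 c x : (0 <= q c x)%R by rewrite mulr_ge0 ?invr_ge0 ?normal_pdf_ge0.
have qE c x : (q c x = sg^-1 * expR (x ^+ 2 - (x + c) ^+ 2 / sg ^+ 2))%R.
  rewrite /q !normal_pdf_expR ?sd0_gt0// normal_peakE// [normal_peak sd0]normal_peakE ?sd0_gt0//.
  rewrite (invfM (normal_peak 1 / sd0)%R) mulrACA -expRN -expRD exprMn sqr_sd0 -[in LHS](mulr_natr (_ * _)%R) -[in LHS](mulr_natr 2^-1%R); congr (_ * expR _)%R.
    have p0 : normal_peak (1 : R) != 0%R by rewrite gt_eqF// normal_peak_gt0 ?oner_eq0.
    by field; rewrite p0 !gt_eqF// sd0_gt0.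
  by field; rewrite gt_eqF.
have mq c : measurable_fun setT (q c).
  rewrite (_ : q c = fun x => (sg^-1 * expR (x ^+ 2 - (x + c) ^+ 2 / sg ^+ 2))%R); last first.
    by apply/funext => x; rewrite qE.
  apply: measurable_funM => //; apply: (measurableT_comp (@measurable_expR R)).
  apply: measurable_funB => //; apply: measurable_funM => //; apply: measurable_funX.
  exact: measurable_funD.
have densE x y : cdens sg (Complex a b) (Complex x y) = (q a x * q b y)%R.
  rewrite !qE mulrACA -expRD /cdens /sqc /=.
  rewrite -(lnK (x := sg^-1%R)) ?posrE ?invr_gt0// -!expRD lnV ?posrE//; congr expR.
  by field; rewrite gt_eqF.
pose G z := f (Complex a b + z)%R * (cdens sg (Complex a b) z)%:E.
have mG : measurable_fun setT G.
  apply: emeasurable_funM; last by apply/measurable_EFinP; exact: measurable_cdens.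
  by apply: (measurableT_comp mf); exact: measurable_complexD.
have G0 z : 0 <= G z by rewrite mule_ge0// lee_fin expR_ge0.
apply: (etrans (ge0_integral_cnormal mG G0)).
apply/esym/(etrans (ge0_integral_cgauss (sg * sd0) mf f0))/esym.
have mC : measurable_fun setT (fun p : measurableTypeR R * measurableTypeR R => f (Complex p.1 p.2)).
  exact: (measurableT_comp mf (@measurable_mkcomplex R)).
have mF : measurable_fun setT (fun x => \int[normal_prob 0 (sg * sd0)]_y f (Complex x y)).
  exact: (measurable_fun_fubini_tonelli_F (m2 := normal_prob 0 (sg * sd0)) _ mC).
have F0 x : 0 <= \int[normal_prob 0 (sg * sd0)]_y f (Complex x y).
  exact: integral_ge0.
apply/(etrans _ (normal_change a sd0_gt0 s00 mF F0)); apply: eq_integral => x _.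
have mfx c : measurable_fun setT (fun y : measurableTypeR R => f (Complex c y)).
  exact: (measurableT_comp mC (pair1_measurable c)).
have mfxb : measurable_fun setT (fun y : measurableTypeR R => f (Complex (x + a) (y + b))%R).
  by apply: (measurableT_comp (mfx _)); exact: measurable_funD.
rewrite -(normal_change b sd0_gt0 s00 (mfx _) (fun y => f0 _)).
rewrite -ge0_integralZr//; last 3 first.
- by apply: emeasurable_funM => //; apply/measurable_EFinP; exact: mq.
- by move=> y _; rewrite mule_ge0// lee_fin; exact: q0.
- by rewrite lee_fin; exact: q0.
apply: eq_integral => y _.
rewrite /G densE EFinM -muleA [X in _ = _ * X]muleC; congr (f _ * _).
by apply/eqP; rewrite eq_complex/= !(addrC a) !(addrC b) !eqxx.
Qed.

End complex_gaussian.

(** * Integration against i.i.d. laws *)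

Section iid_integration.
Context d (T : measurableType d) (R : realType) (P : probability T R).

Lemma ge0_integral_iid0 (f : 0.-tuple T -> \bar R) :
  measurable_fun setT f -> (\int[iid_prob P 0]_h f h = f [tuple])%E.
Proof.
move=> mf; rewrite /= (integral_dirac _ measurableT mf) diracE mem_set// mul1e.
by [].
Qed.

Lemma ge0_integral_iidS n (f : n.+1.-tuple T -> \bar R) :
  measurable_fun setT f -> (forall h, 0 <= f h)%E ->
  (\int[iid_prob P n.+1]_h f h =
   \int[P]_x \int[iid_prob P n]_t f (tcons (x, t)))%E.
Proof.
move=> mf f0; rewrite /= ge0_integral_distribution//.
apply: (fubini_tonelli1 (fun p => f (tcons p))) => //.
exact: (measurableT_comp mf (@measurable_tcons _ T n)).
Qed.

Lemma measurable_fun_tcons n x (f : n.+1.-tuple T -> \bar R) :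
  measurable_fun setT f -> measurable_fun setT (fun t => f (tcons (x, t))).
Proof.
move=> mf; apply: (measurableT_comp mf).
exact: (measurableT_comp (@measurable_tcons _ T n) (@pair1_measurable _ _ _ _ x)).
Qed.

Lemma measurable_integral_tcons n (f : n.+1.-tuple T -> \bar R) :
  measurable_fun setT f -> (forall h, 0 <= f h)%E ->
  measurable_fun setT (fun x => \int[iid_prob P n]_t f (tcons (x, t)))%E.
Proof.
move=> mf f0.
apply: (measurable_fun_fubini_tonelli_F (m2 := iid_prob P n) (fun p => f (tcons p))) => //.
exact: (measurableT_comp mf (@measurable_tcons _ T n)).
Qed.

Definition tset n (h : n.-tuple T) (i : 'I_n) (x : T) : n.-tuple T :=
  [tuple if j == i then x else tnth h j | j < n].

Lemma tnth_tset n (h : n.-tuple T) i x j :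
  tnth (tset h i x) j = if j == i then x else tnth h j.
Proof. by rewrite tnth_mktuple. Qed.

Lemma tnth_tcons0 n (t : n.-tuple T) x : tnth (tcons (x, t)) ord0 = x.
Proof. exact: tnth0. Qed.

Lemma tnth_tconsS n (t : n.-tuple T) x i : tnth (tcons (x, t)) (lift ord0 i) = tnth t i.
Proof. exact: tnthS. Qed.

Lemma tset_tcons0 n (t : n.-tuple T) x y : tset (tcons (x, t)) ord0 y = tcons (y, t).
Proof.
apply: eq_from_tnth => j; rewrite tnth_tset /tcons/=.
by have [j' ->|->] := unliftP ord0 j; rewrite ?tnthS ?tnth0// eqxx.
Qed.

Lemma tset_tconsS n (t : n.-tuple T) x y (i : 'I_n) :
  tset (tcons (x, t)) (lift ord0 i) y = tcons (x, tset t i y).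
Proof.
apply: eq_from_tnth => j; rewrite tnth_tset /tcons/=.
have [j' ->|->] := unliftP ord0 j; last by rewrite !tnth0.
by rewrite !tnthS tnth_tset (inj_eq lift_inj).
Qed.

Lemma measurable_tset n (i : 'I_n) :
  measurable_fun setT (fun p : n.-tuple T * T => tset p.1 i p.2).
Proof.
apply/measurable_fun_tnthP => j.
rewrite (_ : _ \o _ = fun p : n.-tuple T * T => if j == i then p.2 else tnth p.1 j).
  case: eqP => _; first exact: measurable_snd.
  exact: (measurableT_comp (measurable_tnth j) measurable_fst).
by apply/funext => p /=; rewrite tnth_tset.
Qed.

(** A fresh draw in one coordinate leaves the product law unchanged. The marginal laws and the
    independence of a coordinate from the others are both read off from this identity. *)
Lemma iid_resample n (i : 'I_n) (f : n.-tuple T -> \bar R) :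
  measurable_fun setT f -> (forall h, 0 <= f h)%E ->
  (\int[iid_prob P n]_h \int[P]_x f (tset h i x) = \int[iid_prob P n]_h f h)%E.
Proof.
elim: n i f => [[]//|n IHn] i f mf f0.
have mset : measurable_fun setT (fun p : n.+1.-tuple T * T => f (tset p.1 i p.2)).
  exact: (measurableT_comp mf (measurable_tset i)).
have mint : measurable_fun setT (fun h : n.+1.-tuple T => \int[P]_x f (tset h i x))%E.
  exact: (measurable_fun_fubini_tonelli_F (m2 := P) _ mset).
have f0' h : (0 <= \int[P]_x f (tset h i x))%E by exact: integral_ge0.
rewrite (ge0_integral_iidS mint f0') (ge0_integral_iidS mf f0).
have [i' ->|->] := unliftP ord0 i; last first.
  under eq_integral do under eq_integral do under eq_integral do rewrite tset_tcons0.
  rewrite integral_prob_cst.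
  rewrite (fubini_tonelli (fun p : n.-tuple T * T => f (tcons (p.2, p.1))))//.
  exact: (measurableT_comp mf (measurableT_comp (@measurable_tcons _ T n) (@measurable_swap _ _ _ _))).
apply: eq_integral => x _.
under eq_integral do under eq_integral do rewrite tset_tconsS.
rewrite (IHn i' (fun t => f (tcons (x, t))))//.
exact: measurable_fun_tcons.
Qed.

Lemma iid_marginal n (i : 'I_n) (g : T -> \bar R) :
  measurable_fun setT g -> (forall x, 0 <= g x)%E ->
  (\int[iid_prob P n]_h g (tnth h i) = \int[P]_x g x)%E.
Proof.
move=> mg g0; rewrite -(@iid_resample n i (fun h => g (tnth h i)))//; last first.
  exact: (measurableT_comp mg (measurable_tnth i)).
under eq_integral do under eq_integral do rewrite tnth_tset eqxx.
by rewrite integral_prob_cst.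
Qed.

End iid_integration.

Opaque iid_prob cgauss cnormal_prob normal_prob.

(** * Complex Gaussian vectors: change of law and linear functionals *)

Section gaussian_vectors.
Context {R : realType}.
Local Notation C := R[i].

Definition tadd n (a z : n.-tuple C) : n.-tuple C :=
  [tuple tnth a t + tnth z t | t < n].

Lemma tnth_tadd n (a z : n.-tuple C) t : tnth (tadd a z) t = tnth a t + tnth z t.
Proof. by rewrite tnth_mktuple. Qed.

Lemma measurable_tadd n (a : n.-tuple C) : measurable_fun setT (tadd a).
Proof.
apply/measurable_fun_tnthP => t.
rewrite (_ : _ \o _ = fun z => tnth a t + tnth z t); last first.
  by apply/funext => z /=; rewrite tnth_tadd.
by apply: measurable_complexD => //; exact: measurable_tnth.
Qed.

Lemma tadd_tcons n (m t : n.-tuple C) x y :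
  tadd (tcons (x, m)) (tcons (y, t)) = tcons (x + y, tadd m t).
Proof.
apply: eq_from_tnth => j; rewrite tnth_tadd /tcons/=.
by have [j' ->|->] := unliftP ord0 j; rewrite ?tnth0 ?tnthS ?tnth_tadd.
Qed.

Lemma tuple_tcons n (m : n.+1.-tuple C) : {xm | m = tcons xm}.
Proof. by case/tupleP: m => x m; exists (x, m). Qed.

Definition tdens (sg : R) n (m z : n.-tuple C) : R := \prod_(t < n) cdens sg (tnth m t) (tnth z t).

Lemma tdens_tcons sg n (m t : n.-tuple C) x y :
  tdens sg (tcons (x, m)) (tcons (y, t)) = cdens sg x y * tdens sg m t.
Proof.
rewrite /tdens big_ord_recl /tcons/= !tnth0; congr (_ * _).
by apply: eq_bigr => i _; rewrite !tnthS.
Qed.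

Lemma tdens_ge0 sg n (m z : n.-tuple C) : 0 <= tdens sg m z.
Proof. by apply: prodr_ge0 => t _; exact: expR_ge0. Qed.

Lemma measurable_tdens sg n (m : n.-tuple C) : measurable_fun setT (tdens sg m).
Proof.
rewrite (_ : tdens sg m = fun z => expR (\sum_(t < n)
    (sqc (tnth z t) - sqc (tnth m t + tnth z t) / sg ^+ 2 - 2 * ln sg))).
  apply: (measurableT_comp (@measurable_expR R)).
  apply: measurable_sum => t.
  have mt := @measurable_tnth _ C n t.
  apply: measurable_funB => //; apply: measurable_funB.
    exact: (measurableT_comp (@measurable_sqc R) mt).
  apply: measurable_funM => //; apply: (measurableT_comp (@measurable_sqc R)).
  exact: measurable_complexD.
by apply/funext => z; rewrite expR_sum.
Qed.

Lemma iid_change (sg : R) n (m : n.-tuple C) (f : n.-tuple C -> \bar R) : 0 < sg ->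
  measurable_fun setT f -> (forall z, 0 <= f z)%E ->
  (\int[iid_prob cnormal_prob n]_z (f (tadd m z) * (tdens sg m z)%:E) =
   \int[iid_prob (cgauss (sg * sd0)) n]_z f z)%E.
Proof.
move=> sg0; elim: n m f => [|n IHn] m f mf f0.
  have mG : measurable_fun setT (fun z : 0.-tuple C => f (tadd m z) * (tdens sg m z)%:E)%E.
    apply: emeasurable_funM; first exact: (measurableT_comp mf (measurable_tadd m)).
    by apply/measurable_EFinP; exact: measurable_tdens.
  rewrite !ge0_integral_iid0// /tdens big_ord0 mule1; congr f.
  by rewrite [LHS]tuple0.
have [[x m'] ->] := tuple_tcons m.
have mG : measurable_fun setT (fun z => f (tadd (tcons (x, m')) z) * (tdens sg (tcons (x, m')) z)%:E)%E.
  apply: emeasurable_funM; first exact: (measurableT_comp mf (measurable_tadd _)).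
  by apply/measurable_EFinP; exact: measurable_tdens.
have G0 z : (0 <= f (tadd (tcons (x, m')) z) * (tdens sg (tcons (x, m')) z)%:E)%E.
  by rewrite mule_ge0// lee_fin tdens_ge0.
apply: (etrans (ge0_integral_iidS _ mG G0)).
apply/esym/(etrans (ge0_integral_iidS _ mf f0)).
have F0 y : (0 <= \int[iid_prob (cgauss (sg * sd0)) n]_t f (tcons (y, t)))%E.
  exact: integral_ge0.
apply/esym/(etrans _ (cgauss_change x sg0 (measurable_integral_tcons _ mf f0) F0)).
apply: eq_integral => y _.
have E t : (f (tadd (tcons (x, m')) (tcons (y, t))) *
      (tdens sg (tcons (x, m')) (tcons (y, t)))%:E =
    f (tcons ((x + y)%R, tadd m' t)) * (tdens sg m' t)%:E * (cdens sg x y)%:E)%E.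
  by rewrite tadd_tcons tdens_tcons -muleA -EFinM [X in (_ * X%:E)%E]mulrC.
apply: (etrans (eq_integral _ _ (fun t _ => E t))).
have mfy := measurable_fun_tcons (x + y) mf.
have mH : measurable_fun setT (fun t =>
    f (tcons ((x + y)%R, tadd m' t)) * (tdens sg m' t)%:E)%E.
  apply: emeasurable_funM; first exact: (measurableT_comp mfy (measurable_tadd _)).
  by apply/measurable_EFinP; exact: measurable_tdens.
have H0 t : (0 <= f (tcons ((x + y)%R, tadd m' t)) * (tdens sg m' t)%:E)%E.
  by rewrite mule_ge0// lee_fin tdens_ge0.
have c0 : (0 <= (cdens sg x y)%:E)%E by rewrite lee_fin expR_ge0.
apply: (etrans (ge0_integralZr (iid_prob cnormal_prob n) measurableT mH (fun t _ => H0 t) c0)).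
exact: (congr1 (fun e => e * (cdens sg x y)%:E)%E
  (IHn m' (fun t => f (tcons ((x + y)%R, t))) mfy (fun t => f0 _))).
Qed.

Definition tdot n (m z : n.-tuple C) : R := \sum_(t < n)
  (complex.Re (tnth m t) * complex.Re (tnth z t) + complex.Im (tnth m t) * complex.Im (tnth z t)).

Lemma sqnormE n (m : n.-tuple C) : sqnorm m = \sum_(t < n) sqc (tnth m t).
Proof. by apply: eq_bigr => t _; rewrite sqc_normc. Qed.

Lemma sqnorm_ge0 n (m : n.-tuple C) : 0 <= sqnorm m.
Proof. by rewrite sqnormE sumr_ge0// => t _; exact: sqc_ge0. Qed.

Lemma measurable_tdot n (m : n.-tuple C) : measurable_fun setT (tdot m).
Proof.
apply: measurable_sum => t; have mt := @measurable_tnth _ C n t.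
apply: measurable_funD; apply: measurable_funM => //.
  exact: (measurableT_comp (@measurable_Re R) mt).
exact: (measurableT_comp (@measurable_Im R) mt).
Qed.

(** Each complex coordinate contributes two independent real Gaussians of variance 1/2, merged one
    at a time with the rest by [normal_convolution]; hence the total variance [sqnorm m / 2]. *)
Lemma iid_linear_law n (m : n.-tuple C) (f : R -> \bar R) :
  measurable_fun setT f -> (forall x, 0 <= f x)%E ->
  (\int[iid_prob cnormal_prob n]_z f (tdot m z) =
   \int[normal_prob 0 1]_x f (Num.sqrt (sqnorm m / 2) * x)%R)%E.
Proof.
elim: n m f => [|n IHn] m f mf f0.
  rewrite ge0_integral_iid0; last exact: (measurableT_comp mf (measurable_tdot _)).
  rewrite /tdot /sqnorm !big_ord0 mul0r sqrtr0.
  by under eq_integral do rewrite mul0r; rewrite integral_prob_cst.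
have [[[a b] m'] ->] := tuple_tcons m.
have mscale c : measurable_fun setT (fun x : R => f (c * x)).
  exact: (measurableT_comp mf (measurable_scale c)).
have dotE x y t : tdot (tcons (Complex a b, m')) (tcons (Complex x y, t)) =
    a * x + b * y + tdot m' t.
  rewrite /tdot big_ord_recl !tnth_tcons0; congr (_ + _).
  by apply: eq_bigr => i _; rewrite !tnth_tconsS.
have normE : sqnorm (tcons (Complex a b, m')) = a ^+ 2 + b ^+ 2 + sqnorm m'.
  rewrite !sqnormE big_ord_recl tnth_tcons0; congr (_ + _).
  by apply: eq_bigr => i _; rewrite !tnth_tconsS.
have mF : measurable_fun setT (fun z => f (tdot (tcons (Complex a b, m')) z)).
  exact: (measurableT_comp mf (measurable_tdot _)).
have F0 z : (0 <= \int[iid_prob cnormal_prob n]_t f (tdot (tcons (Complex a b, m')) (tcons (z, t))))%E.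
  exact: integral_ge0.
apply: (etrans (ge0_integral_iidS _ mF (fun z => f0 _))).
apply: (etrans (ge0_integral_cnormal (measurable_integral_tcons _ mF (fun z => f0 _)) F0)).
pose r := Num.sqrt (sqnorm m' / 2).
have mfc c : measurable_fun setT (fun x : R => f (c + x)).
  by apply: (measurableT_comp mf); exact: measurable_funD.
have mfcr c : measurable_fun setT (fun x : R => f (c + r * x)).
  by apply: (measurableT_comp (mfc c)); exact: measurable_scale.
transitivity (\int[normal_prob 0 sd0]_x \int[normal_prob 0 sd0]_y
    \int[normal_prob 0 1]_v f ((a * x + b * y) + r * v)%R)%E.
  apply: eq_integral => x _; apply: eq_integral => y _.
  under eq_integral do rewrite dotE.
  by rewrite (IHn m' (fun v => f (a * x + b * y + v))).
pose G (x : R) := (\int[normal_prob 0 1]_v f (a * x + Num.sqrt ((b * sd0) ^+ 2 + r ^+ 2) * v)%R)%E.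
have mpG c e : measurable_fun setT (fun p : R * R => f (c * p.1 + e * p.2)).
  by apply: (measurableT_comp mf); apply: measurable_funD; apply: measurable_funM.
have mfy x : measurable_fun setT (fun y => \int[normal_prob 0 1]_v f ((a * x + b * y) + r * v)%R)%E.
  apply: (measurable_fun_fubini_tonelli_F (m2 := normal_prob (0 : R) 1)
    (fun p : R * R => f (a * x + b * p.1 + r * p.2))) => //.
  apply: (measurableT_comp mf); apply: measurable_funD; last exact: measurable_funM.
  by apply: measurable_funD => //; exact: measurable_funM.
have fy0 x y : (0 <= \int[normal_prob 0 1]_v f ((a * x + b * y) + r * v)%R)%E.
  exact: integral_ge0.
transitivity (\int[normal_prob 0 sd0]_x G x)%E.
  apply: eq_integral => x _.
  apply: (etrans (ge0_integral_normal_scale sd0_gt0 (mfy x) (fy0 x))).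
  apply: (etrans _ (normal_convolution (b * sd0) r (mfc (a * x)) (fun v => f0 _))).
  by apply: eq_integral => y _; apply: eq_integral => v _; rewrite mulrA addrA.
have mG : measurable_fun setT G.
  exact: (measurable_fun_fubini_tonelli_F (m2 := normal_prob (0 : R) 1) _ (mpG a _)).
have G0 x : (0 <= G x)%E by exact: integral_ge0.
apply: (etrans (ge0_integral_normal_scale sd0_gt0 mG G0)); rewrite normE.
transitivity (\int[normal_prob 0 1]_x \int[normal_prob 0 1]_v
    f ((a * sd0) * x + Num.sqrt ((b * sd0) ^+ 2 + r ^+ 2) * v)%R)%E.
  by apply: eq_integral => x _; apply: eq_integral => v _; rewrite mulrA.
apply: (etrans (normal_convolution _ _ mf f0)); apply: eq_integral => x _; congr (f (Num.sqrt _ * _)).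
rewrite sqr_sqrtr ?addr_ge0 ?sqr_ge0// sqr_sqrtr ?divr_ge0 ?sqnorm_ge0//.
by rewrite !exprMn sqr_sd0; field.
Qed.

End gaussian_vectors.

Transparent iid_prob cgauss cnormal_prob normal_prob.

(** * Expectations *)

Section expectation.
Context d (T : measurableType d) (R : realType) (P : probability T R).
Implicit Types f g : T -> R.

Definition intble f := P.-integrable setT (EFin \o f).

(** [fine] maps an infinite integral to 0, so linearity and monotonicity of [ex] are stated under
    [intble]. *)
Definition ex f : R := fine (\int[P]_x (f x)%:E)%E.

Lemma intble_measurable f : intble f -> measurable_fun setT f.
Proof. by move=> /integrableP[/measurable_EFinP]. Qed.

Lemma exE f : intble f -> (\int[P]_x (f x)%:E)%E = (ex f)%:E.
Proof. by move=> fi; rewrite fineK//; exact: (integrable_fin_num measurableT fi). Qed.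

Lemma intble_ge0 f r : measurable_fun setT f -> (forall x, 0 <= f x) ->
  (\int[P]_x (f x)%:E)%E = r%:E -> intble f.
Proof.
move=> mf f0 fr; apply/integrableP; split; first exact/measurable_EFinP.
under eq_integral do rewrite /= ger0_norm//.
by rewrite fr ltry.
Qed.

Lemma ex_eq f r : (\int[P]_x (f x)%:E)%E = r%:E -> ex f = r.
Proof. by rewrite /ex => ->. Qed.

Lemma intble_cst c : intble (fun=> c).
Proof. exact: finite_measure_integrable_cst. Qed.

Lemma intbleD f g : intble f -> intble g -> intble (fun x => f x + g x).
Proof. by move=> fi gi; exact: (integrableD measurableT fi gi). Qed.

Lemma intbleZ c f : intble f -> intble (fun x => c * f x).
Proof. by move=> fi; exact: (integrableZl measurableT c fi). Qed.

Lemma intbleN f : intble f -> intble (fun x => - f x).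
Proof. by move=> fi; exact: (integrableN fi). Qed.

Lemma intbleB f g : intble f -> intble g -> intble (fun x => f x - g x).
Proof. by move=> fi gi; apply: intbleD => //; exact: intbleN. Qed.

Lemma intble_sum (I : Type) (s : seq I) (p : pred I) (f : I -> T -> R) :
  (forall i, intble (f i)) -> intble (fun x => \sum_(i <- s | p i) f i x).
Proof.
move=> fi; elim: s => [|i s IHs].
  rewrite (_ : (fun _ => _) = fun=> 0); first exact: intble_cst.
  by apply/funext => x; rewrite big_nil.
case pi : (p i); last first.
  rewrite (_ : (fun _ => _) = (fun x => \sum_(j <- s | p j) f j x))//.
  by apply/funext => x; rewrite big_cons pi.
rewrite (_ : (fun _ => _) = (fun x => f i x + \sum_(j <- s | p j) f j x)).
  exact: intbleD.
by apply/funext => x; rewrite big_cons pi.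
Qed.

Lemma intble_bounded f M : measurable_fun setT f -> (forall x, `|f x| <= M) -> intble f.
Proof.
move=> mf fM.
apply: (le_integrable measurableT _ _ (intble_cst M)); first exact/measurable_EFinP.
move=> x _ /=; rewrite lee_fin.
exact: le_trans (fM x) (ler_norm M).
Qed.

Lemma intble_le f g : measurable_fun setT f -> (forall x, 0 <= f x <= g x) ->
  intble g -> intble f.
Proof.
move=> mf fg; apply: (le_integrable measurableT); first exact/measurable_EFinP.
move=> x _ /=; have /andP[f0 fgx] := fg x.
by rewrite lee_fin !ger0_norm// (le_trans f0 fgx).
Qed.

Lemma intble01 f : measurable_fun setT f -> (forall x, 0 <= f x <= 1) -> intble f.
Proof.
move=> mf f01; apply: (@intble_bounded _ 1) => // x; have /andP[f0 f1] := f01 x.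
by rewrite ger0_norm.
Qed.

Lemma ex_cst c : ex (fun=> c) = c.
Proof. by apply: ex_eq; exact: integral_prob_cst. Qed.

Lemma exD f g : intble f -> intble g -> ex (fun x => f x + g x) = ex f + ex g.
Proof.
move=> fi gi; apply: ex_eq; rewrite EFinD -!exE//.
exact: (integralD_EFin measurableT fi gi).
Qed.

Lemma exZ c f : intble f -> ex (fun x => c * f x) = c * ex f.
Proof.
move=> fi; apply: ex_eq; rewrite EFinM -exE//.
exact: (integralZl measurableT fi c).
Qed.

Lemma exN f : intble f -> ex (fun x => - f x) = - ex f.
Proof.
move=> fi; rewrite -mulN1r -exZ//; congr ex; apply/funext => x; exact/esym/mulN1r.
Qed.

Lemma exB f g : intble f -> intble g -> ex (fun x => f x - g x) = ex f - ex g.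
Proof. by move=> fi gi; rewrite exD ?exN//; exact: intbleN. Qed.

Lemma ex_sum (I : Type) (s : seq I) (p : pred I) (f : I -> T -> R) :
  (forall i, intble (f i)) ->
  ex (fun x => \sum_(i <- s | p i) f i x) = \sum_(i <- s | p i) ex (f i).
Proof.
move=> fi; elim: s => [|i s IHs].
  rewrite big_nil -[RHS](ex_cst 0); congr ex; apply/funext => x; exact: big_nil.
rewrite big_cons; case pi : (p i); last first.
  by rewrite -IHs; congr ex; apply/funext => x; rewrite big_cons pi.
rewrite -IHs -exD//; last exact: intble_sum.
by congr ex; apply/funext => x; rewrite big_cons pi.
Qed.

Lemma ex_le f g : intble f -> intble g -> (forall x, f x <= g x) -> ex f <= ex g.
Proof.
move=> fi gi fg; rewrite -lee_fin -!exE//; apply: (le_integral measurableT fi gi).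
by move=> x _; rewrite lee_fin.
Qed.

Lemma ex_ge0 f : (forall x, 0 <= f x) -> 0 <= ex f.
Proof. by move=> f0; apply/fine_ge0/integral_ge0 => x _; rewrite lee_fin. Qed.

Lemma ex01 f : measurable_fun setT f -> (forall x, 0 <= f x <= 1) -> 0 <= ex f <= 1.
Proof.
move=> mf f01; apply/andP; split; first by apply: ex_ge0 => x; case/andP: (f01 x).
rewrite -[leRHS](ex_cst 1); apply: ex_le; [exact: intble01|exact: intble_cst|].
by move=> x; case/andP: (f01 x).
Qed.

Lemma ex_norm_le f M : measurable_fun setT f -> (forall x, `|f x| <= M) -> `|ex f| <= M.
Proof.
move=> mf fM; have fi := intble_bounded mf fM.
have fM' x : - M <= f x <= M by rewrite -ler_norml.
rewrite ler_norml; apply/andP; split.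
- rewrite -(ex_cst (- M)); apply: ex_le => //; first exact: intble_cst.
  by move=> x; case/andP: (fM' x).
- rewrite -[leRHS](ex_cst M); apply: ex_le => //; first exact: intble_cst.
  by move=> x; case/andP: (fM' x).
Qed.

End expectation.

Section expectation_product.
Context d1 d2 (T1 : measurableType d1) (T2 : measurableType d2) (R : realType).
Variables (P1 : probability T1 R) (P2 : probability T2 R).

Lemma measurable_ex (f : T1 * T2 -> R) M : measurable_fun setT f ->
  (forall x, `|f x| <= M) -> measurable_fun setT (fun x => ex P2 (fun y => f (x, y))).
Proof.
move=> mf fM; have fi : intble (P1 \x P2)%E f := intble_bounded _ mf fM.
have mF := measurable_fubini_F fi.
by apply: (measurableT_comp (f := fine)) => //; exact: mF.
Qed.

Lemma ex_fubini (f : T1 * T2 -> R) M : measurable_fun setT f -> (forall x, `|f x| <= M) ->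
  ex P1 (fun x => ex P2 (fun y => f (x, y))) = ex P2 (fun y => ex P1 (fun x => f (x, y))).
Proof.
move=> mf fM; have fi : intble (P1 \x P2)%E f := intble_bounded _ mf fM.
have mf1 x : measurable_fun setT (fun y => f (x, y)).
  exact: (measurableT_comp mf (pair1_measurable x)).
have mf2 y : measurable_fun setT (fun x => f (x, y)).
  exact: (measurableT_comp mf (pair2_measurable y)).
apply: ex_eq.
under eq_integral do rewrite -exE ?(intble_bounded _ (mf1 _) (fun y => fM _))//.
apply: (etrans (Fubini fi)).
under eq_integral do rewrite exE ?(intble_bounded _ (mf2 _) (fun y => fM _))//.
rewrite exE//; apply: (@intble_bounded _ _ _ _ _ M).
  have fi' : intble (P2 \x P1)%E (fun p => f (p.2, p.1)).
    apply: (@intble_bounded _ _ _ _ _ M); last by move=> x; exact: fM.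
    exact: (measurableT_comp mf (@measurable_swap _ _ _ _)).
  by apply: (measurableT_comp (f := fine)) => //; exact: (measurable_fubini_F fi').
by move=> y; exact: (ex_norm_le _ (mf2 y) (fun x => fM _)).
Qed.

End expectation_product.

Section expectation_iid.
Context d (T : measurableType d) (R : realType) (P : probability T R) (n : nat).
Local Notation Pn := (iid_prob P n).

Lemma ex_resample (i : 'I_n) (f : n.-tuple T -> R) M : measurable_fun setT f ->
  (forall h, 0 <= f h <= M) ->
  ex Pn (fun h => ex P (fun x => f (tset h i x))) = ex Pn f.
Proof.
move=> mf fM.
have fn h : `|f h| <= M by have /andP[f0 ?] := fM h; rewrite ger0_norm.
have mfi h : measurable_fun setT (fun x => f (tset h i x)).
  apply: (measurableT_comp mf).
  exact: (measurableT_comp (measurable_tset i) (pair1_measurable h)).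
apply: ex_eq.
under eq_integral do rewrite -(exE (intble_bounded _ (mfi _) (fun y => fn _))).
apply: (etrans (iid_resample P i (f := EFin \o f) _ _)).
- exact/measurable_EFinP.
- by move=> h; rewrite lee_fin; case/andP: (fM h).
- by rewrite exE//; exact: (intble_bounded _ mf fn).
Qed.

Lemma ge0_ex_marginal (i : 'I_n) (g : T -> R) : intble P g -> (forall x, 0 <= g x) ->
  intble Pn (fun h => g (tnth h i)) /\ ex Pn (fun h => g (tnth h i)) = ex P g.
Proof.
move=> gi g0; have mg := intble_measurable gi.
have e : (\int[Pn]_h (g (tnth h i))%:E = (ex P g)%:E)%E.
  rewrite -exE//; apply: (iid_marginal P i (g := EFin \o g)).
  - exact/measurable_EFinP.
  - by move=> x; rewrite lee_fin.
split; last exact: ex_eq.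
apply: (intble_ge0 _ _ e) => //.
exact: (measurableT_comp mg (measurable_tnth i)).
Qed.

(** Resampling coordinate [i] leaves [f] fixed and turns the other factor into an independent draw,
    which integrates out. *)
Lemma ex_indep (i : 'I_n) (g : T -> R) (f : n.-tuple T -> R) M N :
  measurable_fun setT g -> (forall x, 0 <= g x <= M) ->
  measurable_fun setT f -> (forall h, 0 <= f h <= N) ->
  (forall h x, f (tset h i x) = f h) ->
  ex Pn (fun h => g (tnth h i) * f h) = ex P g * ex Pn f.
Proof.
move=> mg gM mf fN fi.
have gi : intble P g.
  apply: (@intble_bounded _ _ _ _ _ M) => // x.
  by have /andP[g0 ?] := gM x; rewrite ger0_norm.
have fint : intble Pn f.
  apply: (@intble_bounded _ _ _ _ _ N) => // x.
  by have /andP[f0 ?] := fN x; rewrite ger0_norm.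
rewrite -(@ex_resample i _ (M * N)).
- rewrite -exZ//; congr ex; apply/funext => h.
  rewrite mulrC -exZ//; congr ex; apply/funext => x.
  by rewrite tnth_tset eqxx fi mulrC.
- by apply: measurable_funM => //; exact: (measurableT_comp mg (measurable_tnth i)).
- move=> h; have /andP[g0 g1] := gM (tnth h i); have /andP[f0 f1] := fN h.
  by rewrite mulr_ge0// ler_pM.
Qed.

End expectation_iid.

(** * The law of the squared modulus *)

Section radial.
Context {R : realType}.
Local Notation mu := (@lebesgue_measure R).
Local Notation T := (measurableTypeR R).

Definition radius2 (p : T * T) : T := p.1 ^+ 2 + p.2 ^+ 2.

Lemma measurable_radius2 : measurable_fun setT radius2.
Proof. by apply: measurable_funD; apply: measurable_funX. Qed.

Definition area (r : R) : \bar R := pushforward (mu \x mu)%E radius2 `]0, r]%classic.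

Lemma areaE r : area r = (\int[mu]_x \int[mu]_y (\1_`]0, r] (x ^+ 2 + y ^+ 2) : R)%:E)%E.
Proof.
have mA : measurable (radius2 @^-1` `]0, r]%classic).
  by rewrite -[X in measurable X]setTI; apply: measurable_radius2.
rewrite /area /pushforward -[RHS](fubini_tonelli1 (m1 := mu) (m2 := mu)
  (fun p => (\1_`]0, r] (radius2 p) : R)%:E)); last 2 first.
- apply/measurable_EFinP; apply: (measurableT_comp _ measurable_radius2).
  exact: measurable_indic.
- by move=> p; rewrite lee_fin indicE ler0n.
rewrite -(setIT (_ @^-1` _)) -(integral_indic (mu \x mu)%E measurableT mA).
by apply: eq_integral => p _; rewrite !indicE; congr (_%:R%:E); rewrite !inE.
Qed.

Lemma measurable_indic_radius2 r : measurable_fun setT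
  (fun p : T * T => (\1_`]0, r] (p.1 ^+ 2 + p.2 ^+ 2) : R)%:E).
Proof.
apply/measurable_EFinP; apply: (measurableT_comp _ measurable_radius2).
exact: measurable_indic.
Qed.

Lemma area_scale (a r : R) : 0 < a -> area (a ^+ 2 * r) = ((a ^+ 2)%:E * area r)%E.
Proof.
move=> a0; have a20 : 0 < a ^+ 2 by rewrite exprn_gt0.
have an : `|a| = a by rewrite gtr0_norm.
have anz : a != 0 by rewrite gt_eqF.
pose g (s x y : R) : \bar R := (\1_`]0, s] (x ^+ 2 + y ^+ 2) : R)%:E.
have g0 s x y : (0 <= g s x y)%E by rewrite lee_fin indicE ler0n.
have mg s x : measurable_fun setT (fun y : T => g s x y).
  exact: (measurableT_comp (measurable_indic_radius2 s) (pair1_measurable x)).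
have mG s : measurable_fun setT (fun x : T => \int[mu]_y g s x y)%E.
  exact: (measurable_fun_fubini_tonelli_F (m2 := mu) _ (measurable_indic_radius2 s)).
have G0 s x : (0 <= \int[mu]_y g s x y)%E by exact: integral_ge0.
have gE x y : g (a ^+ 2 * r) (a * x) (a * y) = g r x y.
  rewrite /g !indicE; congr (_%:R%:E); congr nat_of_bool.
  have e : (a * x) ^+ 2 + (a * y) ^+ 2 = a ^+ 2 * (x ^+ 2 + y ^+ 2) by ring.
  by apply/idP/idP; rewrite !inE/= !in_itv/= e pmulr_rgt0// ler_pM2l.
rewrite !areaE -[LHS](ge0_integral_affine 0 anz (mG _) (G0 _)).
have E (x : R) : (\int[mu]_y g (a ^+ 2 * r)%R (a * x + 0)%R y = a%:E * \int[mu]_y g r x y)%E.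
  rewrite -(ge0_integral_affine 0 anz (mg _ _) (g0 _ _)) an; congr (_ * _)%E.
  by apply: eq_integral => y _; rewrite !addr0 gE.
under eq_integral do rewrite E.
rewrite (ge0_integralZl_EFin mu measurableT (fun x _ => G0 r x) (mG r) (ltW a0)).
by rewrite an muleA -EFinM expr2.
Qed.

Lemma area1_gt0 : (0 < area 1)%E.
Proof.
have mA : measurable (`]0, 2^-1]%classic : set T) by exact: measurable_itv.
have mAA : measurable ((`]0, 2^-1] `*` `]0, 2^-1])%classic : set (T * T)).
  exact: measurableX.
apply: (@lt_le_trans _ _ ((mu \x mu)%E (`]0, 2^-1] `*` `]0, 2^-1])%classic)).
  have -> := product_measure1E mu mu mA mA.
  rewrite /= lebesgue_measure_itv/= lte_fin invr_gt0 ltr0n oppr0 adde0 -EFinM lte_fin.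
  by rewrite mulr_gt0// invr_gt0.
rewrite /area /pushforward; apply: le_measure; rewrite ?inE//.
  by rewrite -[X in measurable X]setTI; apply: measurable_radius2.
move=> [x y] [/= ]; rewrite !in_itv/= => /andP[x0 x1] /andP[y0 y1].
rewrite /radius2/= addr_gt0 ?exprn_gt0//=.
by have := mulr_ge0 (ltW x0) (ltW y0); nra.
Qed.

Lemma area1_lty : (area 1 < +oo)%E.
Proof.
have mA : measurable (`[-1, 1]%classic : set T) by exact: measurable_itv.
have mAA : measurable ((`[-1, 1] `*` `[-1, 1])%classic : set (T * T)).
  exact: measurableX.
apply: (@le_lt_trans _ _ ((mu \x mu)%E (`[-1, 1] `*` `[-1, 1])%classic)); last first.
  have -> := product_measure1E mu mu mA mA.
  rewrite /= lebesgue_measure_itv/= lte_fin; case: ifP => _; last by rewrite mule0 ltry.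
  by rewrite -EFinD -EFinM ltry.
rewrite /area /pushforward; apply: le_measure; rewrite ?inE//.
  by rewrite -[X in measurable X]setTI; apply: measurable_radius2.
move=> [x y]; rewrite /= /radius2 !in_itv/= => /andP[_ h].
have /andP[x1 x2] : -1 <= x <= 1.
  by rewrite -ler_norml -(@ler_pXn2r _ 2) ?nnegrE// expr1n real_normK ?num_real//; have := sqr_ge0 y; lra.
have /andP[y1 y2] : -1 <= y <= 1.
  by rewrite -ler_norml -(@ler_pXn2r _ 2) ?nnegrE// expr1n real_normK ?num_real//; have := sqr_ge0 x; lra.
by rewrite x1 x2 y1 y2.
Qed.

(** The area of the unit disc. Its value pi is encoded later by [disc_peak], through the total mass
    of the Gaussian law. *)
Definition disc : R := fine (area 1).

Lemma disc_gt0 : 0 < disc.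
Proof. by apply: fine_gt0; rewrite area1_gt0 area1_lty. Qed.

Lemma area_disc r : 0 <= r -> area r = (disc * r)%:E.
Proof.
rewrite le_eqVlt => /predU1P[<-|r0].
  rewrite mulr0 /area set_itv_ge ?bnd_simp//.
  by rewrite /pushforward preimage_set0 measure0.
rewrite -[in LHS](sqr_sqrtr (ltW r0)) -[in LHS](mulr1 (_ ^+ 2)).
rewrite area_scale ?sqrtr_gt0// sqr_sqrtr ?ltW// mulrC EFinM fineK//.
by rewrite ge0_fin_numE ?area1_lty// ltW ?area1_gt0.
Qed.

Lemma radius2_pushforward (A : set T) : measurable A -> A `<=` `]0, +oo[ ->
  pushforward (mu \x mu)%E radius2 A = (disc%:E * mu A)%E.
Proof.
move=> mA AD.
have mD : measurable (`]0, +oo[%classic : set T) by exact: measurable_itv.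
have mDc : measurable (`]-oo, 0]%classic : set T) by exact: measurable_itv.
have c0 : 0 <= disc^-1 by rewrite invr_ge0 ltW ?disc_gt0.
(* Uniqueness of Lebesgue measure is a statement on the whole line, so the rescaled image measure on
   []0, +oo[] is glued to Lebesgue measure on the other half line. On intervals the image measure is
   known from the quadratic scaling of areas. *)
pose nu : {measure set T -> \bar R} :=
  measure_add (mscale (NngNum c0) (mrestr (pushforward (mu \x mu)%E radius2) mD))
    (mrestr mu mDc).
have nuE B : nu measurable_radius2 B = ((disc^-1)%:E *
    pushforward (mu \x mu)%E radius2 (B `&` `]0%R, +oo[) + mu (B `&` `]-oo, 0%R]))%E.
  exact: measure_addE.
have areaB a b : 0 <= a <= b ->
    pushforward (mu \x mu)%E radius2 `]a, b]%classic = (disc * (b - a))%:E.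
  move=> /andP[a0 ab]; have b0 := le_trans a0 ab.
  have sp : (area b = area a + pushforward (mu \x mu)%E radius2 `]a, b]%classic)%E.
    rewrite /area /pushforward -measureU//; last 3 first.
    - by rewrite -[X in measurable X]setTI; apply: measurable_radius2.
    - by rewrite -[X in measurable X]setTI; apply: measurable_radius2.
    - rewrite -preimage_setI -subset0 => x [/=]; rewrite !in_itv/= => /andP[_ h] /andP[h' _].
      by move: h; rewrite leNgt h'.
    by rewrite -preimage_setU -itv_bndbnd_setU// bnd_simp.
  move: sp; rewrite !area_disc// => /(congr1 (fun e => e - (disc * a)%:E)%E).
  by rewrite addeAC subee// add0e -EFinB mulrBr => <-.
have eqnu : mu A = nu measurable_radius2 A.
  apply: lebesgue_measure_unique => // _ [[a b]] _ <-; rewrite nuE/=.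
  have e1 : (`]a, b] `&` `]0, +oo[ = `]Num.max a 0, b])%classic.
    by apply/seteqP; split => x /=; rewrite !in_itv/= andbT gt_max;
      [case=> /andP[-> ->] ->|case/andP=> /andP[-> ->] ->].
  have e2 : (`]a, b] `&` `]-oo, 0] = `]a, Num.min b 0])%classic.
    by apply/seteqP; split => x /=; rewrite !in_itv/= le_min;
      [case=> /andP[-> ->] ->|case/andP=> -> /andP[-> ->]].
  rewrite e1 e2.
  have [ba|ab] := leP b a.
    have nab : (a < b) = false by rewrite ltNge ba.
    rewrite !lebesgue_measure_itv/= !lte_fin lt_min nab/=.
    rewrite set_itv_ge ?bnd_simp -?leNgt ?le_max ?ba//.
    by rewrite /pushforward preimage_set0 measure0 mule0 adde0.
  have [a0|/ltW a0] := leP 0 a.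
    rewrite (min_r (le_trans a0 (ltW ab))).
    rewrite areaB ?a0 ?ltW// -EFinM mulKf ?gt_eqF ?disc_gt0//.
    rewrite !lebesgue_measure_itv/= !lte_fin ab ltNge a0/= adde0.
    by rewrite EFinB.
  have [b0|/ltW b0] := leP b 0.
    rewrite (_ : `]0, b]%classic = set0); last by rewrite set_itv_ge// bnd_simp -leNgt.
    by rewrite /pushforward preimage_set0 measure0 mule0 add0e.
  rewrite areaB ?lexx// subr0 -EFinM mulKf ?gt_eqF ?disc_gt0//.
  rewrite !lebesgue_measure_itv/= !lte_fin ab; case: ltP => [_|a0'].
    by rewrite -EFinB -EFinD sub0r.
  have -> : a = 0 by apply/eqP; rewrite eq_le a0.
  by rewrite oppr0.
rewrite eqnu nuE setIidl//.
rewrite [X in mu X](_ : _ = set0) ?measure0 ?adde0; last first.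
  rewrite -subset0 => x [/AD]; rewrite /= !in_itv/= andbT => x0.
  by rewrite leNgt x0.
by rewrite muleA -EFinM divff ?mul1e// gt_eqF ?disc_gt0.
Qed.

(** Polar coordinates with the squared radius as variable; the condition at 0 accounts for the
    origin, which the half line leaves out. *)
Lemma ge0_integral_radius2 (F : R -> \bar R) :
  measurable_fun setT F -> (forall s, 0 <= F s)%E -> F 0 = 0%E ->
  (\int[mu]_x \int[mu]_y F (x ^+ 2 + y ^+ 2)%R =
   disc%:E * \int[mu]_(s in `]0%R, +oo[) F s)%E.
Proof.
move=> mF F0 F00.
have mD : measurable (`]0, +oo[%classic : set T) by exact: measurable_itv.
have c0 : 0 <= disc by rewrite ltW ?disc_gt0.
rewrite -(fubini_tonelli1 (m1 := mu) (m2 := mu) (fun p => F (radius2 p))); last 2 first.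
- exact: (measurableT_comp mF measurable_radius2).
- by move=> p.
have mFD : measurable_fun (`]0, +oo[%classic : set T) F by exact: measurable_funTS.
rewrite -(ge0_integral_mscale mu mD (NngNum c0) mFD (fun s _ => F0 s)).
pose nu : {measure set T -> \bar R} := pushforward (mu \x mu)%E radius2.
transitivity (\int[nu measurable_radius2]_(s in `]0%R, +oo[) F s)%E; last first.
  apply: eq_measure_integral => A mA AD.
  exact: radius2_pushforward.
rewrite ge0_integral_pushforward//; last by exact: measurable_radius2.
rewrite [RHS]integral_mkcond; apply: eq_integral => p _; rewrite patchE /=.
case: ifPn => // /negP; rewrite inE/= in_itv/= andbT => /negP; rewrite -leNgt => r0.
have -> : radius2 p = 0 by apply/eqP; rewrite eq_le r0 addr_ge0 ?sqr_ge0.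
by [].
Qed.

Lemma normal_prob_null (s : R) : 0 < s -> normal_prob 0 s [set 0 : R] = 0%E.
Proof. by move=> s0; rewrite /normal_prob integral_set1. Qed.

Lemma ge0_integral_sqc (f : R -> \bar R) :
  measurable_fun setT f -> (forall s, 0 <= f s)%E -> f 0 = 0%E ->
  (\int[cnormal_prob]_z f (sqc z) =
   (disc * normal_peak (sd0 : R) ^+ 2)%:E *
   \int[mu]_(s in `]0%R, +oo[) (f s * (expR (- s))%:E))%E.
Proof.
move=> mf f0 f00.
have mfz : measurable_fun setT (fun z : R[i] => f (sqc z)).
  exact: (measurableT_comp mf (@measurable_sqc R)).
apply: (etrans (ge0_integral_cnormal mfz (fun z => f0 _))).
have mq : measurable_fun setT (fun p : R * R => f (p.1 ^+ 2 + p.2 ^+ 2)).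
  by apply: (measurableT_comp mf); apply: measurable_funD; apply: measurable_funX.
have mqx x : measurable_fun setT (fun y : R => f (x ^+ 2 + y ^+ 2)).
  by apply: (measurableT_comp mf); apply: measurable_funD => //; apply: measurable_funX.
have mG : measurable_fun setT (fun x : R => \int[normal_prob 0 sd0]_y f (x ^+ 2 + y ^+ 2)%R)%E.
  exact: (measurable_fun_fubini_tonelli_F (m2 := normal_prob (0 : R) sd0) _ mq).
have G0 x : (0 <= \int[normal_prob 0 sd0]_y f (x ^+ 2 + y ^+ 2)%R)%E by exact: integral_ge0.
apply: (etrans (ge0_integral_normal 0 sd0 mG G0)).
pose F s := (f s * (normal_peak (sd0 : R) ^+ 2 * expR (- s))%:E)%E.
have p0 : 0 <= normal_peak (sd0 : R) ^+ 2 by rewrite sqr_ge0.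
have mexp : measurable_fun setT (fun s : R => expR (- s)).
  exact: (measurableT_comp (@measurable_expR R) (@oppr_measurable _ _)).
have mfe : measurable_fun setT (fun s : R => f s * (expR (- s))%:E)%E.
  by apply: emeasurable_funM => //; exact/measurable_EFinP.
have mF : measurable_fun setT F.
  by apply: emeasurable_funM => //; apply/measurable_EFinP; exact: measurable_funM.
have F0 s : (0 <= F s)%E by rewrite mule_ge0// lee_fin mulr_ge0 ?expR_ge0.
have pdfE x : normal_pdf 0 sd0 x = normal_peak sd0 * expR (- (x ^+ 2)) :> R.
  have h : 2^-1 *+ 2 = 1 :> R by field.
  by rewrite normal_pdf_expR ?sd0_gt0// sqr_sd0 h divr1.
transitivity (\int[mu]_x \int[mu]_y F (x ^+ 2 + y ^+ 2)%R)%E.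
  apply: eq_integral => x _.
  rewrite (ge0_integral_normal 0 sd0 (mqx x) (fun y => f0 _)).
  have my : measurable_fun setT (fun y : R => f (x ^+ 2 + y ^+ 2)%R * (normal_pdf 0 sd0 y)%:E)%E.
    by apply: emeasurable_funM => //; apply/measurable_EFinP; exact: measurable_normal_pdf.
  apply: (etrans (esym (ge0_integralZr mu measurableT my _ _))).
  - by move=> y _; rewrite mule_ge0// lee_fin normal_pdf_ge0.
  - by rewrite lee_fin normal_pdf_ge0.
  apply: eq_integral => y _; rewrite /F -muleA -EFinM; congr (_ * _%:E)%E.
  by rewrite !pdfE opprD expRD; ring.
apply: (etrans (ge0_integral_radius2 mF F0 _)); first by rewrite /F f00 mul0e.
rewrite EFinM -muleA; congr (_ * _)%E.
have mD : measurable (`]0, +oo[%classic : set T) by exact: measurable_itv.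
apply: (etrans _ (ge0_integralZl_EFin mu mD _ _ p0)).
- by apply: eq_integral => s _; rewrite /F EFinM muleCA.
- by move=> s _; rewrite mule_ge0// lee_fin expR_ge0.
- exact: measurable_funTS.
Qed.

Lemma is_derive_expRN (x : R) : is_derive x 1 (fun s : R => expR (- s)) (- expR (- x)).
Proof.
have h : is_derive x 1 (-%R : R -> R) (-1) by apply: is_deriveNid.
have := @is_derive1_comp R expR (-%R) x _ _ (is_derive_expR _) h.
by rewrite mulrN1.
Qed.

Lemma cvg_expRN : expR (- s) @[s --> +oo%R] --> (0 : R).
Proof. exact: cvgr_expR. Qed.

Section primitive.
Variables (G g : R -> R).
Hypothesis dG : forall x : R, is_derive x 1 G (g x).
Hypothesis cg : continuous g.

Let cG : continuous G.
Proof.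
move=> s; apply: differentiable_continuous; apply/derivable1_diffP.
have h := dG s; exact: ex_derive.
Qed.

Let dGE (x : R) : derive1 G x = g x.
Proof. by rewrite derive1E; have h := dG x; exact: derive_val. Qed.

Lemma integral_primitive t : 0 < t ->
  (\int[mu]_(s in `]0%R, t]) (g s)%:E = (G t - G 0)%:E)%E.
Proof.
move=> t0; rewrite integral_itv_obnd_cbnd; last first.
  apply/measurable_EFinP/measurable_funTS.
  exact: continuous_measurable_fun.
rewrite (@continuous_FTC2 _ g G)//.
- exact: continuous_subspaceT.
- split.
  + by move=> x _; have h := dG x; exact: ex_derive.
  + by apply: cvg_at_right_filter; exact: cG.
  + by apply: cvg_at_left_filter; exact: cG.
Qed.

Lemma integral_primitivey l : (forall x, 0 <= x -> 0 <= g x) ->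
  G x @[x --> +oo%R] --> l -> (\int[mu]_(s in `]0%R, +oo[) (g s)%:E = (l - G 0)%:E)%E.
Proof.
move=> g0 Gl; rewrite integral_itv_obnd_cbnd; last first.
  apply/measurable_EFinP/measurable_funTS.
  exact: continuous_measurable_fun.
rewrite (@ge0_continuous_FTC2y _ g G _ l)//.
- exact: continuous_subspaceT.
- by apply: cvg_at_right_filter; exact: cG.
Qed.

End primitive.

Lemma is_derive_exp_primitive (x : R) : is_derive x 1 (fun s : R => - expR (- s)) (expR (- x)).
Proof. by have h := is_derive_expRN x; apply: is_derive_eq; rewrite opprK. Qed.

Lemma is_derive_xexp_primitive (x : R) :
  is_derive x 1 (fun s : R => - ((1 + s) * expR (- s))) (x * expR (- x)).
Proof.
have h := is_derive_expRN x.
by apply: is_derive_eq; rewrite /GRing.scale/=; ring.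
Qed.

Lemma continuous_expRN : continuous (fun s : R => expR (- s)).
Proof.
move=> s; apply: differentiable_continuous; apply/derivable1_diffP.
by have h := is_derive_expRN s; exact: ex_derive.
Qed.

Lemma continuous_xexpRN : continuous (fun s : R => s * expR (- s)).
Proof.
move=> s; apply: differentiable_continuous; apply/derivable1_diffP.
by have h := is_derive_expRN s; exact: ex_derive.
Qed.

Lemma integral_expRN t : 0 < t ->
  (\int[mu]_(s in `]0%R, t]) (expR (- s))%:E = (1 - expR (- t))%:E)%E.
Proof.
move=> t0; rewrite (integral_primitive is_derive_exp_primitive continuous_expRN)//.
by rewrite oppr0 expR0 opprK addrC.
Qed.

Lemma integral_expRNy : (\int[mu]_(s in `]0%R, +oo[) (expR (- s))%:E = 1)%E.
Proof.
rewrite (integral_primitivey is_derive_exp_primitive continuous_expRN (l := 0)).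
- by rewrite oppr0 expR0 opprK add0r.
- by move=> x _; exact: expR_ge0.
- by rewrite -oppr0; apply: cvgN; exact: cvg_expRN.
Qed.

Lemma integral_xexpRN t : 0 < t ->
  (\int[mu]_(s in `]0%R, t]) (s * expR (- s))%:E = (1 - (1 + t) * expR (- t))%:E)%E.
Proof.
move=> t0; rewrite (integral_primitive is_derive_xexp_primitive continuous_xexpRN)//.
by rewrite addr0 oppr0 expR0 mulr1 opprK addrC.
Qed.

Lemma integral_xexpRNy : (\int[mu]_(s in `]0%R, +oo[) (s * expR (- s))%:E = 1)%E.
Proof.
rewrite (integral_primitivey is_derive_xexp_primitive continuous_xexpRN (l := 0)).
- by rewrite addr0 oppr0 expR0 mulr1 opprK add0r.
- by move=> x x0; rewrite mulr_ge0// expR_ge0.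
rewrite -oppr0; apply: cvgN.
(* The majorant comes from [1 + s / 2 <= expR (s / 2)]: half of the exponential decay absorbs the
   linear factor. *)
apply: (@squeeze_cvgr _ _ _ _ (fun=> 0) (fun s : R => 2 * expR (- (s / 2)))).
- near=> s; have s0 : 0 <= s by near: s; exact: nbhs_pinfty_ge.
  rewrite mulr_ge0 ?expR_ge0 ?addr_ge0//=.
  have -> : expR (- s) = expR (- (s / 2)) * expR (- (s / 2)) by rewrite -expRD; congr expR; field.
  rewrite mulrA ler_wpM2r ?expR_ge0//.
  have h := expR_ge1Dx (s / 2).
  rewrite expRN ler_pdivrMr ?expR_gt0//; apply: le_trans (_ : 2 * (1 + s / 2) <= _); first lra.
  by rewrite ler_wpM2l.
- exact: cvg_cst.
- rewrite -[X in _ --> X](mulr0 2); apply: cvgM; first exact: cvg_cst.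
  apply: (@cvg_comp _ _ _ (fun s : R => s / 2) (fun s : R => expR (- s)) _ (pinfty_nbhs R)).
    by apply: gt0_cvgMly => //; exact: cvg_id.
  exact: cvg_expRN.
Unshelve. all: by end_near. Qed.

(** The origin lies on the line where the real part vanishes, a null set of the product law. *)
Lemma cnormal_nonzero : (\int[cnormal_prob]_z (step 0 (sqc z))%:E = 1 :> \bar R)%E.
Proof.
pose B := [set z : R[i] | sqc z <= 0].
have mB : measurable B.
  rewrite (_ : B = setT `&` sqc @^-1` `]-oo, 0]); first exact: (@measurable_sqc R).
  by rewrite setTI; apply/seteqP; split=> z; rewrite /B/= in_itv.
have B0 : cnormal_prob B = 0%E.
  pose N : probability (measurableTypeR R) R := normal_prob 0 sd0.
  have m0 : measurable [set 0 : measurableTypeR R] by exact: measurable_set1.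
  have mX : measurable ([set 0 : measurableTypeR R] `*` [set: measurableTypeR R]).
    exact: measurableX.
  apply/eqP; rewrite eq_le measure_ge0 andbT.
  apply: (@le_trans _ _ ((N \x N)%E ([set 0] `*` setT))); last first.
    by rewrite (product_measure1E N N m0 measurableT) [X in (X * _)%E](normal_prob_null sd0_gt0) mul0e.
  apply: (le_measure (N \x N)%E); rewrite ?inE//.
    by rewrite -[X in measurable X]setTI; exact: (@measurable_mkcomplex R measurableT).
  move=> [x y] /= h; split=> //; apply/eqP; rewrite -sqrf_eq0 eq_le sqr_ge0 andbT.
  by apply: le_trans h; rewrite /sqc/= lerDl sqr_ge0.
transitivity (\int[cnormal_prob]_z (\1_(~` B) z)%:E : \bar R)%E.
  apply: eq_integral => z _; rewrite indicE /step; congr ((_%:R)%:E); congr nat_of_bool.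
  by apply/idP/idP; rewrite inE/= /B/= ltNge => /negP.
rewrite (integral_indic _ measurableT) ?setIT; last exact: measurableC.
by apply: (etrans (probability_setC cnormal_prob mB)); rewrite [X in (_ - X)%E]B0 sube0.
Qed.

(** Total mass: [ge0_integral_sqc], applied to the indicator of a nonzero modulus, has left side 1,
    and the integral of [expR (- s)] on its right side is also 1. *)
Lemma disc_peak : disc * normal_peak (sd0 : R) ^+ 2 = 1.
Proof.
have mst : measurable_fun setT (fun s : R => (step 0 s)%:E).
  by apply/measurable_EFinP; exact: measurable_step.
have st0 (s : R) : (0 <= (step 0 s)%:E)%E by rewrite lee_fin step_ge0.
have st00 : (step 0 (0 : R))%:E = 0%E by rewrite /step ltxx.
have e : (\int[mu]_(s in `]0%R, +oo[) ((step 0 s)%:E * (expR (- s))%:E) = 1)%E.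
  rewrite -integral_expRNy; apply: eq_integral => s.
  by rewrite inE/= in_itv/= andbT /step => ->; rewrite mul1e.
have := etrans (esym cnormal_nonzero) (ge0_integral_sqc mst st0 st00).
by rewrite e mule1 => -[].
Qed.

(* [|Z|^2] is exponentially distributed; the factor [step 0] excludes the null event [Z = 0]. *)
Lemma sqc_law (f : R -> R) (r : R) :
  measurable_fun setT f -> (forall s, 0 < s -> 0 <= f s) ->
  (\int[mu]_(s in `]0%R, +oo[) (f s * expR (- s))%:E = r%:E)%E ->
  intble cnormal_prob (fun z => step 0 (sqc z) * f (sqc z)) /\
  ex cnormal_prob (fun z => step 0 (sqc z) * f (sqc z)) = r.
Proof.
move=> mf f0 fr; pose F s := step 0 s * f s.
have mF : measurable_fun setT F by apply: measurable_funM => //; exact: measurable_step.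
have F0 s : 0 <= F s.
  by rewrite /F /step; case: ltP => s0; rewrite ?mul0r ?mul1r ?f0.
have e : (\int[cnormal_prob]_z (F (sqc z))%:E = r%:E)%E.
  apply: (etrans (ge0_integral_sqc (f := EFin \o F) _ _ _)).
  - exact/measurable_EFinP.
  - by move=> s; rewrite lee_fin.
  - by rewrite /= /F /step ltxx mul0r.
  - rewrite disc_peak mul1e -fr; apply: eq_integral => s.
    by rewrite inE/= in_itv/= andbT /F /step => ->; rewrite mul1r EFinM.
split; last exact: ex_eq.
apply: (intble_ge0 _ _ e) => //.
exact: (measurableT_comp mF (@measurable_sqc R)).
Qed.

End radial.

(** * Moments, selectors and entropy bounds for Gaussian laws *)

Section gaussian_inequalities.
Context {R : realType}.
Local Notation C := R[i].
Local Notation gam := (@cnormal_prob R).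

Lemma sqc_moment : intble gam sqc /\ ex gam sqc = 1.
Proof.
rewrite (_ : sqc = fun z : C => step 0 (sqc z) * sqc z).
  exact: (sqc_law (f := idfun) (@measurable_id _ R setT) (fun s s0 => ltW s0) integral_xexpRNy).
apply/funext => z; rewrite /step; case: ltP => h; rewrite ?mul1r ?mul0r//.
by apply/eqP; rewrite eq_le h sqc_ge0.
Qed.

(** The centre is excluded in accordance with the factor [step 0] of [sqc_law]. *)
Definition disc_at (t : R) (z : C) : bool := (0 < sqc z <= t)%R.

Lemma disc_at_law (t : R) : 0 < t ->
  [/\ measurable_fun setT (fun z => (disc_at t z)%:R : R),
    ex gam (fun z => (disc_at t z)%:R) = 1 - expR (- t),
    intble gam (fun z => (disc_at t z)%:R * sqc z) &
    ex gam (fun z => (disc_at t z)%:R * sqc z) = 1 - (1 + t) * expR (- t)].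
Proof.
move=> tp.
pose ind (s : R) : R := (s <= t)%R%:R.
have indE : ind = \1_`]-oo, t]%classic.
  apply/funext => s; rewrite indicE /ind; congr (_%:R); congr nat_of_bool.
  by apply/idP/idP; rewrite inE/= in_itv.
have mind : measurable_fun setT ind by rewrite indE; exact: measurable_indic.
have cut (g : R -> R) : measurable_fun setT g -> (\int[@lebesgue_measure R]_(s in `]0%R, +oo[) (ind s * g s)%:E =
    \int[@lebesgue_measure R]_(s in `]0%R, t]) (g s)%:E)%E.
  move=> mg; rewrite [LHS]integral_mkcond [RHS]integral_mkcond; apply: eq_integral => s _.
  rewrite !patchE; have -> : (s \in (`]0%R, +oo[%classic : set R)) = (0 < s).
    by apply/idP/idP; rewrite inE/= in_itv/= andbT.
  have -> : (s \in (`]0%R, t]%classic : set R)) = (0 < s <= t).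
    by apply/idP/idP; rewrite inE/= in_itv/=.
  by rewrite /ind; case: (0 < s) => //=; case: (s <= t); rewrite ?mul1r ?mul0r.
have mexp : measurable_fun setT (fun s : R => expR (- s)).
  exact: (measurableT_comp (@measurable_expR R) (@oppr_measurable _ _)).
have mxexp : measurable_fun setT (fun s : R => s * expR (- s)) by exact: measurable_funM.
have [bi be] := sqc_law mind (fun s _ => ler0n R _) (etrans (cut _ mexp) (integral_expRN tp)).
have mind2 : measurable_fun setT (fun s => ind s * s) by exact: measurable_funM.
have ind20 s : 0 < s -> 0 <= ind s * s by move=> s0; rewrite mulr_ge0 ?ler0n// ltW.
have e2 : (\int[@lebesgue_measure R]_(s in `]0%R, +oo[) (ind s * s * expR (- s))%:E =
    (1 - (1 + t) * expR (- t))%:E)%E.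
  rewrite -(integral_xexpRN tp) -cut//.
  by apply: eq_integral => s _; rewrite mulrA.
have [bi2 be2] := sqc_law mind2 ind20 e2.
have bE z : (disc_at t z)%:R = step 0 (sqc z) * ind (sqc z) :> R.
  by rewrite /disc_at /step /ind; case: (0 < _); rewrite /= ?mul1r ?mul0r.
have b2E z : (disc_at t z)%:R * sqc z = step 0 (sqc z) * (ind (sqc z) * sqc z) :> R.
  by rewrite bE mulrA.
split.
- under eq_fun do rewrite bE; exact: (intble_measurable bi).
- by under eq_fun do rewrite bE; rewrite be.
- by under eq_fun do rewrite b2E.
- by under eq_fun do rewrite b2E.
Qed.

(* Among the events of probability [theta], a centred disc minimizes the energy
   [E[|H|^2; H \in B]], whose value is then [alpha (1 - theta) 1]. *)
Lemma exists_selector (theta : R) : 0 <= theta <= 1 ->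
  exists b : C -> bool, [/\ measurable_fun setT (fun z => (b z)%:R : R),
    ex gam (fun z => (b z)%:R) = theta,
    intble gam (fun z => (b z)%:R * sqc z) &
    ex gam (fun z => (b z)%:R * sqc z) = alpha (1 - theta) 1].
Proof.
move=> /andP[]; rewrite le_eqVlt => /predU1P[<- _|t0].
  exists (fun=> false); split.
  - exact: measurable_cst.
  - exact: ex_cst.
  - rewrite (_ : (fun _ => _) = fun=> 0); first exact: intble_cst.
    by apply/funext => z; rewrite mul0r.
  - rewrite (_ : (fun _ => _) = fun=> 0); last by apply/funext => z; rewrite mul0r.
    by rewrite ex_cst /alpha subr0 ln1; ring.
rewrite le_eqVlt => /predU1P[->|t1].
  have [si se] := sqc_moment.
  exists (fun=> true); split.
  - exact: measurable_cst.
  - exact: ex_cst.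
  - by rewrite (_ : (fun _ => _) = sqc)//; apply/funext => z; rewrite mul1r.
  - rewrite (_ : (fun _ => _) = sqc); last by apply/funext => z; rewrite mul1r.
    by rewrite se /alpha subrr ln1; ring.
(* The squared modulus is exponential, so this squared radius gives the disc probability [theta]. At
   the endpoints treated above it would be 0 or infinite. *)
pose t := - ln (1 - theta).
have omt : 0 < 1 - theta by rewrite subr_gt0.
have tp : 0 < t by rewrite oppr_gt0 ln_lt0// omt/= ltrBlDr ltrDl.
have et : expR (- t) = 1 - theta by rewrite opprK lnK// posrE.
have [mb eb ib ebs] := disc_at_law tp.
exists (disc_at t); split=> //; first by rewrite eb et opprB addrC subrK.
by rewrite ebs et /alpha ln1 /t; ring.
Qed.

Lemma ge0_integral_cnormalN (f : C -> \bar R) :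
  measurable_fun setT f -> (forall z, 0 <= f z)%E ->
  (\int[gam]_z f (- z)%R = \int[gam]_z f z)%E.
Proof.
move=> mf f0.
have mN : measurable_fun setT (fun z : C => - z).
  rewrite (_ : (fun _ => _) = fun z : C => (- 1) * z).
    by apply: measurable_complexM.
  by apply/funext => z; rewrite mulN1r.
have mfN := measurableT_comp mf mN.
apply: (etrans (ge0_integral_cnormal mfN (fun z => f0 _))).
apply/esym/(etrans (ge0_integral_cnormal mf f0))/esym.
have mC : measurable_fun setT (fun p : measurableTypeR R * measurableTypeR R => f (Complex p.1 p.2)).
  exact: (measurableT_comp mf (@measurable_mkcomplex R)).
pose G x := (\int[normal_prob 0 sd0]_y f (Complex x y))%E.
have mG : measurable_fun setT G.
  exact: (measurable_fun_fubini_tonelli_F (m2 := normal_prob 0 sd0) _ mC).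
have G0 x : (0 <= G x)%E by exact: integral_ge0.
transitivity (\int[normal_prob 0 sd0]_x G (- x)%R)%E; last exact: (ge0_integral_normalN sd0_gt0 mG G0).
apply: eq_integral => x _.
exact: (ge0_integral_normalN sd0_gt0 (f := fun y => f (Complex (- x)%R y))
  (measurableT_comp mC (pair1_measurable _)) (fun y => f0 _)).
Qed.

Lemma sqcN (z : C) : sqc (- z) = sqc z.
Proof. by case: z => a b; rewrite /sqc/= !sqrrN. Qed.

Lemma parallelogram (m z : C) : sqc (m + z) + sqc (m - z) = 2 * sqc m + 2 * sqc z.
Proof. by case: m => a b; case: z => c e; rewrite /sqc/=; ring. Qed.

Lemma measurable_sqcD (m : C) : measurable_fun setT (fun z : C => sqc (m + z)).
Proof. by apply: (measurableT_comp (@measurable_sqc R)); exact: measurable_complexD. Qed.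

(** The cross term vanishes by symmetry: [z] and [- z] have the same law, and the parallelogram
    identity averages the two shifts. *)
Lemma sqcD_moment (m : C) : intble gam (fun z => sqc (m + z)) /\
  ex gam (fun z => sqc (m + z)) = sqc m + 1.
Proof.
have [si se] := sqc_moment.
have i1 : intble gam (fun z => sqc (m + z)).
  apply: (@intble_le _ _ _ _ _ (fun z => 2 * sqc m + 2 * sqc z)).
  - exact: measurable_sqcD.
  - by move=> z; rewrite sqc_ge0/= -parallelogram lerDl sqc_ge0.
  - by apply: intbleD; [exact: intble_cst|exact: intbleZ].
have mf : measurable_fun setT (fun z : C => (sqc (m + z))%:E).
  by apply/measurable_EFinP; exact: measurable_sqcD.
have f0 (z : C) : (0 <= (sqc (m + z))%:E)%E by rewrite lee_fin sqc_ge0.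
have eN : (\int[gam]_z (sqc (m - z))%:E = (ex gam (fun z => sqc (m + z)))%:E)%E.
  by apply: (etrans (ge0_integral_cnormalN mf f0)); rewrite exE.
have mN : measurable_fun setT (fun z : C => sqc (m - z)).
  rewrite (_ : (fun _ => _) = fun z : C => sqc (- m + z)); first exact: measurable_sqcD.
  by apply/funext => z; rewrite -sqcN opprB addrC.
have i2 : intble gam (fun z => sqc (m - z)).
  by apply: (intble_ge0 mN _ eN) => z; exact: sqc_ge0.
split=> //.
have h := exD i1 i2; rewrite (ex_eq eN) in h.
have h' : ex gam (fun z => sqc (m + z) + sqc (m - z)) = 2 * sqc m + 2.
  rewrite (_ : (fun _ => _) = fun z => 2 * sqc m + 2 * sqc z); last first.
    by apply/funext => z; rewrite parallelogram.
  by rewrite exD ?ex_cst ?exZ ?se ?mulr1//; [exact: intble_cst|exact: intbleZ].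
by move: h; rewrite h'; lra.
Qed.

End gaussian_inequalities.

Opaque intble ex.

Lemma expR_ge_subD (R : realType) (x y : R) : x <= expR (x + y) - 1 + - y.
Proof. by have := expR_ge1Dx (x + y); lra. Qed.

Section gaussian_vector_inequalities.
Context {R : realType} (n : nat).
Local Notation C := R[i].
Local Notation gam := (iid_prob (@cnormal_prob R) n).
Implicit Types m z : n.-tuple C.

Definition log_tdens (sg : R) m z : R :=
  \sum_(t < n) (sqc (tnth z t) - sqc (tnth m t + tnth z t) / sg ^+ 2 - 2 * ln sg).

Lemma tdensE sg m z : tdens sg m z = expR (log_tdens sg m z).
Proof. by rewrite expR_sum. Qed.

Lemma log_tdens1 m z : log_tdens 1 m z = - 2 * tdot m z - sqnorm m.
Proof.
rewrite sqnormE /tdot mulr_sumr -sumrB; apply: eq_bigr => t _.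
rewrite expr1n divr1 ln1 mulr0 subr0.
by case: (tnth m t) => a b; case: (tnth z t) => c e; rewrite /sqc/=; ring.
Qed.

Lemma ex_tdens (sg : R) m (f : n.-tuple C -> R) M : 0 < sg -> measurable_fun setT f ->
  (forall z, 0 <= f z <= M) ->
  intble gam (fun z => f (tadd m z) * tdens sg m z) /\
  ex gam (fun z => f (tadd m z) * tdens sg m z) =
    ex (iid_prob (cgauss (sg * sd0)) n) f.
Proof.
move=> sg0 mf fM.
have f0 z : 0 <= f z by case/andP: (fM z).
have fi : intble (iid_prob (cgauss (sg * sd0)) n) f.
  by apply: (intble_bounded _ mf (M := M)) => z; rewrite ger0_norm//; case/andP: (fM z).
have e : (\int[gam]_z (f (tadd m z) * tdens sg m z)%:E =
    (ex (iid_prob (cgauss (sg * sd0)) n) f)%:E)%E.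
  rewrite -(exE fi); apply: (iid_change m (f := EFin \o f) sg0).
  - exact/measurable_EFinP.
  - by move=> z; rewrite lee_fin.
split; last exact: ex_eq.
apply: (intble_ge0 _ _ e).
- apply: measurable_funM; last exact: measurable_tdens.
  exact: (measurableT_comp mf (measurable_tadd m)).
- by move=> z; rewrite mulr_ge0 ?tdens_ge0.
Qed.

(* Neyman--Pearson for a Gaussian shift of length at most [D / sqrt 2]. *)
Lemma shift_test (tau D lam : R) m (g : n.-tuple C -> R) :
  0 <= D -> 2 * sqnorm m <= D ^+ 2 -> lam = expR (tau * D - D ^+ 2 / 2) ->
  measurable_fun setT g -> (forall z, 0 <= g z <= 1) ->
  ex gam (fun z => g (tadd m z)) <= lam * (ex gam g - Qfun tau) + Qfun (tau - D).
Proof.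
move=> D0 mD lamd mg g01.
have lam0 : 0 <= lam by rewrite lamd expR_ge0.
have [i1 e1] := ex_tdens m ltr01 mg g01.
rewrite mul1r in e1.
have mtd : measurable_fun setT (tdens 1 m) by exact: measurable_tdens.
(* A test with values in [[0, 1]] times [1 - lam * x] is at most the positive part [h x]; with [x]
   the likelihood ratio this bounds every test at once. *)
pose h x : R := Num.max 0 (1 - lam * x).
have mh : measurable_fun setT (fun z => h (tdens 1 m z)).
  by apply: measurable_maxr => //; apply: measurable_funB => //; exact: measurable_funM.
have h01 x : 0 <= x -> 0 <= h x <= 1.
  move=> x0; rewrite /h le_max lexx/= ge_max ler01 lerBlDr lerDl.
  by rewrite mulr_ge0.
have i2 : intble gam (fun z => h (tdens 1 m z)).
  by apply: (intble01 _ mh) => z; rewrite h01// tdens_ge0.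
have mgm : measurable_fun setT (fun z => g (tadd m z)).
  exact: (measurableT_comp mg (measurable_tadd m)).
have i3 : intble gam (fun z => g (tadd m z)) by exact: (intble01 _ mgm).
apply: (@le_trans _ _ (lam * ex gam g + ex gam (fun z => h (tdens 1 m z)))).
  rewrite -e1 -exZ// -exD//; last exact: intbleZ.
  apply: ex_le => //; first by apply: intbleD => //; exact: intbleZ.
  move=> z; have /andP[g0 g1] := g01 (tadd m z).
  have [l1 l2] : (0 <= h (tdens 1 m z)) /\ (1 - lam * tdens 1 m z <= h (tdens 1 m z)).
    by rewrite /h !le_max !lexx orbT.
  by move: l1 l2; set x := tdens 1 m z; set y := h x; nra.
rewrite mulrBr -addrA lerD2l addrC.
have q0 := sqnorm_ge0 m.
(* The logarithm of the likelihood ratio is [- 2 * tdot m z - sqnorm m], distributed as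
   [- d * x - d ^ 2 / 2] with [x] standard normal: the vector problem is the scalar one with shift
   [d]. *)
pose d := Num.sqrt (2 * sqnorm m).
have dD : 0 <= d <= D.
  by rewrite sqrtr_ge0/= -(ler_pXn2r (n := 2)) ?nnegrE ?sqrtr_ge0// sqr_sqrtr// mulr_ge0.
have d2 : d ^+ 2 = 2 * sqnorm m by rewrite sqr_sqrtr// mulr_ge0.
have := likelihood_excess dD lamd.
rewrite -lee_fin => /(le_trans _); apply; rewrite -exE//.
pose f (x : R) : R := h (expR (- 2 * x - sqnorm m)).
have mf : measurable_fun setT (fun x => (f x)%:E).
  apply/measurable_EFinP; apply: measurable_maxr => //; apply: measurable_funB => //.
  by apply: measurable_funM => //; exact: measurable_expR_affine.
have f0 x : (0 <= (f x)%:E)%E by rewrite lee_fin; case/andP: (h01 _ (expR_ge0 (- 2 * x - sqnorm m))).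
rewrite le_eqVlt; apply/orP; left; apply/eqP.
transitivity (\int[gam]_z (f (tdot m z))%:E)%E.
  by apply: eq_integral => z _; rewrite tdensE log_tdens1.
apply: (etrans (iid_linear_law m mf f0)); apply: eq_integral => x _.
rewrite /f /h; congr (Num.max 0 (1 - lam * expR _))%:E.
have -> : Num.sqrt (sqnorm m / 2) = d / 2.
  have -> : sqnorm m / 2 = (d / 2) ^+ 2 by rewrite expr_div_n d2; field.
  by rewrite sqrtr_sqr ger0_norm// divr_ge0// sqrtr_ge0.
by rewrite d2; field.
Qed.

(* Donsker--Varadhan bound with reference law [CN(0, sg^2)]: from
   [x + 1 <= e^x] at [x = s + ln(dQ/dP)]. *)
Lemma gibbs_bound (sg B : R) m (s : n.-tuple C -> R) : 0 < sg ->
  measurable_fun setT s -> (forall y, `|s y| <= B) ->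
  ex gam (fun z => s (tadd m z)) <=
  ex (iid_prob (cgauss (sg * sd0)) n) (fun y => expR (s y)) - 1
    + (2 * ln sg - 1) * n%:R + (sqnorm m + n%:R) / sg ^+ 2.
Proof.
move=> sg0 ms sB.
have mes : measurable_fun setT (fun y => expR (s y)).
  exact: (measurableT_comp (@measurable_expR R) ms).
have esB y : 0 <= expR (s y) <= expR B.
  by rewrite expR_ge0 ler_expR (le_trans (ler_norm _)).
have [i1 e1] := ex_tdens m sg0 mes esB.
have [si se] := @sqc_moment R.
(* The sum of the [q t] is [ln (dP / dQ)]; its mean, a relative entropy, involves second moments
   alone. *)
pose q t z := sqc (tnth m t + tnth z t) / sg ^+ 2 + 2 * ln sg - sqc (tnth z t).
have qie t : intble gam (q t) /\ ex gam (q t) = (sqc (tnth m t) + 1) / sg ^+ 2 + 2 * ln sg - 1.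
  have [mi me] := sqcD_moment (tnth m t).
  have [ia ea] := ge0_ex_marginal t mi (fun w => sqc_ge0 _).
  have [ib eb] := ge0_ex_marginal t si sqc_ge0.
  have ia' := intbleZ (sg ^+ 2)^-1 ia.
  have ia'' := intbleD ia' (intble_cst gam (2 * ln sg)).
  rewrite (_ : q t = fun z => (sg ^+ 2)^-1 * sqc (tnth m t + tnth z t) + 2 * ln sg - sqc (tnth z t)); last first.
    by apply/funext => z; rewrite /q [in LHS]mulrC.
  split; first exact: (intbleB ia'' ib).
  rewrite (exB ia'' ib) (exD ia' (intble_cst gam _)) ex_cst.
  by rewrite (exZ _ ia) (etrans ea me) (etrans eb se) [_^-1 * _]mulrC.
have msm : measurable_fun setT (fun z => s (tadd m z)).
  exact: (measurableT_comp ms (measurable_tadd m)).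
have i2 : intble gam (fun z => s (tadd m z)) by exact: (intble_bounded _ msm (fun z => sB _)).
have i3 : intble gam (fun z => \sum_(t < n) q t z) by apply: intble_sum => t; case: (qie t).
apply: (@le_trans _ _ (ex gam (fun z => expR (s (tadd m z)) * tdens sg m z - 1 + \sum_(t < n) q t z))).
  apply: (ex_le i2 (intbleD (intbleB i1 (intble_cst gam 1)) i3)).
  move=> z; have -> : \sum_(t < n) q t z = - log_tdens sg m z.
    by rewrite -sumrN; apply: eq_bigr => t _; rewrite /q; ring.
  by rewrite tdensE -expRD; exact: expR_ge_subD.
have i1' := intbleB i1 (intble_cst gam 1).
have E1 := etrans (exB i1 (intble_cst gam 1)) (congr2 (fun a b => a - b) e1 (ex_cst gam 1)).
have E2 : ex gam (fun z => \sum_(t < n) q t z) =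
    (2 * ln sg - 1) * n%:R + (sqnorm m + n%:R) / sg ^+ 2.
  apply: (etrans (ex_sum _ _ (fun t => proj1 (qie t)))).
  under eq_bigr do rewrite (proj2 (qie _)).
  rewrite sumrB big_split/= !sumr_const !card_ord -mulr_suml big_split/= sumr_const card_ord -sqnormE.
  by rewrite -(mulr_natr (2 * ln sg)); ring.
rewrite [leLHS](etrans (exD i1' i3) (congr2 +%R E1 E2)).
by rewrite -[leRHS]addrA.
Qed.

End gaussian_vector_inequalities.

Transparent intble ex.

(** * Sampling without replacement *)

Section sampling_without_replacement.
Context {R : realFieldType} {K M : nat}.
Local Notation msgs := {ffun 'I_K -> 'I_M}.
Implicit Types (w : msgs) (B S A : {set 'I_K}).

Definition determined_on B (X : Type) (F : msgs -> X) :=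
  forall w w', {in B, w =1 w'} -> F w = F w'.

Lemma card_imsetC B w : injectiveb w -> #|~: (w @: B)| = (M - #|B|)%N.
Proof.
move/injectiveP => iw; have := cardsC (w @: B).
rewrite card_imset// card_ord => /(congr1 (subn^~ #|B|)) e.
by rewrite -e addKn.
Qed.

(** The two values are transposed throughout [w], not just overwritten at [a], so [w] stays
    injective even if [y] is the message of another user outside [B]; recording the old [w a] makes
    the map an involution. *)
Let swap (a : 'I_K) (p : msgs * 'I_M) : msgs * 'I_M :=
  ([ffun i => tperm (p.1 a) p.2 (p.1 i)], p.1 a).

Let swapK a : involutive (swap a).
Proof.
move=> [w y]; rewrite /swap/= ffunE tpermL; congr pair.
by apply/ffunP => i; rewrite !ffunE tpermC tpermK.
Qed.

Let swap_on a B w y : a \notin B -> injectiveb w -> y \notin w @: B ->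
  {in B, (swap a (w, y)).1 =1 w}.
Proof.
move=> aB /injectiveP iw yB b bB; rewrite ffunE tpermD//=.
  by apply: contraNneq aB => /iw ->.
by apply: contraNneq yB => ->; apply: imset_f.
Qed.

Let swap_ok a B w y : a \notin B -> injectiveb w -> y \notin w @: B ->
  injectiveb (swap a (w, y)).1 && ((swap a (w, y)).2 \notin (swap a (w, y)).1 @: B).
Proof.
move=> aB iw yB; have on := swap_on aB iw yB; apply/andP; split.
  by move/injectiveP: iw => iw; apply/injectiveP => i j; rewrite !ffunE => /perm_inj/iw.
rewrite (eq_in_imset on)/=; apply/imsetP => -[b bB e].
move/injectiveP: iw => iw.
by move: aB; rewrite (iw _ _ e) bB.
Qed.

(* Given the messages of the users in [B], the message of another user [a] is uniform
   on the remaining ones; the proof exchanges [w a] and [y]. *)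
Lemma conditional_uniform B (a : 'I_K) (F : msgs -> 'I_M -> R) : a \notin B ->
  determined_on B F ->
  \sum_(w : msgs | injectiveb w) \sum_(y | y \notin w @: B) F w y =
  (M - #|B|)%:R * \sum_(w : msgs | injectiveb w) F w (w a).
Proof.
move=> aB dF.
transitivity (\sum_(w : msgs | injectiveb w) \sum_(y | y \notin w @: B) F w (w a)); last first.
  rewrite mulr_sumr; apply: eq_bigr => w iw.
  rewrite sumr_const mulr_natl -(card_imsetC B iw); congr (_ *+ _).
  by apply: eq_card => y; rewrite inE.
pose ok (p : msgs * 'I_M) := injectiveb p.1 && (p.2 \notin p.1 @: B).
have okS p : ok p -> ok (swap a p).
  by case: p => w y /andP[]; exact: swap_ok.
have okE p : ok (swap a p) = ok p.
  by apply/idP/idP => [/okS|/okS//]; rewrite swapK.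
rewrite !pair_big_dep [LHS](reindex_inj (inv_inj (swapK a))).
apply: eq_big => [p|p okp]; first exact: okE.
have {okp} : ok p by rewrite -okE.
case: p => w y /andP[iw yB].
by rewrite -(dF _ _ (swap_on aB iw yB)).
Qed.

Variable S : {set 'I_K}.
Hypothesis KM : (K <= M)%N.
Local Notation N := (M - #|~: S|)%N.

Lemma card_users_le : (#|~: S| <= M)%N.
Proof. by rewrite (leq_trans (max_card _))// card_ord. Qed.

Lemma card_pool w : injectiveb w -> #|~: (w @: ~: S)| = N.
Proof. exact: card_imsetC. Qed.

Lemma card_S_le_pool : (#|S| <= N)%N.
Proof.
have := cardsC S; rewrite card_ord => SK.
by rewrite leq_subRL ?card_users_le// addnC SK.
Qed.

(** The probability that a message drawn uniformly from those left free by the users outside [S] is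
    listed. *)
Definition hit_rate (L : msgs -> {set 'I_M}) w : R :=
  #|L w :\: w @: ~: S|%:R / N%:R.

Lemma determined_hit_rate L : determined_on (~: S) L -> determined_on (~: S) (hit_rate L).
Proof.
move=> dL w w' e; rewrite /hit_rate (dL _ _ e).
by rewrite (eq_in_imset e).
Qed.

Lemma hit_rate_ge0 L w : 0 <= hit_rate L w.
Proof. by rewrite divr_ge0 ?ler0n. Qed.

(** Messages are drawn one at a time. If [l] of the [N] free messages are listed and [n] draws have
    hit, the next one hits with probability [(l - n) / (N - n)], which is at most [l / N]. *)
Lemma joint_hits (L : msgs -> {set 'I_M}) A (q : msgs -> R) : A \subset S ->
  determined_on (~: S) L -> determined_on (~: S) q -> (forall w, 0 <= q w) ->
  \sum_(w : msgs | injectiveb w) q w * \prod_(j in A) (w j \in L w)%:R <=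
  \sum_(w : msgs | injectiveb w) q w * hit_rate L w ^+ #|A|.
Proof.
move En : #|A| => n; elim: n A q En => [|n IHn] A q.
  move=> /eqP; rewrite cards_eq0 => /eqP -> _ _ _ _.
  by apply: ler_sum => w _; rewrite big_set0 expr0.
move=> An AS dL dq q0.
have [a aA] : exists a, a \in A by apply/finset.set0Pn; rewrite -cards_eq0 An.
have aS : a \in S by exact: (fintype.subsetP AS).
pose A' := A :\ a.
have A'n : #|A'| = n by apply/eqP; rewrite -eqSS -An (cardsD1 a A) aA.
have A'S : A' \subset S by rewrite (fintype.subset_trans _ AS)// finset.subsetDl.
pose B := ~: S :|: A'.
have aB : a \notin B by rewrite !inE aS eqxx.
have cB : #|B| = (#|~: S| + n)%N.
  rewrite cardsU A'n (_ : ~: S :&: A' = finset.set0) ?cards0 ?subn0//.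
  apply/finset.setP => i; rewrite !inE; apply/negP => /andP[/negP iS] /andP[_ iA].
  by apply: iS; exact: (fintype.subsetP AS).
have nN : (n < N)%N.
  by rewrite (leq_trans _ card_S_le_pool)// -An subset_leq_card.
have MB : (M - #|B| = N - n)%N by rewrite cB subnDA.
pose F w (y : 'I_M) : R := q w * \prod_(j in A') (w j \in L w)%:R * (y \in L w)%:R.
have dF : determined_on B F.
  move=> w w' e; have e' : {in ~: S, w =1 w'} by move=> b bS; apply: e; rewrite inE bS.
  apply/funext => y; rewrite /F (dq _ _ e') (dL _ _ e'); congr (_ * _ * _).
  by apply: eq_bigr => j jA; rewrite e// inE jA orbT.
have Nn0 : 0 < (N - n)%:R :> R by rewrite ltr0n subn_gt0.
have N0 : 0 < N%:R :> R by rewrite ltr0n (leq_trans _ nN).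
apply: (@le_trans _ _ (\sum_(w : msgs | injectiveb w)
    (q w * hit_rate L w) * \prod_(j in A') (w j \in L w)%:R)); last first.
  apply: le_trans (IHn A' (fun w => q w * hit_rate L w) A'n A'S dL _ _) _.
  - by move=> w w' e; rewrite (dq _ _ e) (determined_hit_rate dL e).
  - by move=> w; rewrite mulr_ge0 ?hit_rate_ge0.
  by apply: ler_sum => w _; rewrite exprS mulrA.
rewrite -(ler_pM2l Nn0).
have -> : (N - n)%:R * (\sum_(w : msgs | injectiveb w) q w * \prod_(j in A) (w j \in L w)%:R) =
    \sum_(w : msgs | injectiveb w) \sum_(y | y \notin w @: B) F w y.
  rewrite (conditional_uniform aB dF) MB; congr (_ * _); apply: eq_bigr => w _.
  by rewrite /F (big_setD1 a aA)/= -mulrA; congr (_ * _); rewrite mulrC.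
rewrite mulr_sumr; apply: ler_sum => w iw.
rewrite -mulr_sumr [X in _ <= X](_ : _ =
  q w * \prod_(j in A') (w j \in L w)%:R * ((N - n)%:R * hit_rate L w)); last by ring.
have [hit|/existsP[j]] := boolP [forall j in A', w j \in L w]; last first.
  rewrite negb_imply => /andP[jA wj].
  by rewrite (bigD1 j)//= (negbTE wj) !mul0r mulr0 !mul0r.
apply: ler_wpM2l; first by rewrite mulr_ge0// prodr_ge0// => j _; rewrite ler0n.
have iw' := injectiveP _ iw.
have wA' : w @: A' \subset L w :\: w @: ~: S.
  apply/fintype.subsetP => _ /imsetP[j jA ->]; rewrite inE (forall_inP hit _ jA) andbT.
  apply/imsetP => -[i iS /iw' ji]; move: iS; rewrite -ji inE.
  by rewrite (fintype.subsetP A'S).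
have cnt : \sum_(y | y \notin w @: B) (y \in L w)%:R =
    (#|L w :\: w @: ~: S| - n)%:R :> R.
  have -> : (#|L w :\: w @: ~: S| - n)%N = #|(L w :\: w @: ~: S) :\: w @: A'|.
    by rewrite [RHS]cardsD (finset.setIidPr wA') card_imset// A'n.
  rewrite -natr_sum; congr _%:R; rewrite -sum1_card big_mkcond [RHS]big_mkcond/=.
  apply: eq_bigr => y _; rewrite !inE imsetU inE negb_or.
  by case: (y \in w @: ~: S); case: (y \in w @: A'); case: (y \in L w).
rewrite cnt /hit_rate.
have l1 : (n <= #|L w :\: w @: ~: S|)%N.
  by rewrite -A'n -(card_imset _ iw') subset_leq_card.
have l2 : (#|L w :\: w @: ~: S| <= N)%N.
  apply: (@leq_trans #|~: (w @: ~: S)|); last by rewrite card_pool.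
  by apply: subset_leq_card; rewrite finset.setDE finset.subsetIr.
rewrite mulrA ler_pdivlMr// (natrB _ l1) (natrB _ (ltnW nN)).
have l2' : #|L w :\: w @: ~: S|%:R <= N%:R :> R by rewrite ler_nat.
by have := ler0n R n; move: l2'; set l := #|_|%:R; set N' := N%:R; nra.
Qed.

Lemma prod_1D (x : 'I_K -> R) :
  \prod_(j in S) (1 + x j) = \sum_(A : {set 'I_K} | A \subset S) \prod_(j in A) x j.
Proof.
transitivity (\prod_(j : 'I_K) ((if j \in S then x j else 0) + 1)).
  by rewrite big_mkcond; apply: eq_bigr => j _; case: ifP => _; rewrite ?add0r// addrC.
rewrite bigA_distr [RHS]big_mkcond; apply: eq_bigr => A _; rewrite -big_mkcond/=.
case: ifP => [/fintype.subsetP AS|/negbT/fintype.subsetPn[j jA jS]].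
  by apply: eq_bigr => j /AS ->.
by rewrite (bigD1 j)//= (negbTE jS) mul0r.
Qed.

(* The moment generating function of the number of hits of a sample without
   replacement is at most that of a sample with replacement. *)
Lemma hypergeometric_mgf (L : msgs -> {set 'I_M}) (q : msgs -> R) (x : R) : 0 <= x ->
  determined_on (~: S) L -> determined_on (~: S) q -> (forall w, 0 <= q w) ->
  \sum_(w : msgs | injectiveb w) q w * \prod_(j in S) (1 + x * (w j \in L w)%:R) <=
  \sum_(w : msgs | injectiveb w) q w * (1 + x * hit_rate L w) ^+ #|S|.
Proof.
move=> x0 dL dq q0.
have -> : \sum_(w : msgs | injectiveb w) q w * (1 + x * hit_rate L w) ^+ #|S| =
    \sum_(A : {set 'I_K} | A \subset S) x ^+ #|A| *
      \sum_(w : msgs | injectiveb w) q w * hit_rate L w ^+ #|A|.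
  under [RHS]eq_bigr do rewrite mulr_sumr.
  rewrite exchange_big/=; apply: eq_bigr => w _.
  rewrite -prodr_const prod_1D mulr_sumr; apply: eq_bigr => A _.
  by rewrite prodr_const exprMn; ring.
have -> : \sum_(w : msgs | injectiveb w) q w * \prod_(j in S) (1 + x * (w j \in L w)%:R) =
    \sum_(A : {set 'I_K} | A \subset S) x ^+ #|A| *
      \sum_(w : msgs | injectiveb w) q w * \prod_(j in A) (w j \in L w)%:R.
  under [RHS]eq_bigr do rewrite mulr_sumr.
  rewrite exchange_big/=; apply: eq_bigr => w _.
  rewrite prod_1D mulr_sumr; apply: eq_bigr => A _.
  by rewrite big_split/= prodr_const; ring.
apply: ler_sum => A AS; apply: ler_wpM2l; first by rewrite exprn_ge0.
exact: joint_hits.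
Qed.

(* Sampling without replacement makes the centred terms negatively correlated, up to
   the factor [N / (N - 1)] coming from the diagonal. *)
Lemma sampling_variance (b : 'I_K -> msgs -> 'I_M -> R) : (1 < N)%N ->
  (forall i, determined_on (~: S) (b i)) ->
  (forall i w, injectiveb w -> i \in S -> \sum_(y | y \notin w @: ~: S) b i w y = 0) ->
  (N.-1)%:R * \sum_(w : msgs | injectiveb w) (\sum_(i in S) b i w (w i)) ^+ 2 <=
  \sum_(w : msgs | injectiveb w) \sum_(y | y \notin w @: ~: S) \sum_(i in S) b i w y ^+ 2.
Proof.
move=> N1 db b0.
have N0 : 0 < N%:R :> R by rewrite ltr0n (leq_trans _ N1).
have NE : N%:R = (N.-1)%:R + 1 :> R by rewrite natr1 prednK// (leq_trans _ N1).
pose T i j := \sum_(w : msgs | injectiveb w) b i w (w i) * b j w (w j).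
pose U i j := \sum_(w : msgs | injectiveb w) b i w (w i) * b j w (w i).
pose V i j := \sum_(w : msgs | injectiveb w) \sum_(y | y \notin w @: ~: S) b i w y * b j w y.
have UV i j : i \in S -> N%:R * U i j = V i j.
  move=> iS; rewrite /V (conditional_uniform (a := i))//; first by rewrite inE iS.
  by move=> w w' e; apply/funext => y; rewrite (db i _ _ e) (db j _ _ e).
have TU i j : i \in S -> j \in S -> (N.-1)%:R * T i j = (i == j)%:R * (N%:R * U i i) - U i j.
  move=> iS jS; have [<-|ij] := eqVneq i j.
    by rewrite mul1r NE /T -/(U i i); ring.
  rewrite mul0r sub0r.
  (* Given [w i], the message of [j] is uniform on the pool without [w i]. Since [b j] sums to zero
     over the pool, summing over the rest gives minus the missing term. *)
  pose B := i |: ~: S.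
  have jB : j \notin B by rewrite !inE jS orbF eq_sym.
  have cB : (M - #|B|)%N = N.-1.
    by rewrite cardsU1 inE iS add1n subnS.
  pose F w (y : 'I_M) : R := b i w (w i) * b j w y.
  have dF : determined_on B F.
    move=> w w' e; have e' : {in ~: S, w =1 w'} by move=> k kS; apply: e; rewrite in_setU1 kS orbT.
    by apply/funext => y; rewrite /F (db i _ _ e') (db j _ _ e') e// !inE eqxx.
  rewrite -cB /T -(conditional_uniform jB dF) /U -sumrN; apply: eq_bigr => w iw.
  have iw' := injectiveP _ iw.
  rewrite -mulr_sumr -mulrN; congr (_ * _); apply/eqP; rewrite -addr_eq0; apply/eqP.
  rewrite -[RHS](b0 j w iw jS) [RHS](bigD1 (w i))/=; last first.
    apply/imsetP => -[k kS /iw' ik]; move: kS; rewrite -ik inE iS//.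
  rewrite addrC; congr (_ + _); apply: eq_bigl => y.
  by rewrite imsetU1 !inE negb_or andbC.
have -> : \sum_(w : msgs | injectiveb w) \sum_(y | y \notin w @: ~: S) \sum_(i in S) b i w y ^+ 2
    = \sum_(i in S) V i i.
  rewrite /V exchange_big/=; apply: eq_bigr => w _.
  by rewrite exchange_big/=; apply: eq_bigr => y _; apply: eq_bigr => i _; rewrite expr2.
have -> : (N.-1)%:R * (\sum_(w : msgs | injectiveb w) (\sum_(i in S) b i w (w i)) ^+ 2) =
    \sum_(i in S) V i i - \sum_(i in S) \sum_(j in S) U i j.
  have -> : \sum_(w : msgs | injectiveb w) (\sum_(i in S) b i w (w i)) ^+ 2 =
      \sum_(i in S) \sum_(j in S) T i j.
    rewrite /T exchange_big/=; under [RHS]eq_bigr do rewrite exchange_big/=.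
    rewrite exchange_big/=; apply: eq_bigr => w _.
    by rewrite expr2 big_distrlr/= exchange_big.
  rewrite mulr_sumr -sumrB; apply: eq_bigr => i iS.
  rewrite mulr_sumr (eq_bigr _ (fun j jS => TU i j iS jS)) sumrB; congr (_ - _).
  rewrite -big_distrl/= UV// (bigD1 i)//= eqxx big1 ?addr0 ?mul1r// => j /andP[_ ji].
  by rewrite eq_sym (negbTE ji).
(* The discarded double sum of the [U i j] is nonnegative: [N] times it is a sum of squares over the
   pool. *)
rewrite lerBlDr lerDl -(pmulr_rge0 _ N0) mulr_sumr.
have -> : \sum_(i in S) N%:R * \sum_(j in S) U i j =
    \sum_(w : msgs | injectiveb w) \sum_(y | y \notin w @: ~: S) (\sum_(i in S) b i w y) ^+ 2.
  transitivity (\sum_(i in S) \sum_(j in S) V i j).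
    by apply: eq_bigr => i iS; rewrite mulr_sumr; apply: eq_bigr => j _; exact: UV.
  rewrite /V; under eq_bigr do rewrite exchange_big/=.
  rewrite exchange_big/=; apply: eq_bigr => w _.
  under eq_bigr do rewrite exchange_big/=.
  rewrite exchange_big/=; apply: eq_bigr => y _.
  by rewrite expr2 big_distrlr.
by apply: sumr_ge0 => w _; apply: sumr_ge0 => y _; rewrite sqr_ge0.
Qed.

End sampling_without_replacement.

(** * The Fano-type converse *)

Section fano.
Context {R : realType}.

Lemma exprn_1D_le_expR (x : R) n : -1 <= x -> (1 + x) ^+ n <= expR (x * n%:R).
Proof.
move=> x1; rewrite mulrC expRM_natl.
by apply: lerXn2r; rewrite ?nnegrE ?expR_ge0 ?expR_ge1Dx//; lra.
Qed.

(** Here [r] users are tested and [e] of the other [K - r] are missed, so the list has [r + e]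
    entries in a pool of [M - (K - r)] messages. For [e = 0] the hit rate is at most [1 / M1], and
    the choice of [A] makes each factor at most 1. The [e] further entries raise the product by at
    most [expR ((1 - c^-1) * e) <= c ^+ e], which the factor [c^-1 ^+ e] cancels. *)
Lemma fano_weight (K M r e : nat) (c M1 A : R) :
  1 <= c -> (0 < K)%N -> (K < M)%N -> (r <= K)%N ->
  M1 = M%:R / K%:R -> A = c / (c + M1 - 1) ->
  M1 ^+ r * A ^+ K * (c^-1 ^+ r * c^-1 ^+ e) *
    (1 + (c - 1) * ((r + e)%:R / (M - (K - r))%:R)) ^+ r <= 1.
Proof.
move=> c1 K0 KM rK M1E AE.
have c0 : 0 < c by lra.
have Kp : 0 < K%:R :> R by rewrite ltr0n.
have M1gt : 1 < M1 by rewrite M1E ltr_pdivlMr// mul1r ltr_nat.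
have den : 0 < c + M1 - 1 by lra.
have A0 : 0 < A by rewrite AE divr_gt0.
have A1 : A <= 1 by rewrite AE ler_pdivrMr// mul1r; lra.
set N := (M - (K - r))%N.
have NE : N%:R = M%:R - K%:R + r%:R :> R.
  by rewrite natrB ?natrB//; [ring|exact: leq_trans (leq_subr _ _) (ltnW KM)].
have KMr : K%:R < M%:R :> R by rewrite ltr_nat.
have r0 : 0 <= r%:R :> R by rewrite ler0n.
have e0 : 0 <= e%:R :> R by rewrite ler0n.
have rKr : r%:R <= K%:R :> R by rewrite ler_nat.
have N0 : 0 < N%:R :> R by rewrite NE; lra.
have rate : M1 * r%:R <= N%:R.
  rewrite M1E mulrAC ler_pdivrMr// NE.
  have : 0 <= (M%:R - K%:R) * (K%:R - r%:R) :> R by rewrite mulr_ge0// subr_ge0// ltW.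
  lra.
have -> : A ^+ K = A ^+ r * A ^+ (K - r) by rewrite -exprD subnKC.
have Arest : A ^+ (K - r) <= 1 by rewrite exprn_ile1// ltW.
have Arest0 : 0 <= A ^+ (K - r) by rewrite exprn_ge0// ltW.
have c10 : 0 <= c - 1 by lra.
have M10 : 0 <= M1 by lra.
have A0' : 0 <= A := ltW A0.
have ci0 : 0 <= c^-1 by rewrite invr_ge0 ltW.
pose v := M1 * (c - 1) / (c + M1 - 1) * (e%:R / N%:R).
have v0 : 0 <= v.
  by rewrite /v !mulr_ge0// invr_ge0 ltW.
have u1 : M1 * A * c^-1 * (1 + (c - 1) * ((r + e)%:R / N%:R)) <= 1 + v.
  have -> : M1 * A * c^-1 = M1 / (c + M1 - 1) by rewrite AE; field; rewrite !gt_eqF.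
  have -> : M1 / (c + M1 - 1) * (1 + (c - 1) * ((r + e)%:R / N%:R)) =
      M1 / (c + M1 - 1) * (1 + (c - 1) * (r%:R / N%:R)) + v.
    by rewrite /v natrD; ring.
  rewrite lerD2r mulrAC ler_pdivrMr// mul1r.
  have : M1 * (r%:R / N%:R) <= 1 by rewrite mulrA ler_pdivrMr// mul1r.
  have : 0 <= c - 1 by lra.
  set p := r%:R / N%:R => ? ?.
  have : (c - 1) * (M1 * p) <= (c - 1) * 1 by rewrite ler_wpM2l.
  lra.
have w0 : 0 <= M1 * A * c^-1 * (1 + (c - 1) * ((r + e)%:R / N%:R)).
  by rewrite !mulr_ge0// addr_ge0// mulr_ge0// divr_ge0 ?ler0n.
have ur : (M1 * A * c^-1 * (1 + (c - 1) * ((r + e)%:R / N%:R))) ^+ r <= c ^+ e.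
  apply: (@le_trans _ _ ((1 + v) ^+ r)); first by apply: lerXn2r; rewrite ?nnegrE//; lra.
  apply: le_trans (exprn_1D_le_expR _ _) _; first lra.
  rewrite -[c in leRHS](lnK (x := c)) ?posrE// -expRM_natl ler_expR [leRHS]mulrC.
  apply: (@le_trans _ _ ((1 - c^-1) * e%:R)).
    have -> : v * r%:R = ((c - 1) / (c + M1 - 1) * e%:R) * (M1 * r%:R / N%:R).
      by rewrite /v; ring.
    apply: (@le_trans _ _ ((c - 1) / (c + M1 - 1) * e%:R)).
      apply: ler_piMr; last by rewrite ler_pdivrMr// mul1r.
      by rewrite mulr_ge0// divr_ge0// ltW.
    apply: ler_wpM2r => //.
    rewrite ler_pdivrMr//.
    have -> : (1 - c^-1) * (c + M1 - 1) = (c - 1) + (1 - c^-1) * (M1 - 1).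
      by field; rewrite gt_eqF.
    rewrite lerDl mulr_ge0//; last lra.
    by rewrite subr_ge0 invf_le1.
  apply: ler_wpM2r => //.
  have := expR_ge1Dx (- ln c); rewrite expRN lnK ?posrE//; lra.
rewrite (_ : _ * _ = A ^+ (K - r) * (c^-1 ^+ e *
   (M1 * A * c^-1 * (1 + (c - 1) * ((r + e)%:R / N%:R))) ^+ r)); last first.
  by rewrite !exprMn; ring.
apply: mulr_ile1 => //; first by rewrite mulr_ge0 ?exprn_ge0 ?invr_ge0// ltW.
by rewrite exprVn mulrC ler_pdivrMr ?exprn_gt0// mul1r.
Qed.

End fano.

Section fano_sum.
Context {R : realType} {K M : nat}.
Local Notation msgs := {ffun 'I_K -> 'I_M}.
Implicit Types (w : msgs) (S : {set 'I_K}).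

Definition num_inj : R := \sum_(w : msgs | injectiveb w) 1.

Lemma num_inj_card : num_inj = #|[pred w : msgs | injectiveb w]|%:R.
Proof. by rewrite /num_inj sumr_const. Qed.

Definition num_missed (T : {set 'I_M}) w : R := \sum_(j < K) (w j \notin T)%:R.

Lemma num_missed_ge0 T w : 0 <= num_missed T w.
Proof. by apply: sumr_ge0 => j _; rewrite ler0n. Qed.

Lemma num_missed_le T w : num_missed T w <= K%:R.
Proof.
rewrite -[in leRHS](card_ord K) -sumr_const; apply: ler_sum => j _.
by case: (_ \notin _).
Qed.

Definition score (c M1 A : R) S (T : {set 'I_M}) w : R :=
  #|S|%:R * ln M1 + K%:R * ln A - num_missed T w * ln c.

(** With the list fixed by the users outside [S], a tested user contributes
    [c^-1 * (1 + (c - 1) * hit)]. [hypergeometric_mgf] replaces the dependent hits by the rate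
    [hit_rate], and [fano_weight] then bounds the summand of each message vector. *)
Lemma fano_sum S (L : msgs -> {set 'I_M}) (c M1 A : R) :
  1 <= c -> (0 < K)%N -> (K < M)%N -> M1 = M%:R / K%:R -> A = c / (c + M1 - 1) ->
  determined_on (~: S) L -> (forall w, #|L w| = K) ->
  \sum_(w : msgs | injectiveb w) expR (score c M1 A S (L w) w) <= num_inj.
Proof.
move=> c1 K0 KM M1E AE dL cL.
have c0 : 0 < c by lra.
have Kp : 0 < K%:R :> R by rewrite ltr0n.
have M1gt : 1 < M1 by rewrite M1E ltr_pdivlMr// mul1r ltr_nat.
have den : 0 < c + M1 - 1 by lra.
have A0 : 0 < A by rewrite AE divr_gt0.
pose pen (b : bool) : R := if b then 1 else c^-1.
have penE b : pen b = expR (- ((~~ b)%:R * ln c)).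
  by case: b; rewrite /pen/= ?mul0r ?oppr0 ?expR0// mul1r expRN lnK// posrE.
have pen0 b : 0 <= pen b by rewrite penE expR_ge0.
pose q w := M1 ^+ #|S| * A ^+ K *
  (c^-1 ^+ #|S| * \prod_(j | j \notin S) pen (w j \in L w)).
have scoreE w : expR (score c M1 A S (L w) w) =
    q w * \prod_(j in S) (1 + (c - 1) * (w j \in L w)%:R).
  rewrite /score !expRD !expRM_natl !lnK ?posrE//; last lra.
  rewrite /q -!mulrA; congr (_ * (_ * _)).
  rewrite /num_missed mulr_suml -sumrN expR_sum (bigID (mem S))/= mulrC [RHS]mulrCA.
  under eq_bigr do rewrite -penE.
  congr (_ * _).
  rewrite -prodr_const -big_split/=; apply: eq_bigr => j _; rewrite -penE /pen.
  by case: (_ \in _); rewrite /= ?mulr1 ?mulr0 ?addr0 ?mulr1// addrC subrK mulVf// gt_eqF.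
under eq_bigr do rewrite scoreE.
have dq : determined_on (~: S) q.
  move=> w w' e; rewrite /q (dL _ _ e); congr (_ * (_ * _)).
  by apply: eq_bigr => j jS; rewrite e// inE.
have q0 w : 0 <= q w.
  rewrite /q !mulr_ge0 ?exprn_ge0 ?invr_ge0 ?prodr_ge0//; lra.
have c10 : 0 <= c - 1 by lra.
apply: le_trans (hypergeometric_mgf (ltnW KM) c10 dL dq q0) _.
apply: ler_sum => w iw; have iw' := injectiveP _ iw.
pose E := [set j in ~: S | w j \notin L w].
have cS : #|~: S| = (K - #|S|)%N by rewrite cardsCs finset.setCK card_ord.
have penprod : \prod_(j | j \notin S) pen (w j \in L w) = c^-1 ^+ #|E|.
  rewrite -prodr_const [LHS]big_mkcond [RHS]big_mkcond; apply: eq_bigr => j _.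
  by rewrite !inE /pen; case: (j \in S) => //=; case: (w j \in L w).
(* The fixed list size enters here: entries not spent on correctly listed users outside [S] fall
   into the pool. *)
have cLE : #|L w :\: w @: ~: S| = (#|S| + #|E|)%N.
  have h1 : #|L w :&: w @: ~: S| = #|[set j in ~: S | w j \in L w]|.
    rewrite -(card_imset _ iw'); apply: eq_card => y; rewrite !inE.
    apply/andP/imsetP => [[yL /imsetP[j jS e]]|[j + ->]].
      by exists j => //; rewrite inE jS -e yL.
    by rewrite inE => /andP[jS jL]; rewrite jL; split=> //; exact: imset_f.
  have h2 : (#|[set j in ~: S | w j \in L w]| + #|E| = #|~: S|)%N.
    rewrite -(cardsID [set j | w j \in L w] (~: S)); congr (_ + _)%N;
      by apply: eq_card => j; rewrite !inE// andbC.
  have h3 := cardsID (w @: ~: S) (L w).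
  have h4 : (#|S| <= K)%N by rewrite -[leqRHS](card_ord K) max_card.
  apply/eqP; rewrite -(eqn_add2l #|L w :&: w @: ~: S|) h3 cL h1 addnCA addnC.
  by rewrite h2 cS subnK.
rewrite /q /hit_rate penprod cLE cS.
apply: fano_weight => //.
by rewrite -[leqRHS](card_ord K) max_card.
Qed.

End fano_sum.

(** * Centring the signals of the tested users *)

Section centering.
Context {R : realType} (T : finType) (Y : {set T}).
Local Notation C := R[i].

Definition mean_on (g : T -> C) : C :=
  Complex ((\sum_(y in Y) complex.Re (g y)) / #|Y|%:R)
          ((\sum_(y in Y) complex.Im (g y)) / #|Y|%:R).

Hypothesis Y0 : (0 < #|Y|)%N.

Let Yn0 : #|Y|%:R != 0 :> R.
Proof. by rewrite pnatr_eq0 -lt0n. Qed.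

Lemma Re_centered (g : T -> C) : \sum_(y in Y) complex.Re (g y - mean_on g) = 0.
Proof.
under eq_bigr do rewrite Re_complexB.
by rewrite sumrB sumr_const -mulr_natr/= divfK// subrr.
Qed.

Lemma Im_centered (g : T -> C) : \sum_(y in Y) complex.Im (g y - mean_on g) = 0.
Proof.
under eq_bigr do rewrite Im_complexB.
by rewrite sumrB sumr_const -mulr_natr/= divfK// subrr.
Qed.

Let real_variance (g : T -> R) (a : R) : a = (\sum_(y in Y) g y) / #|Y|%:R ->
  \sum_(y in Y) (g y - a) ^+ 2 <= \sum_(y in Y) g y ^+ 2.
Proof.
move=> aE; have S : \sum_(y in Y) g y = a * #|Y|%:R by rewrite aE divfK.
under eq_bigr do rewrite sqrrB.
rewrite big_split sumrB/= sumr_const -[X in _ + X]mulr_natr.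
have -> : \sum_(y in Y) g y * a *+ 2 = 2 * a * \sum_(y in Y) g y.
  by rewrite mulr_sumr; apply: eq_bigr => y _; rewrite -mulr_natr; ring.
rewrite S; have : 0 <= a ^+ 2 * #|Y|%:R by rewrite mulr_ge0 ?sqr_ge0.
by lra.
Qed.

Lemma variance_le_moment (g : T -> C) :
  \sum_(y in Y) sqc (g y - mean_on g) <= \sum_(y in Y) sqc (g y).
Proof.
rewrite /sqc !big_split/=; apply: lerD.
  under eq_bigr do rewrite Re_complexB; exact: real_variance.
under eq_bigr do rewrite Im_complexB; exact: real_variance.
Qed.

End centering.

Section deviation.
Context {R : realType} {n K M : nat}.
Local Notation C := R[i].
Local Notation msgs := {ffun 'I_K -> 'I_M}.
Implicit Types (w : msgs).
(** With the seeds frozen the users no longer share an encoder: [f i] is the codebook of user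
    [i]. *)
Variables (f : 'I_K -> 'I_M -> n.-tuple C) (P0 : R).
Hypothesis pow : forall i m, sqnorm (f i m) <= P0.
Variables (S : {set 'I_K}) (h : K.-tuple C).
Local Notation N := (M - #|~: S|)%N.

Definition pool w := ~: (w @: ~: S).

Definition residual i w (y : 'I_M) (t : 'I_n) : C :=
  tnth h i * (tnth (f i y) t - mean_on (pool w) (fun y => tnth (f i y) t)).

(** The conditional mean of the noiseless output given the messages outside [S]: a tested message is
    uniform on the pool. *)
Definition center_mean w : n.-tuple C :=
  [tuple \sum_(i in ~: S) tnth h i * tnth (f i (w i)) t +
         \sum_(i in S) tnth h i * mean_on (pool w) (fun y => tnth (f i y) t) | t < n].

Definition deviation w : n.-tuple C :=
  [tuple \sum_(i in S) residual i w (w i) t | t < n].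

Lemma determined_pool : determined_on (~: S) pool.
Proof. by move=> w w' e; rewrite /pool (eq_in_imset e). Qed.

Lemma determined_center_mean : determined_on (~: S) center_mean.
Proof.
move=> w w' e; apply: eq_from_tnth => t; rewrite !tnth_mktuple (determined_pool e).
by congr (_ + _); apply: eq_bigr => i iS; rewrite e.
Qed.

Lemma mac_output_split w z :
  mac_output (fun i => f i (w i)) h z = tadd (center_mean w) (tadd (deviation w) z).
Proof.
apply: eq_from_tnth => t; rewrite !tnth_mktuple addrA; congr (_ + _).
rewrite (bigID (mem S))/= -addrA -big_split/= addrC; congr (_ + _).
  by apply: eq_bigl => i; rewrite inE.
by apply: eq_bigr => i _; rewrite /residual mulrBr addrC subrK.
Qed.

(** Residuals sum to zero over the pool, so [sampling_variance] applies to the real and imaginary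
    parts of each coordinate. Centring can only lower a user's energy, which leaves at most [P0] per
    pool message. *)
Lemma deviation_energy : (1 < N)%N ->
  (N.-1)%:R * \sum_(w : msgs | injectiveb w) sqnorm (deviation w) <=
  N%:R * P0 * (\sum_(i in S) sqc (tnth h i)) * @num_inj R K M.
Proof.
move=> N1.
have poolE w (F : 'I_M -> R) : \sum_(y | y \notin w @: ~: S) F y = \sum_(y in pool w) F y.
  by apply: eq_bigl => y; rewrite inE.
have cp w : injectiveb w -> #|pool w| = N by exact: card_pool.
have dres i t : determined_on (~: S) (fun w y => residual i w y t).
  by move=> w w' e; apply/funext => y; rewrite /residual (determined_pool e).
pose part (g : C -> R) i w y t := g (residual i w y t).
have step1 (g : C -> R) t :
    (forall i w, injectiveb w -> i \in S -> \sum_(y | y \notin w @: ~: S) g (residual i w y t) = 0) ->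
    (N.-1)%:R * \sum_(w : msgs | injectiveb w) (\sum_(i in S) g (residual i w (w i) t)) ^+ 2 <=
    \sum_(w : msgs | injectiveb w) \sum_(y in pool w) \sum_(i in S) g (residual i w y t) ^+ 2.
  move=> g0; under [leRHS]eq_bigr do rewrite -poolE.
  have db i : determined_on (~: S) (fun w y => g (residual i w y t)).
    move=> w w' e; apply/funext => y.
    by rewrite (congr1 (fun F : 'I_M -> C => F y) (dres i t _ _ e)).
  exact: (sampling_variance (b := fun i w y => g (residual i w y t)) N1 db g0).
have re0 i w t : injectiveb w -> i \in S ->
    \sum_(y | y \notin w @: ~: S) complex.Re (residual i w y t) = 0.
  move=> iw _; rewrite poolE /residual; under eq_bigr do rewrite Re_complexM.
  rewrite sumrB -!mulr_sumr Re_centered ?Im_centered ?mulr0 ?subr0//; rewrite cp//; exact: ltnW.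
have im0 i w t : injectiveb w -> i \in S ->
    \sum_(y | y \notin w @: ~: S) complex.Im (residual i w y t) = 0.
  move=> iw _; rewrite poolE /residual; under eq_bigr do rewrite Im_complexM.
  rewrite big_split/= -!mulr_sumr Re_centered ?Im_centered ?mulr0 ?addr0//; rewrite cp//; exact: ltnW.
have -> : \sum_(w : msgs | injectiveb w) sqnorm (deviation w) =
    \sum_(t < n) \sum_(w : msgs | injectiveb w)
      ((\sum_(i in S) complex.Re (residual i w (w i) t)) ^+ 2 +
       (\sum_(i in S) complex.Im (residual i w (w i) t)) ^+ 2).
  rewrite [RHS]exchange_big/=; apply: eq_bigr => w _; rewrite sqnormE; apply: eq_bigr => t _.
  by rewrite tnth_mktuple /sqc Re_sum Im_sum.
apply: (@le_trans _ _ (\sum_(t < n) \sum_(w : msgs | injectiveb w) \sum_(y in pool w)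
    \sum_(i in S) sqc (residual i w y t))).
  rewrite mulr_sumr; apply: ler_sum => t _.
  rewrite big_split/= mulrDr.
  apply: le_trans (lerD (step1 _ t (fun i w => @re0 i w t)) (step1 _ t (fun i w => @im0 i w t))) _.
  rewrite -big_split/=; apply: ler_sum => w _.
  rewrite -big_split/=; apply: ler_sum => y _.
  by rewrite -big_split/=.
rewrite exchange_big/= /num_inj mulr_sumr; apply: ler_sum => w iw; rewrite mulr1.
have -> : \sum_(t < n) \sum_(y in pool w) \sum_(i in S) sqc (residual i w y t) =
    \sum_(i in S) sqc (tnth h i) * \sum_(t < n) \sum_(y in pool w)
      sqc (tnth (f i y) t - mean_on (pool w) (fun y => tnth (f i y) t)).
  under eq_bigr do rewrite exchange_big/=.
  rewrite exchange_big/=; apply: eq_bigr => i _.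
  rewrite mulr_sumr; apply: eq_bigr => t _; rewrite mulr_sumr.
  by apply: eq_bigr => y _; rewrite /residual sqcM.
rewrite mulr_sumr; apply: ler_sum => i _; rewrite [leRHS]mulrC.
apply: ler_wpM2l; first exact: sqc_ge0.
apply: (@le_trans _ _ (\sum_(t < n) \sum_(y in pool w) sqc (tnth (f i y) t))).
  apply: ler_sum => t _; apply: variance_le_moment.
  by rewrite cp//; exact: ltnW.
rewrite exchange_big/= -(cp w iw) mulr_natl -sumr_const; apply: ler_sum => y _.
by rewrite -sqnormE.
Qed.

End deviation.

Section deterministic_code.
Context {R : realType} {n K M : nat}.
Local Notation C := R[i].
Local Notation msgs := {ffun 'I_K -> 'I_M}.
Local Notation gamH := (iid_prob (@cnormal_prob R) K).
Local Notation gamZ := (iid_prob (@cnormal_prob R) n).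
Implicit Types (w : msgs).
Variables (f : 'I_K -> 'I_M -> n.-tuple C) (D : n.-tuple C -> {set 'I_M}) (P0 : R).
Hypothesis mD : forall A : {set 'I_M}, measurable [set y | D y = A].
Hypothesis cD : forall y, #|D y| = K.
Hypothesis pow : forall i m, sqnorm (f i m) <= P0.

Lemma measurable_dec_fun (F : {set 'I_M} -> R) : measurable_fun setT (fun y => F (D y)).
Proof. exact: measurable_fin_valued. Qed.

Definition out w (h : K.-tuple C) (z : n.-tuple C) : n.-tuple C :=
  mac_output (fun i => f i (w i)) h z.

Lemma measurable_out w : measurable_fun setT (fun p : K.-tuple C * n.-tuple C => out w p.1 p.2).
Proof.
apply/measurable_fun_tnthP => t.
rewrite (_ : _ \o _ = fun p : K.-tuple C * n.-tuple C =>
    \sum_(i < K) tnth p.1 i * tnth (f i (w i)) t + tnth p.2 t); last first.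
  by apply/funext => p /=; rewrite tnth_mktuple.
apply: measurable_complexD; last exact: (measurableT_comp (measurable_tnth t) measurable_snd).
apply: measurable_complex_sum => i; apply: measurable_complexM => //.
exact: (measurableT_comp (measurable_tnth i) measurable_fst).
Qed.

Definition loss w h : R := ex gamZ (fun z => num_missed (D (out w h z)) w).

Definition det_loss : R := (@num_inj R K M)^-1 * \sum_(w : msgs | injectiveb w) ex gamH (loss w).

Lemma measurable_loss_fun (F : {set 'I_M} -> R) w :
  measurable_fun setT (fun p : K.-tuple C * n.-tuple C => F (D (out w p.1 p.2))).
Proof. exact: (measurableT_comp (measurable_dec_fun F) (measurable_out w)). Qed.

Lemma num_missed_norm (T : {set 'I_M}) w : `|num_missed T w : R| <= K%:R.
Proof. by rewrite ger0_norm ?num_missed_ge0// num_missed_le. Qed.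

Lemma measurable_loss w : measurable_fun setT (loss w).
Proof.
exact: (measurable_ex gamH gamZ (measurable_loss_fun (fun T => num_missed T w) w)
  (fun p => num_missed_norm _ _)).
Qed.

Lemma loss_ge0 w h : 0 <= loss w h.
Proof. by apply: ex_ge0 => z; exact: num_missed_ge0. Qed.

Lemma measurable_missed_z w h : measurable_fun setT (fun z => num_missed (D (out w h z)) w : R).
Proof.
exact: (measurableT_comp (measurable_loss_fun (fun T => num_missed T w) w) (pair1_measurable h)).
Qed.

Lemma intble_missed_z w h : intble gamZ (fun z => num_missed (D (out w h z)) w).
Proof. exact: (intble_bounded _ (measurable_missed_z w h) (fun z => num_missed_norm _ _)). Qed.

Lemma loss_norm w h : `|loss w h| <= K%:R.
Proof. exact: (ex_norm_le _ (measurable_missed_z w h) (fun z => num_missed_norm _ _)). Qed.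

Lemma intble_loss w : intble gamH (loss w).
Proof. exact: (intble_bounded _ (measurable_loss w) (loss_norm w)). Qed.

Lemma K_le_M : (K <= M)%N.
Proof. by rewrite -(cD [tuple 0 | t < n]) -[leqRHS](card_ord M) max_card. Qed.

Lemma num_inj_gt0 : 0 < @num_inj R K M.
Proof.
have w0 : injectiveb [ffun i : 'I_K => widen_ord K_le_M i].
  by apply/injectiveP => i j; rewrite !ffunE => /(congr1 val)/= /val_inj.
rewrite num_inj_card ltr0n; apply/card_gt0P; exists [ffun i : 'I_K => widen_ord K_le_M i].
by rewrite inE.
Qed.

(** The factor [N / (N - 1)] of [sampling_variance] decreases in the pool size [N]; this is its
    value at the smallest pool, where all users are tested. *)
Local Notation kap := ((M - K)%:R / ((M - K).-1)%:R : R).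

(** [gibbs_bound] is applied to each message vector with the deviation as mean, then averaged. For a
    fixed value [y] under the reference law, the list decoded from [center_mean + y] depends on the
    users outside [S] only, so [fano_sum] bounds the mean exponential by 1 and cancels the [- 1]. *)
Lemma fano_fixed_fading (S : {set 'I_K}) (h : K.-tuple C) (c M1 A sg : R) :
  0 < sg -> 1 <= c -> (0 < K)%N -> (1 < M - K)%N ->
  M1 = M%:R / K%:R -> A = c / (c + M1 - 1) -> 0 <= P0 ->
  #|S|%:R * ln M1 + K%:R * ln A - ln c * ((@num_inj R K M)^-1 * \sum_(w : msgs | injectiveb w) loss w h) <=
  (2 * ln sg - 1) * n%:R + n%:R / sg ^+ 2 +
    kap * P0 / sg ^+ 2 * \sum_(i in S) sqc (tnth h i).
Proof.
move=> sg0 c1 K0 MK M1E AE P00.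
have KM : (K < M)%N by rewrite -subn_gt0 (leq_trans _ MK).
have J0 := num_inj_gt0.
set J := @num_inj R K M in J0 *.
pose cst := #|S|%:R * ln M1 + K%:R * ln A.
pose B := `|cst| + K%:R * `|ln c|.
have scoreB T w : `|score c M1 A S T w| <= B.
  rewrite /score -/cst; apply: (le_trans (ler_normB _ _)); rewrite lerD2l normrM.
  by apply: ler_wpM2r => //; exact: num_missed_norm.
pose ctr := center_mean f S h; pose dv := deviation f S h.
pose Q := iid_prob (cgauss (sg * (@sd0 R))) n.
pose s w y := score c M1 A S (D (tadd (ctr w) y)) w.
have ms w : measurable_fun setT (s w).
  exact: (measurableT_comp (measurable_dec_fun (fun T => score c M1 A S T w)) (measurable_tadd _)).
have es w : intble Q (fun y => expR (s w y)).
  apply: (intble_bounded (M := expR B) _ (measurableT_comp (@measurable_expR R) (ms w))) => y.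
  rewrite ger0_norm ?expR_ge0// ler_expR.
  exact: le_trans (ler_norm _) (scoreB _ _).
have one w : cst - ln c * loss w h <= ex Q (fun y => expR (s w y)) - 1
    + (2 * ln sg - 1) * n%:R + (sqnorm (dv w) + n%:R) / sg ^+ 2.
  apply: le_trans (gibbs_bound (dv w) sg0 (ms w) (fun y => scoreB _ _)).
  have -> : (fun z => s w (tadd (dv w) z)) =
      (fun z => cst - ln c * num_missed (D (out w h z)) w).
    apply/funext => z; rewrite /s /score -/cst /out (mac_output_split f S h) -/(ctr w) -/(dv w).
    by rewrite [num_missed _ _ * _]mulrC.
  have iz := intbleZ (ln c) (intble_missed_z w h).
  by rewrite (exB (intble_cst gamZ cst) iz) ex_cst (exZ _ (intble_missed_z w h)).
have sumexp : \sum_(w : msgs | injectiveb w) ex Q (fun y => expR (s w y)) <= J.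
  have es' w := es w.
  rewrite -(ex_sum _ (fun w => injectiveb w) es) -(ex_cst Q J).
  apply: ex_le; [exact: intble_sum|exact: intble_cst|].
  move=> y; apply: (fano_sum (L := fun w => D (tadd (ctr w) y)) c1 K0 KM M1E AE) => // w w' e.
  by rewrite /ctr (determined_center_mean f h e).
have cS : (#|S| <= K)%N by rewrite -[leqRHS](card_ord K) max_card.
have cSc : #|~: S| = (K - #|S|)%N by rewrite cardsCs finset.setCK card_ord.
have NMK : (M - K <= M - #|~: S|)%N by rewrite cSc leq_sub2l// leq_subr.
have N1 : (1 < M - #|~: S|)%N by exact: leq_trans NMK.
have energy : \sum_(w : msgs | injectiveb w) sqnorm (dv w) <=
    kap * P0 * (\sum_(i in S) sqc (tnth h i)) * J.
  have := deviation_energy pow h N1; rewrite -/J -/dv.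
  set E := \sum_(w | _) _; set q := \sum_(i in S) _; set N := (M - #|~: S|)%N.
  have Np : 0 < (N.-1)%:R :> R by rewrite ltr0n -subn1 subn_gt0.
  have MKp : 0 < ((M - K).-1)%:R :> R by rewrite ltr0n -subn1 subn_gt0.
  have q0 : 0 <= q by apply: sumr_ge0 => i _; exact: sqc_ge0.
  move=> h1; apply: (@le_trans _ _ (N%:R / (N.-1)%:R * P0 * q * J)).
    have -> : N%:R / (N.-1)%:R * P0 * q * J = N%:R * P0 * q * J / (N.-1)%:R by ring.
    by rewrite ler_pdivlMr// mulrC.
  rewrite -!mulrA [leLHS]mulrA [leRHS]mulrA; apply: ler_wpM2r; first by rewrite !mulr_ge0// ltW.
  rewrite ler_pdivrMr// mulrAC ler_pdivlMr// -!natrM ler_nat.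
  have e1 : N = N.-1.+1 by rewrite prednK// (leq_trans _ N1).
  have e2 : (M - K)%N = (M - K).-1.+1 by rewrite prednK// (leq_trans _ MK).
  rewrite [X in (X * _ <= _)%N]e1 [X in (_ <= X * _)%N]e2 !mulSn [(N.-1 * _)%N]mulnC leq_add2r.
  by rewrite -ltnS -e1 -e2.
have := ler_sum (index_enum msgs) (P := fun w => injectiveb w) (fun w _ => one w).
have sumc (x : R) : \sum_(w : msgs | injectiveb w) x = J * x.
  by rewrite /J /num_inj mulr_suml; apply: eq_bigr => w _; rewrite mul1r.
rewrite sumrB -mulr_sumr sumc big_split/= big_split/= sumrB !sumc -mulr_suml big_split/= sumc => main.
have sg2 : 0 < sg ^+ 2 by rewrite exprn_gt0.
have energy' := ler_wpM2r (ltW (_ : 0 < (sg ^+ 2)^-1)) energy.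
rewrite -(ler_pM2l J0).
have -> : J * (#|S|%:R * ln M1 + K%:R * ln A - ln c * (J^-1 * \sum_(w : msgs | injectiveb w) loss w h))
   = J * cst - ln c * \sum_(w : msgs | injectiveb w) loss w h.
  by rewrite /cst; field; rewrite gt_eqF.
apply: le_trans main _.
have {}energy' : (\sum_(w : msgs | injectiveb w) sqnorm (dv w)) / sg ^+ 2 <=
    kap * P0 * (\sum_(i in S) sqc (tnth h i)) * J / sg ^+ 2.
  by apply: energy'; rewrite invr_gt0.
move: sumexp energy'.
set X := \sum_(w | _) ex _ _; set Y := \sum_(w | _) _; set Z := \sum_(i in S) _.
move=> hX hY.
apply: (@le_trans _ _ (J - J * 1 + J * ((2 * ln sg - 1) * n%:R) +
   (kap * P0 * Z * J / sg ^+ 2 + J * n%:R / sg ^+ 2))).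
  by rewrite [X in _ + X <= _]mulrDl; apply: lerD; [rewrite !lerD2r|rewrite lerD2r].
by rewrite le_eqVlt; apply/orP; left; apply/eqP; ring.
Qed.

(** The previous bound holds for every fading vector, so [S] may be selected by the fading itself;
    in expectation only the probability and the energy of the selector [b] remain. *)
Lemma fano_converse (b : C -> bool) (theta a c M1 A sg : R) :
  measurable_fun setT (fun z => (b z)%:R : R) ->
  ex cnormal_prob (fun z => (b z)%:R) = theta ->
  intble cnormal_prob (fun z => (b z)%:R * sqc z) ->
  ex cnormal_prob (fun z => (b z)%:R * sqc z) = a ->
  0 < sg -> 1 <= c -> (0 < K)%N -> (1 < M - K)%N ->
  M1 = M%:R / K%:R -> A = c / (c + M1 - 1) -> 0 <= P0 ->
  K%:R * theta * ln M1 + K%:R * ln A - ln c * det_loss <=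
  (2 * ln sg - 1) * n%:R + n%:R / sg ^+ 2 + kap * P0 / sg ^+ 2 * (K%:R * a).
Proof.
move=> mb eb ib ea sg0 c1 K0 MK M1E AE P00.
have ib0 : intble cnormal_prob (fun z : C => (b z)%:R : R).
  by apply: (intble01 _ mb) => z; case: (b z); rewrite ?lexx ?ler01.
pose cnt (h : K.-tuple C) : R := \sum_(i < K) (b (tnth h i))%:R.
pose nrg (h : K.-tuple C) : R := \sum_(i < K) (b (tnth h i))%:R * sqc (tnth h i).
have mi (i : 'I_K) := ge0_ex_marginal i ib0 (fun z => ler0n R (b z)).
have ni (i : 'I_K) := ge0_ex_marginal i ib (fun z => mulr_ge0 (ler0n R (b z)) (sqc_ge0 z)).
have icnt : intble gamH cnt by apply: intble_sum => i; exact: (proj1 (mi i)).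
have inrg : intble gamH nrg by apply: intble_sum => i; exact: (proj1 (ni i)).
have ecnt : ex gamH cnt = K%:R * theta.
  apply: (etrans (ex_sum _ _ (fun i => proj1 (mi i)))).
  under eq_bigr do rewrite (etrans (proj2 (mi _)) eb).
  by rewrite sumr_const card_ord mulr_natl.
have enrg : ex gamH nrg = K%:R * a.
  apply: (etrans (ex_sum _ _ (fun i => proj1 (ni i)))).
  under eq_bigr do rewrite (etrans (proj2 (ni _)) ea).
  by rewrite sumr_const card_ord mulr_natl.
pose S (h : K.-tuple C) : {set 'I_K} := [set i | b (tnth h i)]%SET.
have cntE h : cnt h = #|S h|%:R.
  rewrite /cnt -sum1_card natr_sum big_mkcond [RHS]big_mkcond/=; apply: eq_bigr => i _.
  by rewrite inE; case: (b _).
have nrgE h : nrg h = \sum_(i in S h) sqc (tnth h i).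
  rewrite /nrg [RHS]big_mkcond/=; apply: eq_bigr => i _.
  by rewrite inE; case: (b _); rewrite ?mul1r ?mul0r.
have isum : intble gamH (fun h => \sum_(w : msgs | injectiveb w) loss w h).
  by apply: intble_sum => w; exact: intble_loss.
pose LHS h := ln M1 * cnt h + K%:R * ln A -
  (ln c * (@num_inj R K M)^-1) * \sum_(w : msgs | injectiveb w) loss w h.
pose RHS h := (2 * ln sg - 1) * n%:R + n%:R / sg ^+ 2 + kap * P0 / sg ^+ 2 * nrg h.
have i1 := intbleD (intbleZ (ln M1) icnt) (intble_cst gamH (K%:R * ln A)).
have i2 := intbleZ (ln c * (@num_inj R K M)^-1) isum.
have i3 := intbleZ (kap * P0 / sg ^+ 2) inrg.
have i4 := intble_cst gamH ((2 * ln sg - 1) * n%:R + n%:R / sg ^+ 2).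
have : ex gamH LHS <= ex gamH RHS.
  apply: (ex_le (intbleB i1 i2) (intbleD i4 i3)) => h.
  apply: le_trans (le_trans (fano_fixed_fading (S h) h sg0 c1 K0 MK M1E AE P00) _).
    by rewrite cntE [ln M1 * _]mulrC mulrA.
  by rewrite nrgE.
have -> : ex gamH LHS = K%:R * theta * ln M1 + K%:R * ln A - ln c * det_loss.
  apply: (etrans (exB i1 i2)).
  rewrite (exD (intbleZ (ln M1) icnt) (intble_cst gamH _)) (exZ _ icnt) ex_cst (exZ _ isum) ecnt.
  rewrite (ex_sum _ _ (fun w => intble_loss w)) /det_loss -!mulrA; congr (_ + _ - _).
  by rewrite mulrC -mulrA.
have -> : ex gamH RHS = (2 * ln sg - 1) * n%:R + n%:R / sg ^+ 2 + kap * P0 / sg ^+ 2 * (K%:R * a).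
  by apply: (etrans (exD i4 i3)); rewrite ex_cst (exZ _ inrg) enrg.
by [].
Qed.

End deterministic_code.

(** * The testing converse *)

Section deleted_user.
Context {R : realType} {n K M : nat}.
Local Notation C := R[i].
Local Notation msgs := {ffun 'I_K -> 'I_M}.
Local Notation gam := (@cnormal_prob R).
Local Notation gamH := (iid_prob (@cnormal_prob R) K).
Local Notation gamZ := (iid_prob (@cnormal_prob R) n).
Implicit Types (w : msgs) (h : K.-tuple C).
Variables (f : 'I_K -> 'I_M -> n.-tuple C) (D : n.-tuple C -> {set 'I_M}) (P0 : R).
Hypothesis mD : forall A : {set 'I_M}, measurable [set y | D y = A].
Hypothesis cD : forall y, #|D y| = K.
Hypothesis pow : forall i m, sqnorm (f i m) <= P0.
Hypothesis P0_ge0 : 0 <= P0.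
Local Notation out := (out f).
Local Notation loss := (loss f D).
Local Notation det_loss := (det_loss f D).

Definition signal j w (x : C) : n.-tuple C := [tuple x * tnth (f j (w j)) t | t < n].

(** User [j] is deleted by setting its fading coefficient to 0; its signal then acts as a shift of
    the noise. *)
Lemma out_tset j w h x z : out w (tset h j x) z = out w (tset h j 0) (tadd (signal j w x) z).
Proof.
apply: eq_from_tnth => t; rewrite !tnth_mktuple (bigD1 j)//= [in RHS](bigD1 j)//=.
rewrite !tnth_mktuple eqxx mul0r add0r addrA [_ + \sum_(_ | _) _]addrC; congr (_ + _ + _).
by apply: eq_bigr => i ij; rewrite !tnth_mktuple (negbTE ij).
Qed.

Lemma tset_id d (T : measurableType d) m (h : m.-tuple T) j : tset h j (tnth h j) = h.
Proof. by apply: eq_from_tnth => i; rewrite tnth_tset; case: eqP => [->|]. Qed.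

Lemma tset_tset d (T : measurableType d) m (h : m.-tuple T) j x y : tset (tset h j x) j y = tset h j y.
Proof. by apply: eq_from_tnth => i; rewrite !tnth_tset; case: eqP. Qed.

Lemma sqnorm_signal j w x : sqnorm (signal j w x) <= sqc x * P0.
Proof.
rewrite sqnormE; under eq_bigr do rewrite tnth_mktuple sqcM.
by rewrite -mulr_sumr -sqnormE ler_wpM2l ?sqc_ge0.
Qed.

Definition hit j w h : R := ex gamZ (fun z => (w j \in D (out w h z))%:R).

Lemma measurable_hit_z j w h : measurable_fun setT (fun z => (w j \in D (out w h z))%:R : R).
Proof.
exact: (measurableT_comp (measurable_loss_fun f mD (fun T => (w j \in T)%:R) w) (pair1_measurable h)).
Qed.

Lemma bool01 (b : bool) : 0 <= (b%:R : R) <= 1.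
Proof. by case: b; rewrite ?lexx ?ler01. Qed.

Lemma bool_norm (b : bool) : `|b%:R : R| <= 1.
Proof. by case: b; rewrite ?normr1 ?normr0 ?lexx ?ler01. Qed.

Lemma intble_hit_z j w h : intble gamZ (fun z => (w j \in D (out w h z))%:R : R).
Proof. exact: (intble01 _ (measurable_hit_z j w h) (fun z => bool01 _)). Qed.

Lemma measurable_hit j w : measurable_fun setT (hit j w).
Proof.
exact: (measurable_ex gamH gamZ (measurable_loss_fun f mD (fun T => (w j \in T)%:R) w)
  (fun p => bool_norm _)).
Qed.

Lemma hit01 j w h : 0 <= hit j w h <= 1.
Proof. exact: (ex01 _ (measurable_hit_z j w h) (fun z => bool01 _)). Qed.

Lemma num_missedE (T : {set 'I_M}) w :
  num_missed T w = K%:R - \sum_(i < K) (w i \in T)%:R :> R.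
Proof.
have -> : K%:R = \sum_(i < K) 1 :> R by rewrite sumr_const card_ord.
rewrite /num_missed -sumrB; apply: eq_bigr => i _.
by case: (_ \in _) => /=; rewrite ?subr0 ?subrr.
Qed.

Lemma sum_hit w h : \sum_(j < K) hit j w h = K%:R - loss w h.
Proof.
rewrite -(ex_sum _ _ (fun j => intble_hit_z j w h)) -(ex_cst gamZ K%:R).
rewrite -(exB (intble_cst gamZ K%:R) (intble_missed_z f mD w h)).
congr ex; apply/funext => z.
by rewrite num_missedE opprB addrC subrK.
Qed.

Lemma tset0_measurable (j : 'I_K) : measurable_fun setT (fun h : K.-tuple C => tset h j 0).
Proof. exact: (measurableT_comp (measurable_tset j) (pair2_measurable (0 : C))). Qed.

Section test.
Variables (tau : R) (d : C -> R).
Hypothesis d_ge0 : forall x, 0 <= d x.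
Hypothesis md : measurable_fun setT d.
Hypothesis d_energy : forall x, 2 * P0 * sqc x <= d x ^+ 2.

(** The slope at level [Qfun tau] of the Neyman--Pearson curve for a shift [d x]. Fixing [tau] for
    all fading values keeps the bound affine in the deleted hit probability. *)
Definition test_level (x : C) : R := expR (tau * d x - d x ^+ 2 / 2).

Lemma hit_le_deleted j w h :
  hit j w h <= test_level (tnth h j) * (hit j w (tset h j 0) - Qfun tau) + Qfun (tau - d (tnth h j)).
Proof.
set x := tnth h j.
have e : hit j w h = ex gamZ (fun z => (fun z => (w j \in D (out w (tset h j 0) z))%:R : R)
    (tadd (signal j w x) z)).
  by congr ex; apply/funext => z; rewrite /= -out_tset /x tset_id.
rewrite e; apply: shift_test => //; last by move=> z; exact: bool01.
- apply: le_trans (d_energy x); rewrite -mulrA ler_pM2l//.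
  by rewrite [leRHS]mulrC sqnorm_signal.
- exact: measurable_hit_z.
Qed.

Lemma test_level_le x : test_level x <= expR (tau ^+ 2 / 2).
Proof. by rewrite ler_expR; have := sqr_ge0 (d x - tau); nra. Qed.

Lemma measurable_test_level : measurable_fun setT test_level.
Proof.
apply: (measurableT_comp (@measurable_expR R)); apply: measurable_funB.
  exact: measurable_funM.
by apply: measurable_funM => //; exact: measurable_funX.
Qed.

Lemma measurable_Qtest : measurable_fun setT (fun x => Qfun (tau - d x)).
Proof.
apply: (measurableT_comp (continuous_measurable_fun (@continuous_Qfun R))).
exact: measurable_funB.
Qed.

Local Notation lamb := (ex cnormal_prob test_level).
Local Notation qbar := (ex cnormal_prob (fun x => Qfun (tau - d x))).

Definition deleted_hit j w := ex gamH (fun h => hit j w (tset h j 0)).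

(** After deletion the hit probability of user [j] does not depend on its fading, so the slope and
    the deleted hit probability are independent and their mean product factorizes. *)
Lemma ex_hit_le j w : ex gamH (hit j w) <= lamb * (deleted_hit j w - Qfun tau) + qbar.
Proof.
have m0 : measurable_fun setT (fun h => hit j w (tset h j 0)).
  exact: (measurableT_comp (measurable_hit j w) (tset0_measurable j)).
have i0 : intble gamH (fun h => hit j w (tset h j 0)) by exact: (intble01 _ m0 (fun h => hit01 _ _ _)).
have q01 x : 0 <= Qfun (tau - d x) <= 1 by rewrite Qfun_ge0 Qfun_le1.
have l0 x : 0 <= test_level x <= expR (tau ^+ 2 / 2) by rewrite expR_ge0 test_level_le.
have il : intble cnormal_prob test_level.
  apply: (intble_bounded _ measurable_test_level (M := expR (tau ^+ 2 / 2))) => x.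
  by case/andP: (l0 x) => ? ?; rewrite ger0_norm.
have iq : intble cnormal_prob (fun x => Qfun (tau - d x)) by exact: (intble01 _ measurable_Qtest q01).
have [ml el] := ge0_ex_marginal j il (fun x => expR_ge0 _).
have [mq eq] := ge0_ex_marginal j iq (fun x => Qfun_ge0 _).
have dep : forall h x, hit j w (tset (tset h j x) j 0) = hit j w (tset h j 0).
  by move=> h x; rewrite tset_tset.
have prod := ex_indep cnormal_prob (i := j) measurable_test_level l0 m0 (fun h => hit01 _ _ _) dep.
have mp : measurable_fun setT (fun h : K.-tuple C => test_level (tnth h j) * hit j w (tset h j 0)).
  by apply: measurable_funM => //; exact: (measurableT_comp measurable_test_level (measurable_tnth j)).
have ip : intble gamH (fun h => test_level (tnth h j) * hit j w (tset h j 0)).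
  apply: (intble_bounded _ mp (M := expR (tau ^+ 2 / 2))) => h.
  have /andP[a1 a2] := l0 (tnth h j); have /andP[b1 b2] := hit01 j w (tset h j 0).
  by rewrite ger0_norm ?mulr_ge0// -[leRHS]mulr1 ler_pM.
have iT := intbleZ (Qfun tau) ml.
have iA := intbleD (intbleB ip iT) mq.
have ih : intble gamH (hit j w) by exact: (intble01 _ (measurable_hit j w) (fun h => hit01 _ _ _)).
apply: le_trans (ex_le ih iA _) _.
  move=> h; apply: le_trans (hit_le_deleted j w h) _.
  by rewrite mulrBr [Qfun tau * _]mulrC.
rewrite (exD (intbleB ip iT) mq) (exB ip iT) (exZ _ ml) el eq prod /deleted_hit.
by rewrite mulrBr [Qfun tau * _]mulrC.
Qed.

End test.

Definition deleted_loss j w := ex gamH (fun h => loss w (tset h j 0)).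

Lemma measurable_deleted_loss j w : measurable_fun setT (fun h => loss w (tset h j 0)).
Proof. exact: (measurableT_comp (measurable_loss f mD w) (tset0_measurable j)). Qed.

Lemma intble_deleted_loss j w : intble gamH (fun h => loss w (tset h j 0)).
Proof.
exact: (intble_bounded _ (measurable_deleted_loss j w) (fun h => loss_norm f mD w _)).
Qed.

(* Without the signal of user [j], its message is uniform on the [M - K + 1] values not taken by
   the others, and the decoder lists at most [K] of them minus the correct decodings. *)
Lemma sum_deleted_hit j :
  (M - K.-1)%:R * \sum_(w : msgs | injectiveb w) deleted_hit j w <=
  \sum_(w : msgs | injectiveb w) (deleted_loss j w + 1).
Proof.
pose B : {set 'I_K} := ~: [set j]%SET.
have jB : j \notin B by rewrite !inE eqxx.
have cB : #|B| = K.-1 by rewrite cardsCs finset.setCK cards1 card_ord subn1.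
have pt h z : (M - K.-1)%:R * \sum_(w : msgs | injectiveb w) (w j \in D (out w (tset h j 0) z))%:R <=
    \sum_(w : msgs | injectiveb w) (num_missed (D (out w (tset h j 0) z)) w + 1) :> R.
  pose F w (y : 'I_M) : R := (y \in D (out w (tset h j 0) z))%:R.
  have dF : determined_on B F.
    move=> w w' e; rewrite /F; suff -> : out w (tset h j 0) z = out w' (tset h j 0) z by [].
    apply: eq_from_tnth => t; rewrite !tnth_mktuple; congr (_ + _); apply: eq_bigr => i _.
    have [->|ij] := eqVneq i j; first by rewrite tnth_tset eqxx !mul0r.
    by rewrite e// !inE.
  rewrite -cB -(conditional_uniform jB dF); apply: ler_sum => w /injectiveP iw.
  set T := D _; rewrite /F -/T.
  have s1 : \sum_(y : 'I_M) (y \in T)%:R = K%:R :> R.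
    transitivity (#|T|%:R : R); last by rewrite cD.
    rewrite -sum1_card natr_sum [RHS]big_mkcond/=; apply: eq_bigr => y _.
    by case: (_ \in _).
  have s2 : \sum_(y in w @: B) (y \in T)%:R = \sum_(i in B) (w i \in T)%:R :> R.
    by rewrite big_imset//= => x y _ _; exact: iw.
  have s4 : \sum_(i < K) (w i \in T)%:R = (w j \in T)%:R + \sum_(i in B) (w i \in T)%:R :> R.
    by rewrite (bigD1 j)//=; congr (_ + _); apply: eq_bigl => i; rewrite !inE.
  (* The listed messages outside [w @: B] number the missed users, plus one if [j] itself is listed;
     this is the [+ 1] of the statement. *)
  move: s1; rewrite (bigID (mem (w @: B)))/= s2 num_missedE s4 => <-.
  have fin (a b c : R) : c <= 1 -> b <= a + b - (c + a) + 1 by move=> ?; lra.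
  by apply: fin; case/andP: (bool01 (w j \in T)).
have iH w : intble gamH (fun h => hit j w (tset h j 0)).
  have m0 := measurableT_comp (measurable_hit j w) (tset0_measurable j).
  exact: (intble01 _ m0 (fun h => hit01 _ _ _)).
have iS1 : intble gamH (fun h => \sum_(w : msgs | injectiveb w) hit j w (tset h j 0)) by exact: intble_sum.
have iL w := intbleD (intble_deleted_loss j w) (intble_cst gamH 1).
rewrite /deleted_hit -(ex_sum _ _ iH) -(exZ _ iS1).
under eq_bigr do rewrite /deleted_loss -(ex_cst gamH 1) -(exD (intble_deleted_loss j _) (intble_cst gamH 1)).
rewrite -(ex_sum _ _ iL).
apply: (ex_le (intbleZ _ iS1) (intble_sum _ _ iL)) => h.
have iz w := intble_hit_z j w (tset h j 0).
have iS2 : intble gamZ (fun z => \sum_(w : msgs | injectiveb w) (w j \in D (out w (tset h j 0) z))%:R : R).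
  exact: intble_sum.
have im w := intbleD (intble_missed_z f mD w (tset h j 0)) (intble_cst gamZ 1).
rewrite /hit -(ex_sum _ _ iz) -(exZ _ iS2) /loss.
under eq_bigr do rewrite -(ex_cst gamZ 1) -(exD (intble_missed_z f mD _ (tset h j 0)) (intble_cst gamZ 1)).
rewrite -(ex_sum _ _ im).
exact: (ex_le (intbleZ _ iS2) (intble_sum _ _ im) (pt h)).
Qed.

(** * Deleting a user in a deep fade *)

Section removing_a_user.
Variables (delta dd : R).
Hypothesis delta_gt0 : 0 < delta.
Hypothesis dd_ge0 : 0 <= dd.
Hypothesis dd_energy : 2 * P0 * delta <= dd ^+ 2.
Local Notation b := (disc_at delta).
Local Notation p := (1 - expR (- delta)).
Local Notation tv := (Qfun (- (dd / 2)) - Qfun (dd / 2)).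

(** [shift_test] for the fraction of decoded users, at multiplier 1, where it becomes a total
    variation bound: [tv] is the distance between two unit Gaussians whose means differ by [dd]. *)
Lemma loss_deleted_le j w h x : b x -> loss w (tset h j 0) <= loss w (tset h j x) + K%:R * tv.
Proof.
move=> /andP[_ xd].
have Kp : 0 < K%:R :> R by rewrite ltr0n (leq_ltn_trans _ (ltn_ord j)).
pose g z : R := 1 - K%:R^-1 * num_missed (D (out w (tset h j 0) z)) w.
have iz h' := intble_missed_z f mD w h'.
have mg : measurable_fun setT g.
  by apply: measurable_funB => //; apply: measurable_funM => //; exact: measurable_missed_z.
have g01 z : 0 <= g z <= 1.
  rewrite /g subr_ge0 lerBlDr lerDl mulr_ge0 ?invr_ge0 ?ler0n ?num_missed_ge0// andbT.
  by rewrite mulrC ler_pdivrMr// mul1r num_missed_le.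
(* The threshold [dd / 2], midway between the two means, is the one with multiplier 1. *)
have e1 : 1 = expR (dd / 2 * dd - dd ^+ 2 / 2) :> R.
  by rewrite (_ : _ - _ = 0) ?expR0//; ring.
have en : 2 * sqnorm (signal j w x) <= dd ^+ 2.
  apply: le_trans dd_energy; rewrite -mulrA ler_pM2l//.
  apply: le_trans (sqnorm_signal j w x) _.
  by rewrite mulrC ler_wpM2l.
have := shift_test dd_ge0 en e1 mg g01.
have -> : (fun z => g (tadd (signal j w x) z)) =
    fun z => 1 - K%:R^-1 * num_missed (D (out w (tset h j x) z)) w.
  by apply/funext => z; rewrite /g -out_tset.
rewrite !(exB (intble_cst gamZ 1) (intbleZ K%:R^-1 (iz _))) !(exZ K%:R^-1 (iz _)) !ex_cst.
rewrite (_ : dd / 2 - dd = - (dd / 2)); last by field.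
rewrite -/(loss w (tset h j 0)) -/(loss w (tset h j x)) mul1r => h1.
have h2 : K%:R^-1 * loss w (tset h j 0) <= K%:R^-1 * loss w (tset h j x) + tv by lra.
move: h2; rewrite -(ler_pM2l Kp) mulrDr !mulrA divff ?gt_eqF//.
by rewrite !mul1r.
Qed.

Lemma disc_selectorE : [/\ measurable_fun setT (fun x => (b x)%:R : R),
  intble gam (fun x => (b x)%:R) & ex gam (fun x => (b x)%:R) = p].
Proof.
have [mb eb _ _] := disc_at_law delta_gt0.
by split => //; exact: (intble01 _ mb (fun x => bool01 _)).
Qed.

Lemma weak_prob_gt0 : 0 < p.
Proof. by rewrite subr_gt0 expR_lt1 oppr_lt0. Qed.

Lemma Qfun_gap_ge0 : 0 <= tv.
Proof.
rewrite subr_ge0; apply: Qfun_nonincreasing.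
by apply: (@le_trans _ _ 0); rewrite ?oppr_le0 divr_ge0.
Qed.

(** The deleted loss ignores the coefficient of user [j], so multiplying by [p] amounts to
    restricting to a fresh weak coefficient, where [loss_deleted_le] applies; resampling then
    identifies the fresh coefficient with the true one. *)
Lemma deleted_loss_le j w :
  p * deleted_loss j w <= ex gamH (fun h => (b (tnth h j))%:R * loss w h) + p * (K%:R * tv).
Proof.
have [mb ib eb] := disc_selectorE.
pose phi h := (b (tnth h j))%:R * (loss w h + K%:R * tv).
have mbj : measurable_fun setT (fun h : K.-tuple C => (b (tnth h j))%:R : R).
  exact: (measurableT_comp mb (measurable_tnth j)).
have mphi : measurable_fun setT phi.
  apply: measurable_funM => //; apply: measurable_funD => //; exact: measurable_loss.
have Ktv : 0 <= K%:R * tv by rewrite mulr_ge0 ?Qfun_gap_ge0.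
have lK h : 0 <= loss w h <= K%:R.
  by rewrite loss_ge0 (le_trans (ler_norm _) (loss_norm f mD w h)).
have phiB h : 0 <= phi h <= K%:R + K%:R * tv.
  have /andP[l0 l1] := lK h; rewrite /phi; case: (b _); rewrite ?mul1r ?mul0r ?lexx/=.
    by rewrite addr_ge0//= lerD2r.
  by rewrite addr_ge0.
have phin h : `|phi h| <= K%:R + K%:R * tv by case/andP: (phiB h) => ? ?; rewrite ger0_norm.
have mphi2 : measurable_fun setT (fun q : K.-tuple C * C => phi (tset q.1 j q.2)).
  exact: (measurableT_comp mphi (measurable_tset j)).
have i1 : intble gamH (fun h => ex gam (fun x => phi (tset h j x))).
  have m1 := measurable_ex gamH gam mphi2 (fun q => phin _).
  apply: (intble_bounded _ m1 (M := K%:R + K%:R * tv)) => h.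
  exact: (ex_norm_le _ (measurableT_comp mphi2 (pair1_measurable h)) (fun x => phin _)).
have i0 := intble_deleted_loss j w.
apply: (@le_trans _ _ (ex gamH (fun h => ex gam (fun x => phi (tset h j x))))).
  rewrite /deleted_loss -(exZ _ i0); apply: (ex_le (intbleZ _ i0) i1) => h.
  rewrite mulrC -eb -(exZ _ ib).
  have i2 : intble gam (fun x => phi (tset h j x)).
    exact: (intble_bounded _ (measurableT_comp mphi2 (pair1_measurable h)) (fun x => phin _)).
  apply: (ex_le (intbleZ _ ib) i2) => x; rewrite /phi tnth_tset eqxx.
  case bx : (b x); last by rewrite mulr0 mul0r.
  by rewrite mulr1 mul1r; apply (loss_deleted_le j w h bx).
rewrite (ex_resample _ j mphi phiB).
have [im em] := ge0_ex_marginal j ib (fun x => ler0n R (b x)).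
have i3 : intble gamH (fun h => (b (tnth h j))%:R * loss w h).
  have m3 := measurable_funM mbj (measurable_loss f mD w).
  apply: (intble_bounded _ m3 (M := K%:R)) => h.
  by rewrite normrM -[leRHS]mul1r ler_pM ?bool_norm//; exact: (loss_norm f mD).
have i4 := intbleZ (K%:R * tv) im.
have -> : phi = fun h => (b (tnth h j))%:R * loss w h + (K%:R * tv) * (b (tnth h j))%:R.
  by apply/funext => h; rewrite /phi mulrDr [X in _ + X]mulrC.
by rewrite (exD i3 i4) (exZ _ im) em eb [_ * p]mulrC.
Qed.

Definition num_weak h : R := \sum_(j < K) (b (tnth h j))%:R.

Lemma num_weak_variance : intble gamH (fun h => (num_weak h - K%:R * p) ^+ 2) /\
  ex gamH (fun h => (num_weak h - K%:R * p) ^+ 2) <= K%:R.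
Proof.
have [mb ib eb] := disc_selectorE.
have mbj (j : 'I_K) : measurable_fun setT (fun h : K.-tuple C => (b (tnth h j))%:R : R).
  exact: (measurableT_comp mb (measurable_tnth j)).
have im (j : 'I_K) := proj1 (ge0_ex_marginal j ib (fun x => ler0n R (b x))).
have em (j : 'I_K) := etrans (proj2 (ge0_ex_marginal j ib (fun x => ler0n R (b x)))) eb.
have mij (i j : 'I_K) := measurable_funM (mbj i) (mbj j).
have iij (i j : 'I_K) : intble gamH (fun h => (b (tnth h i))%:R * (b (tnth h j))%:R).
  apply: (intble01 _ (mij i j)) => h.
  by rewrite /= -natrM mulnb; exact: bool01.
have eij (i j : 'I_K) : i != j -> ex gamH (fun h => (b (tnth h i))%:R * (b (tnth h j))%:R) = p * p.
  move=> ij; rewrite -[X in X * _]eb -(em j).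
  apply: (ex_indep gam (i := i) mb (fun x => bool01 _) (mbj j) (fun h => bool01 _)) => h x.
  by rewrite tnth_tset eq_sym (negbTE ij).
have eii (i : 'I_K) : ex gamH (fun h => (b (tnth h i))%:R * (b (tnth h i))%:R) = p.
  by rewrite -[RHS](em i); congr ex; apply/funext => h; rewrite -natrM mulnb andbb.
have iW : intble gamH num_weak by exact: (intble_sum _ _ im).
have eW : ex gamH num_weak = K%:R * p.
  apply: (etrans (ex_sum _ _ im)); under eq_bigr do rewrite em.
  by rewrite sumr_const card_ord mulr_natl.
pose sq h : R := \sum_(i < K) \sum_(j < K) (b (tnth h i))%:R * (b (tnth h j))%:R.
have isq : intble gamH sq.
  by apply: intble_sum => i; apply: intble_sum => j; exact: iij.
have esq : ex gamH sq = K%:R * (p + (K%:R - 1) * (p * p)).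
  apply: (etrans (ex_sum _ _ (fun i => intble_sum _ _ (iij i)))).
  rewrite mulr_natl -[in RHS](card_ord K) -[RHS]sumr_const; apply: eq_bigr => i _.
  rewrite (ex_sum _ _ (iij i)) (bigD1 i)//= eii; congr (_ + _).
  rewrite (eq_bigr (fun=> p * p)); last by move=> j ji; rewrite eij// eq_sym.
  rewrite sumr_const -[LHS]mulr_natl; congr (_ * _).
  have -> : #|(fun j : 'I_K => j != i)| = K.-1 by have := cardC1 i; rewrite card_ord.
  have K0 : (0 < K)%N by rewrite (leq_ltn_trans _ (ltn_ord i)).
  by rewrite -subn1 natrB// card_ord.
have e : (fun h => (num_weak h - K%:R * p) ^+ 2) =
    (fun h => sq h - (2 * (K%:R * p)) * num_weak h + (K%:R * p) ^+ 2).
  apply/funext => h; have -> : sq h = num_weak h ^+ 2 by rewrite /sq /num_weak expr2 big_distrlr.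
  by ring.
have i1 := intbleB isq (intbleZ (2 * (K%:R * p)) iW).
rewrite e; split; first exact: (intbleD i1 (intble_cst gamH _)).
rewrite (exD i1 (intble_cst gamH _)) (exB isq (intbleZ _ iW)) (exZ _ iW) ex_cst eW esq.
have Kp : 0 <= K%:R :> R by exact: ler0n.
have p0 := weak_prob_gt0; have p1 : p <= 1 by rewrite lerBlDr lerDl expR_ge0.
move: Kp p0 p1; move: (K%:R : R) (p : R) => k q k0 q0 q1.
rewrite (_ : _ + _ = k * (q - q * q)); last by ring.
by rewrite -[leRHS]mulr1 ler_wpM2l//; nra.
Qed.

(** Summation over users produces the mean of [num_weak h * loss w h], two quantities that depend on
    the same fading. Replacing [num_weak] by its mean [K * p] costs [K * sqrt K], as the loss is at
    most [K] and the variance at most [K]. *)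
Lemma sum_deleted_loss_le w :
  p * \sum_(j < K) deleted_loss j w <=
  K%:R * (p * ex gamH (loss w) + Num.sqrt K%:R + p * (K%:R * tv)).
Proof.
have [K0|K0] := posnP K.
  rewrite big1 ?mulr0; last by move=> j; have := ltn_ord j; rewrite [X in (_ < X)%N]K0.
  have p0 := ltW weak_prob_gt0; have tv0 := Qfun_gap_ge0.
  have el0 : 0 <= ex gamH (loss w) by apply: ex_ge0 => h; exact: loss_ge0.
  by rewrite mulr_ge0// !addr_ge0 ?sqrtr_ge0 ?mulr_ge0.
have Kp : 0 < K%:R :> R by rewrite ltr0n.
have [mb ib eb] := disc_selectorE.
set s := Num.sqrt K%:R.
have s0 : 0 < s by rewrite sqrtr_gt0.
have s2 : s * s = K%:R by rewrite -expr2 sqr_sqrtr// ltW.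
have [iV eV] := num_weak_variance.
have lK h : 0 <= loss w h <= K%:R.
  by rewrite loss_ge0 (le_trans (ler_norm _) (loss_norm f mD w h)).
have mbj (j : 'I_K) : measurable_fun setT (fun h : K.-tuple C => (b (tnth h j))%:R : R).
  exact: (measurableT_comp mb (measurable_tnth j)).
have ij (j : 'I_K) : intble gamH (fun h => (b (tnth h j))%:R * loss w h).
  have m3 := measurable_funM (mbj j) (measurable_loss f mD w).
  apply: (intble_bounded _ m3 (M := K%:R)) => h.
  by rewrite normrM -[leRHS]mul1r ler_pM ?bool_norm//; exact: (loss_norm f mD).
have il := intble_loss f mD w.
have step1 : \sum_(j < K) ex gamH (fun h => (b (tnth h j))%:R * loss w h) <=
    K%:R * p * ex gamH (loss w) + K%:R * s.
  rewrite -(ex_sum _ _ ij).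
  (* Uses [x <= s / 2 + x ^ 2 / (2 * s)] for [x = num_weak h - K * p]; the choice [s = sqrt K]
     balances the constant against the variance. *)
  pose rhs h := (K%:R * p) * loss w h + (K%:R / 2 * s) + (K%:R / 2 / s) * (num_weak h - K%:R * p) ^+ 2.
  have i1 := intbleD (intbleZ (K%:R * p) il) (intble_cst gamH (K%:R / 2 * s)).
  have i2 := intbleZ (K%:R / 2 / s) iV.
  apply: (@le_trans _ _ (ex gamH rhs)).
    apply: (ex_le (intble_sum _ _ ij) (intbleD i1 i2)) => h.
    rewrite -mulr_suml -/(num_weak h); have /andP[l0 l1] := lK h.
    rewrite -lerBlDl -(ler_pM2r s0) [leRHS]mulrAC divfK ?gt_eqF//.
    move: l0 l1 s0; move: (loss w h) (num_weak h) (K%:R : R) (K%:R * p) => l N k q l0 l1 s0'.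
    rewrite [leLHS](_ : _ = l * (s * (N - q)) - k / 2 * s ^+ 2); last by ring.
    have k0 : 0 <= k by exact: le_trans l1.
    have t1 : s * (N - q) <= (s ^+ 2 + (N - q) ^+ 2) / 2.
      by have := sqr_ge0 (s - (N - q)); nra.
    have t2 : 0 <= (s ^+ 2 + (N - q) ^+ 2) / 2 by rewrite divr_ge0// addr_ge0 ?sqr_ge0.
    move: t1 t2; set X := s * _; set Y := (_ + _) / 2 => t1 t2.
    have YE : k * Y = k / 2 * s ^+ 2 + k / 2 * (N - q) ^+ 2 by rewrite /Y; field.
    suff : l * X <= k * Y by rewrite YE lerBlDl.
    apply: (@le_trans _ _ (l * Y)); first by rewrite ler_wpM2l.
    by rewrite ler_wpM2r.
  rewrite (exD i1 i2) (exD (intbleZ _ il) (intble_cst gamH _)) !(exZ _ il) (exZ _ iV) ex_cst -addrA lerD2l.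
  have -> : K%:R * s = K%:R / 2 * s + K%:R / 2 / s * K%:R.
    by rewrite -s2; field; rewrite gt_eqF.
  by rewrite lerD2l ler_wpM2l// !divr_ge0// ltW.
rewrite mulr_sumr; apply: le_trans (ler_sum _ (fun j _ => deleted_loss_le j w)) _.
rewrite big_split/= sumr_const card_ord -[X in _ + X]mulr_natl.
apply: le_trans (lerD step1 (lexx _)) _.
move: (p : R) tv (ex gamH _) (K%:R : R) => q t l k.
by rewrite le_eqVlt; apply/orP; left; apply/eqP; ring.
Qed.

End removing_a_user.

(** [ex_hit_le] is summed over users and messages. Deleted hits are bounded through deleted losses,
    and these through [det_loss], which therefore occurs on both sides. *)
Lemma test_converse (delta dd tau p tv : R) (d : C -> R) :
  (0 < K)%N -> 0 < delta -> 0 <= dd -> 2 * P0 * delta <= dd ^+ 2 ->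
  p = 1 - expR (- delta) -> tv = Qfun (- (dd / 2)) - Qfun (dd / 2) ->
  (forall x, 0 <= d x) -> measurable_fun setT d -> (forall x, 2 * P0 * sqc x <= d x ^+ 2) ->
  K%:R - det_loss <=
  ex gam (test_level tau d) *
    (K%:R * (det_loss + Num.sqrt K%:R / p + K%:R * tv + 1) / (M - K.-1)%:R - K%:R * Qfun tau)
  + K%:R * ex gam (fun x => Qfun (tau - d x)).
Proof.
move=> K0 delta0 dd0 ddE pE tvE d0 md dE.
set lamb := ex gam (test_level tau d); set qbar := ex gam (fun x => Qfun _).
have lamb0 : 0 <= lamb by apply: ex_ge0 => x; exact: expR_ge0.
have J0 := num_inj_gt0 cD; set J := @num_inj R K M in J0.
have sumc (x : R) : \sum_(w : msgs | injectiveb w) x = J * x.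
  by rewrite /J /num_inj mulr_suml; apply: eq_bigr => w _; rewrite mul1r.
have sumK (x : R) : \sum_(j < K) x = K%:R * x by rewrite sumr_const card_ord mulr_natl.
have KM := K_le_M cD.
have MK : (0 < M - K.-1)%N by rewrite subn_gt0 (leq_trans _ KM)// prednK.
have MKp : 0 < (M - K.-1)%:R :> R by rewrite ltr0n.
have p0 : 0 < p by rewrite pE; exact: weak_prob_gt0.
pose DH := \sum_(j < K) \sum_(w : msgs | injectiveb w) deleted_hit j w.
have il w := intble_loss f mD w.
have lossE : \sum_(w : msgs | injectiveb w) ex gamH (loss w) = J * det_loss.
  by rewrite /det_loss mulrA divff ?gt_eqF// mul1r.
have ih (j : 'I_K) w : intble gamH (hit j w).
  exact: (intble01 _ (measurable_hit j w) (fun h => hit01 _ _ _)).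
have h1 : J * (K%:R - det_loss) <= lamb * (DH - J * (K%:R * Qfun tau)) + J * (K%:R * qbar).
  have -> : J * (K%:R - det_loss) =
      \sum_(w : msgs | injectiveb w) \sum_(j < K) ex gamH (hit j w).
    rewrite mulrBr -lossE -sumc -sumrB; apply: eq_bigr => w _.
    rewrite -(ex_sum _ _ (fun j => ih j w)) -(ex_cst gamH K%:R) -(exB (intble_cst gamH K%:R) (il w)).
    by congr ex; apply/funext => h; rewrite sum_hit.
  apply: (@le_trans _ _ (\sum_(w : msgs | injectiveb w) \sum_(j < K)
      (lamb * (deleted_hit j w - Qfun tau) + qbar))).
    apply: ler_sum => w _; apply: ler_sum => j _.
    exact: (ex_hit_le tau d0 md dE).
  rewrite le_eqVlt; apply/orP; left; apply/eqP.
  transitivity (\sum_(w : msgs | injectiveb w)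
      (lamb * \sum_(j < K) deleted_hit j w + (K%:R * (qbar - lamb * Qfun tau)))).
    apply: eq_bigr => w _; rewrite mulr_sumr -sumK -big_split/=.
    by apply: eq_bigr => j _; ring.
  by rewrite big_split/= sumc -mulr_sumr exchange_big/= -/DH; ring.
have h2 : (M - K.-1)%:R * DH <= J * (K%:R * (det_loss + Num.sqrt K%:R / p + K%:R * tv + 1)).
  rewrite /DH mulr_sumr; apply: le_trans (ler_sum _ (fun j _ => sum_deleted_hit j)) _.
  rewrite exchange_big/=.
  apply: (@le_trans _ _ (\sum_(w : msgs | injectiveb w)
      (K%:R * ex gamH (loss w) + K%:R * (Num.sqrt K%:R / p + K%:R * tv + 1)))).
    apply: ler_sum => w _; rewrite big_split/= sumK mulr1.
    have := sum_deleted_loss_le delta0 dd0 ddE w; rewrite -pE -tvE.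
    set S := \sum_(j < K) _; set E := ex _ _ => hS.
    rewrite -(ler_pM2l p0); apply: (@le_trans _ _ (p * S + p * K%:R)); first by rewrite mulrDr.
    apply: le_trans (lerD hS (lexx _)) _.
    by rewrite le_eqVlt; apply/orP; left; apply/eqP; field; rewrite gt_eqF.
  rewrite big_split/= sumc -mulr_sumr lossE.
  by rewrite le_eqVlt; apply/orP; left; apply/eqP; ring.
rewrite -(ler_pM2l J0); apply: le_trans h1 _.
rewrite [leRHS]mulrDr; apply: lerD => //; rewrite [leRHS]mulrCA; apply: ler_wpM2l => //.
by rewrite [leRHS]mulrBr; apply: lerB => //; rewrite mulrA ler_pdivlMr// mulrC.
Qed.

End deleted_user.

(** * Averaging over the seeds *)

Section expectation_fubini.
Context d1 d2 (T1 : measurableType d1) (T2 : measurableType d2) (R : realType).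
Variables (P1 : probability T1 R) (P2 : probability T2 R).
Variables (f : T1 * T2 -> R) (B : R).
Hypothesis mf : measurable_fun setT f.
Hypothesis fB : forall x, `|f x| <= B.

Let fi : intble (P1 \x P2)%E f := intble_bounded _ mf fB.

Lemma ex_prod1 : ex (P1 \x P2)%E f = ex P1 (fun x => ex P2 (fun y => f (x, y))).
Proof.
have mf1 x : measurable_fun setT (fun y => f (x, y)).
  exact: (measurableT_comp mf (pair1_measurable x)).
apply: esym; apply: ex_eq.
under eq_integral do rewrite -(exE (intble_bounded _ (mf1 _) (fun y => fB _))).
by rewrite -(exE fi); exact: (integral12_prod_meas1 fi).
Qed.

Lemma ex_prod2 : ex (P1 \x P2)%E f = ex P2 (fun y => ex P1 (fun x => f (x, y))).
Proof. by rewrite ex_prod1; exact: (ex_fubini _ _ mf fB). Qed.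

Lemma ex_prod_ge1 L : (forall x, L <= ex P2 (fun y => f (x, y))) -> L <= ex (P1 \x P2)%E f.
Proof.
move=> fL; rewrite ex_prod1 -(ex_cst P1 L).
have mF := measurable_ex P1 P2 mf fB.
apply: (ex_le (intble_cst P1 L) _ fL).
apply: (intble_bounded _ mF (M := B)) => x.
exact: (ex_norm_le _ (measurableT_comp mf (pair1_measurable x)) (fun y => fB _)).
Qed.

Lemma ex_prod_ge2 L : (forall y, L <= ex P1 (fun x => f (x, y))) -> L <= ex (P1 \x P2)%E f.
Proof.
move=> fL; rewrite ex_prod2 -(ex_cst P2 L).
have mg : measurable_fun setT (fun q : T2 * T1 => f (q.2, q.1)).
  exact: (measurableT_comp mf (@measurable_swap _ _ _ _)).
have mF := measurable_ex P2 P1 mg (fun q => fB _).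
apply: (ex_le (intble_cst P2 L) _ fL).
apply: (intble_bounded _ mF (M := B)) => y.
exact: (ex_norm_le _ (measurableT_comp mf (pair2_measurable y)) (fun x => fB _)).
Qed.

End expectation_fubini.

Lemma ex_indic d (T : measurableType d) (R : realType) (P : probability T R) (A : set T) :
  measurable A -> ex P \1_A = fine (P A).
Proof.
move=> mA; apply: ex_eq.
rewrite (integral_indic P measurableT mA) setIT fineK//.
exact: (fin_num_measure P A mA).
Qed.

Section derandomization.
Context {R : realType} {n M K : nat}.
Local Notation msgs := {ffun 'I_K -> 'I_M}.
Local Notation C := R[i].
Implicit Types (w : msgs).
Variable c : @ra_code R n M K.
Local Notation PU := (iid_prob (Penc c) K).
Local Notation PH := (iid_prob (@cnormal_prob R) K).
Local Notation PZ := (iid_prob (@cnormal_prob R) n).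
Local Notation PV := (Pdec c).
Local Notation obs := (K.-tuple (Tenc c) * K.-tuple C * n.-tuple C * Tdec c)%type.

Definition fixed_enc (u : K.-tuple (Tenc c)) (i : 'I_K) (m : 'I_M) : n.-tuple C :=
  enc c m (tnth u i).

Definition fixed_dec (v : Tdec c) (y : n.-tuple C) : {set 'I_M} := dec c y v.

Lemma measurable_fixed_dec v (A : {set 'I_M}) : measurable [set y | fixed_dec v y = A].
Proof.
rewrite -[X in measurable X]setTI.
exact: (pair2_measurable v measurableT (@measurable_dec _ _ _ _ c A)).
Qed.

Definition obs_output w (o : obs) : n.-tuple C :=
  out (fixed_enc o.1.1.1) w o.1.1.2 o.1.2.

Lemma measurable_obs_output w : measurable_fun setT (obs_output w).
Proof.
have m11 : measurable_fun setT (fun o : obs => o.1.1).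
  exact: (measurableT_comp measurable_fst measurable_fst).
have mu : measurable_fun setT (fun o : obs => o.1.1.1).
  exact: (measurableT_comp measurable_fst m11).
have mh : measurable_fun setT (fun o : obs => o.1.1.2).
  exact: (measurableT_comp measurable_snd m11).
have mz : measurable_fun setT (fun o : obs => o.1.2).
  exact: (measurableT_comp measurable_snd measurable_fst).
apply/measurable_fun_tnthP => t.
rewrite (_ : _ \o _ = fun o : obs =>
    \sum_(i < K) tnth o.1.1.2 i * tnth (enc c (w i) (tnth o.1.1.1 i)) t + tnth o.1.2 t); last first.
  by apply/funext => o /=; rewrite tnth_mktuple.
apply: measurable_complexD; last exact: (measurableT_comp (measurable_tnth t) mz).
apply: measurable_complex_sum => i; apply: measurable_complexM.
  exact: (measurableT_comp (measurable_tnth i) mh).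
apply: (measurableT_comp (measurable_tnth t)).
apply: (measurableT_comp (@measurable_enc _ _ _ _ c (w i))).
exact: (measurableT_comp (measurable_tnth i) mu).
Qed.

Definition obs_list w (o : obs) : {set 'I_M} := fixed_dec o.2 (obs_output w o).

Lemma measurable_obs_list w (F : {set 'I_M} -> R) : measurable_fun setT (fun o => F (obs_list w o)).
Proof.
have mp : measurable_fun setT (fun o : obs => (obs_output w o, o.2)).
  exact: (measurable_fun_pair (measurable_obs_output w) measurable_snd).
apply: (measurableT_comp (f := fun q : n.-tuple C * Tdec c => F (dec c q.1 q.2)) _ mp).
exact: (measurable_fin_valued F (@measurable_dec _ _ _ _ c)).
Qed.

Lemma missed_prob w j :
  fine (ra_law c (missed c w j)) = ex (ra_law c) (fun o => (w j \notin obs_list w o)%:R).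
Proof.
have e : missed c w j = [set o | w j \notin obs_list w o] by apply/seteqP; split=> -[[[u h] z] v].
have mA : measurable (missed c w j).
  have := measurable_obs_list w (fun T => (w j \notin T)%:R) measurableT (measurable_set1 1).
  rewrite setTI; congr measurable; rewrite e; apply/seteqP; split => o /=.
    by case: (_ \notin _) => // /eqP; rewrite eq_sym oner_eq0.
  by move=> ->.
rewrite -(ex_indic (ra_law c) mA) e; congr ex; apply/funext => o; rewrite indicE.
congr (_%:R); congr nat_of_bool; apply/idP/idP; rewrite inE//.
Qed.

Definition obs_loss (o : obs) : R :=
  (@num_inj R K M)^-1 * \sum_(w : msgs | injectiveb w) num_missed (obs_list w o) w.

Lemma measurable_obs_loss : measurable_fun setT obs_loss.
Proof.
rewrite /obs_loss; under eq_fun do rewrite big_mkcond/=.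
apply: measurable_funM => //; apply: measurable_sum => w; case: (injectiveb w) => //.
exact: (measurable_obs_list w (fun T => num_missed T w)).
Qed.

Lemma obs_loss_norm o : `|obs_loss o| <= K%:R.
Proof.
have s0 : 0 <= \sum_(w : msgs | injectiveb w) num_missed (obs_list w o) w :> R.
  by apply: sumr_ge0 => w _; exact: num_missed_ge0.
have J0 : 0 <= @num_inj R K M by rewrite num_inj_card.
rewrite ger0_norm ?mulr_ge0 ?invr_ge0//.
have [J1|J1] := eqVneq (@num_inj R K M) 0.
  by rewrite /obs_loss J1 invr0 mul0r.
rewrite /obs_loss mulrC ler_pdivrMr ?lt_def ?J1//.
rewrite /num_inj mulr_sumr; apply: ler_sum => w _.
by rewrite mulr1 num_missed_le.
Qed.

Lemma per_user_error_loss : (0 < K)%N -> K%:R * per_user_error c = ex (ra_law c) obs_loss.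
Proof.
move=> K0; rewrite /per_user_error mulrA divff ?pnatr_eq0 -?lt0n// mul1r.
have i1 w j : intble (ra_law c) (fun o => (w j \notin obs_list w o)%:R : R).
  exact: (intble01 _ (measurable_obs_list w (fun T => (w j \notin T)%:R)) (fun o => bool01 _)).
have i2 w : intble (ra_law c) (fun o => num_missed (obs_list w o) w : R).
  by apply: intble_sum => j; exact: i1.
rewrite /obs_loss (exZ _ (intble_sum _ _ i2)) (ex_sum _ _ i2) num_inj_card.
rewrite /miss_prob -mulr_suml mulrC; congr (_ * _).
rewrite exchange_big/=; apply: eq_bigr => w _.
by rewrite (ex_sum _ _ (i1 w)); apply: eq_bigr => j _; exact: missed_prob.
Qed.

(** Integrating fading and noise with the seeds frozen gives [det_loss]; a lower bound valid for all
    seeds is inherited by the average. *)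
Lemma derandomize (L : R) : (0 < K)%N ->
  (forall u v, L <= det_loss (fixed_enc u) (fixed_dec v)) -> L <= K%:R * per_user_error c.
Proof.
move=> K0 hL; rewrite (per_user_error_loss K0).
apply: (ex_prod_ge2 _ measurable_obs_loss obs_loss_norm) => v.
have mv : measurable_fun setT (fun q : K.-tuple (Tenc c) * K.-tuple C * n.-tuple C => obs_loss (q, v)).
  exact: (measurableT_comp measurable_obs_loss (pair2_measurable v)).
rewrite (ex_prod1 (PU \x PH)%E PZ mv (fun q => obs_loss_norm _)).
have mq := measurable_ex (PU \x PH)%E PZ mv (fun q => obs_loss_norm _).
have nq q : `|ex PZ (fun z => obs_loss (q, z, v))| <= K%:R.
  exact: (ex_norm_le _ (measurableT_comp mv (pair1_measurable q)) (fun z => obs_loss_norm _)).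
apply: (ex_prod_ge1 _ mq nq) => u.
apply: le_trans (hL u v) _; rewrite le_eqVlt; apply/orP; left; apply/eqP.
rewrite /det_loss.
have mD := measurable_fixed_dec v.
rewrite -(ex_sum _ _ (intble_loss (fixed_enc u) mD)).
rewrite -(exZ _ (intble_sum _ _ (intble_loss (fixed_enc u) mD))).
congr ex; apply/funext => h.
rewrite /loss -(ex_sum _ _ (fun w => intble_missed_z (fixed_enc u) mD w h)).
by rewrite -(exZ _ (intble_sum _ _ (fun w => intble_missed_z (fixed_enc u) mD w h))).
Qed.

End derandomization.

(** * Rates and limits *)

Section code_bounds.
Context {R : realType} {n M K : nat}.
Local Notation C := R[i].
Variables (c : @ra_code R n M K) (P0 eps x y : R).
Hypothesis K_gt0 : (0 < K)%N.
Hypothesis pow : forall m u, sqnorm (enc c m u) <= P0.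
Hypothesis perr : per_user_error c <= eps.
Hypothesis xE : x = M%:R / K%:R.
Hypothesis yE : y = K%:R^-1.

Let Kp : 0 < K%:R :> R. Proof. by rewrite ltr0n. Qed.

Let fpow u i m : sqnorm (fixed_enc (c := c) u i m) <= P0.
Proof. exact: pow. Qed.

Let fcard v z : #|fixed_dec (c := c) v z| = K.
Proof. exact: (@card_dec _ _ _ _ c). Qed.

Let derandomized (L : R) :
  (forall u v, L <= det_loss (fixed_enc (c := c) u) (fixed_dec (c := c) v)) -> L <= K%:R * eps.
Proof.
by move=> hL; apply: le_trans (derandomize K_gt0 hL) _; rewrite ler_wpM2l// ltW.
Qed.

Lemma fano_code (theta cc r : R) : (0 < n)%N -> (1 < M - K)%N -> 0 <= P0 ->
  0 <= theta <= 1 -> 1 <= cc -> r = K%:R / n%:R ->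
  theta * ln x + ln (cc / (cc + x - 1)) - eps * ln cc <=
  r^-1 * ln (1 + (x - 1) / (x - 1 - y) * P0 * r * alpha (1 - theta) 1).
Proof.
move=> n0 MK P00 th cc1 rE.
have np : 0 < n%:R :> R by rewrite ltr0n.
have KM : (K <= M)%N by rewrite ltnW// -subn_gt0 (leq_trans _ MK).
have [b [mb eb ib ea]] := exists_selector th.
set a := alpha (1 - theta) 1 in ea *.
have a0 : 0 <= a by rewrite -ea; apply: ex_ge0 => z; rewrite mulr_ge0 ?sqc_ge0.
have MKE : (M - K)%:R = K%:R * (x - 1) :> R.
  by rewrite natrB// xE; field; rewrite gt_eqF.
have MK1E : ((M - K).-1)%:R = K%:R * (x - 1 - y) :> R.
  rewrite -subn1 natrB ?MKE; last exact: ltnW.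
  by rewrite yE; field; rewrite gt_eqF.
have MK1p : 0 < ((M - K).-1)%:R :> R by rewrite ltr0n -subn1 subn_gt0.
have xy0 : 0 < x - 1 - y by rewrite -(ltr_pM2l Kp) mulr0 -MK1E.
pose v := (M - K)%:R / ((M - K).-1)%:R * P0 * (K%:R * a) / n%:R.
have v0 : 0 <= v by rewrite !(mulr_ge0, invr_ge0)// ltW.
have v1 : 0 < 1 + v by rewrite ltr_pwDl.
(* [1 + v] bounds the mean power per channel use around the conditional mean, noise included. As a
   reference variance it minimizes [ln (sg ^+ 2) + (1 + v) / sg ^+ 2] and reduces the right side to
   [n * ln (1 + v)]. *)
pose sg := Num.sqrt (1 + v).
have sg0 : 0 < sg by rewrite sqrtr_gt0.
have sg2 : sg ^+ 2 = 1 + v by rewrite sqr_sqrtr// ltW.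
have lnsg : 2 * ln sg = ln (1 + v) by rewrite -sg2 lnXn// mulr_natl.
have xE' : (x - 1) / (x - 1 - y) * P0 * r * a = v.
  rewrite /v MKE MK1E rE; field.
  by rewrite (gt_eqF Kp) (gt_eqF np) (gt_eqF xy0).
rewrite xE'.
set A := cc / (cc + x - 1).
pose L0 := K%:R * theta * ln x + K%:R * ln A.
have base u w : L0 - ln cc * det_loss (fixed_enc (c := c) u) (fixed_dec (c := c) w) <= n%:R * ln (1 + v).
  have := fano_converse (measurable_fixed_dec w) (fcard w) (fpow u) mb eb ib ea sg0 cc1 K_gt0 MK xE erefl P00.
  rewrite -/A => /le_trans; apply; rewrite lnsg sg2 le_eqVlt; apply/orP; left; apply/eqP.
  have -> : (M - K)%:R / ((M - K).-1)%:R * P0 / (1 + v) * (K%:R * a) = v * n%:R / (1 + v).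
    by rewrite [LHS]mulrAC; congr (_ / _); rewrite /v divfK// gt_eqF.
  by field; rewrite gt_eqF.
have lcc : 0 <= ln cc by rewrite ln_ge0.
have key : L0 - ln cc * (K%:R * eps) <= n%:R * ln (1 + v).
  (* For [cc = 1] the loss drops out and cannot be solved for; the inequality at any one pair of
     seeds is then the claim. *)
  have [l0|l0] := eqVneq (ln cc) 0.
    by have := base point point; rewrite l0 !mul0r.
  have lp : 0 < ln cc by rewrite lt_def l0.
  have : (L0 - n%:R * ln (1 + v)) / ln cc <= K%:R * eps.
    apply: derandomized => u w; rewrite ler_pdivrMr//.
    by rewrite lerBlDr [_ * ln cc]mulrC -lerBlDl.
  by rewrite ler_pdivrMr// lerBlDr [_ * ln cc]mulrC -lerBlDl.
have -> : r^-1 * ln (1 + v) = n%:R * ln (1 + v) / K%:R.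
  by rewrite rE invf_div mulrAC.
rewrite ler_pdivlMr//; apply: le_trans key; rewrite le_eqVlt; apply/orP; left; apply/eqP.
by rewrite /L0; ring.
Qed.

Lemma test_code (tau t p : R) : 0 < P0 -> 0 < t -> p = 1 - expR (- (t ^+ 2 / (2 * P0))) ->
  (K <= M)%N ->
  1 - eps <=
  ex cnormal_prob (test_level tau (fun z : C => Num.sqrt (2 * P0 * sqc z))) *
    ((x - 1 + y)^-1 * (eps + Num.sqrt y / p + normal_peak 1 * t + y) - Qfun tau)
  + ex cnormal_prob (fun z : C => Qfun (tau - Num.sqrt (2 * P0 * sqc z))).
Proof.
move=> P00 t0 pE KM.
set d := fun z : C => Num.sqrt (2 * P0 * sqc z).
set lamb := ex _ (test_level _ _); set qbar := ex _ (fun z => Qfun _).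
have lamb0 : 0 <= lamb by apply: ex_ge0 => z; exact: expR_ge0.
have P2 : 0 < 2 * P0 by rewrite mulr_gt0.
(* The fade threshold for which a weak signal shifts the noise by at most [t] in the scalar test, so
   that [dd = t]. *)
pose delta := t ^+ 2 / (2 * P0).
have delta0 : 0 < delta by rewrite divr_gt0// exprn_gt0.
have tE : 2 * P0 * delta <= t ^+ 2 by rewrite mulrC divfK// gt_eqF.
have d0 z : 0 <= d z by exact: sqrtr_ge0.
have md : measurable_fun setT d.
  apply: (measurableT_comp (continuous_measurable_fun (@sqrt_continuous R))).
  by apply: measurable_funM => //; exact: measurable_sqc.
have dE z : 2 * P0 * sqc z <= d z ^+ 2 by rewrite sqr_sqrtr// mulr_ge0 ?sqc_ge0// ltW.
set tv := Qfun (- (t / 2)) - Qfun (t / 2).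
have tvle : tv <= normal_peak 1 * t.
  have h : - (t / 2) <= t / 2 by rewrite -subr_ge0 opprK addr_ge0// ltW// divr_gt0.
  by apply: le_trans (Qfun_lipschitz h) _; rewrite opprK -mulrDl -mulr2n -[t *+ 2]mulr_natr mulfK.
set m : R := (M - K.-1)%:R.
have mE : m = K%:R * (x - 1 + y).
  rewrite /m natrB; last by rewrite (leq_trans (leq_pred _)).
  rewrite -subn1 natrB// xE yE; field; by rewrite gt_eqF.
have mp : 0 < m by rewrite ltr0n subn_gt0 (leq_trans _ KM)// prednK.
have xyp : 0 < x - 1 + y by rewrite -(ltr_pM2l Kp) mulr0 -mE.
have dlp : 0 < 1 + lamb * K%:R / m by rewrite ltr_pwDl// divr_ge0 ?mulr_ge0// ltW.
have tc u v := test_converse (measurable_fixed_dec v) (fcard v) (fpow u) (ltW P00) tau K_gt0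
  delta0 (ltW t0) tE pE erefl d0 md dE.
set Z := Num.sqrt K%:R / p + K%:R * tv + 1.
(* The loss occurs on both sides of [test_converse]; since its coefficients are constant in the
   seeds, the inequality is solved for it before averaging. *)
pose L := (K%:R - K%:R * qbar + lamb * (K%:R * Qfun tau) - lamb * (K%:R * Z / m)) / (1 + lamb * K%:R / m).
have trade e : (L <= e) = (K%:R - e <= lamb * (K%:R * (e + Z) / m - K%:R * Qfun tau) + K%:R * qbar).
  rewrite ler_pdivrMr// -subr_ge0 -[RHS]subr_ge0; congr (0 <= _).
  by field; rewrite gt_eqF.
have : L <= K%:R * eps.
  apply: derandomized => u v; rewrite trade; have := tc u v.
  by rewrite /Z !addrA.
rewrite trade -(ler_pM2l (_ : 0 < K%:R^-1)) ?invr_gt0// => h.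
apply: (@le_trans _ _ (lamb * ((x - 1 + y)^-1 * (eps + Z / K%:R) - Qfun tau) + qbar)).
  apply: (@le_trans _ _ (K%:R^-1 * (K%:R - K%:R * eps))).
    by rewrite mulrBr mulVf ?mulKf ?gt_eqF.
  apply: le_trans h _; rewrite le_eqVlt; apply/orP; left; apply/eqP.
  by rewrite mE; field; rewrite !gt_eqF.
rewrite lerD2r ler_wpM2l// lerD2r ler_wpM2l ?invr_ge0 ?(ltW xyp)// -!addrA lerD2l.
have -> : Z / K%:R = Num.sqrt y / p + (tv + y).
  have sK : Num.sqrt K%:R / K%:R = Num.sqrt y :> R.
    rewrite yE sqrtrV ?ler0n// -[X in _ / X](sqr_sqrtr (ltW Kp)).
    by field; rewrite gt_eqF// sqrtr_gt0.
  by rewrite -sK /Z yE !mulrDl -addrA; congr (_ + (_ + _)); [rewrite mulrAC|rewrite mulrC mulKf// gt_eqF|rewrite mul1r].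
by rewrite lerD2l lerD2r.
Qed.

End code_bounds.

(** * Asymptotics of the rounded numbers of users and messages *)

Section growth.
Context {R : realType} (mu M1 : R).
Hypothesis mu_gt0 : 0 < mu.
Hypothesis M1_gt2 : 2 < M1.
Local Notation K := (num_users mu).
Local Notation M := (codebook_size mu M1).

Definition user_density n : R := (K n)%:R / n%:R.
Definition user_inv n : R := (K n)%:R^-1.
Definition book_ratio n : R := (M n)%:R / (K n)%:R.

Lemma num_users_itv n : (K n)%:R <= mu * n%:R < (K n)%:R + 1.
Proof. by rewrite natr1; apply: truncn_itv; rewrite mulr_ge0// ltW. Qed.

Lemma codebook_size_itv n : (M n)%:R <= (K n)%:R * M1 < (M n)%:R + 1.
Proof.
rewrite natr1; apply: truncn_itv; apply: mulr_ge0; first exact: ler0n.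
by apply: ltW; exact: lt_trans M1_gt2.
Qed.

Lemma cvg_inv_nat : (n%:R^-1 : R) @[n --> \oo] --> (0 : R).
Proof.
apply/(@gtr0_cvgV0 _ _ _ _ (fun n => n%:R : R)); last exact: cvgr_idn.
by near=> n; rewrite ltr0n; near: n; exact: nbhs_infty_gt.
Unshelve. all: end_near. Qed.

Lemma cvg_user_density : user_density n @[n --> \oo] --> mu.
Proof.
apply: (squeeze_cvgr (f := fun n => mu - n%:R^-1) (h := fun=> mu)); last exact: cvg_cst.
  near=> n; have n0 : 0 < n%:R :> R by rewrite ltr0n; near: n; exact: nbhs_infty_gt.
  have /andP[h1 h2] := num_users_itv n.
  rewrite /user_density ler_pdivrMr// h1 andbT ler_pdivlMr// mulrBl mulVf ?gt_eqF//.
  by rewrite lerBlDr ltW.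
by rewrite -[X in _ --> X]subr0; apply: cvgB; [exact: cvg_cst|exact: cvg_inv_nat].
Unshelve. all: end_near. Qed.

Lemma cvg_user_inv : user_inv n @[n --> \oo] --> (0 : R).
Proof.
have h : (user_density n)^-1 * n%:R^-1 @[n --> \oo] --> mu^-1 * 0.
  by apply: cvgM; [apply: cvgV; [rewrite gt_eqF|exact: cvg_user_density]|exact: cvg_inv_nat].
rewrite mulr0 in h; apply: cvg_trans h; apply: near_eq_cvg.
near=> n; have n0 : 0 < n%:R :> R by rewrite ltr0n; near: n; exact: nbhs_infty_gt.
by rewrite /user_density /user_inv invf_div mulrAC divff ?mul1r// gt_eqF.
Unshelve. all: end_near. Qed.

Lemma near_num_users : \forall n \near \oo, (0 < K n)%N.
Proof.
near=> n.
have : 0 < user_density n.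
  by near: n; apply: (cvgr_gt mu) => //; exact: cvg_user_density.
rewrite /user_density -(ltr0n R); apply: contraTT; rewrite -!leNgt => h.
by rewrite mulr_le0_ge0.
Unshelve. all: end_near. Qed.

Lemma book_ratio_itv n : (0 < K n)%N -> M1 - user_inv n <= book_ratio n <= M1.
Proof.
rewrite -(ltr0n R) => K0; have /andP[h1 h2] := codebook_size_itv n.
rewrite /book_ratio /user_inv ler_pdivrMr// [M1 * _]mulrC h1 andbT.
by rewrite ler_pdivlMr// mulrBl mulVf ?gt_eqF// lerBlDr ltW// mulrC.
Qed.

Lemma cvg_book_ratio : book_ratio n @[n --> \oo] --> M1.
Proof.
apply: (squeeze_cvgr (f := fun n => M1 - user_inv n) (h := fun=> M1)); last exact: cvg_cst.
  near=> n; apply: book_ratio_itv; near: n; exact: near_num_users.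
by rewrite -[X in _ --> X]subr0; apply: cvgB; [exact: cvg_cst|exact: cvg_user_inv].
Unshelve. all: end_near. Qed.

Lemma near_book_ratio : \forall n \near \oo, 2 < book_ratio n.
Proof. by apply: (cvgr_gt M1) => //; exact: cvg_book_ratio. Qed.

(** A ratio above 2 gives [K < M - K], and [K] itself eventually exceeds 1. This is where [M1 > 2]
    leaves room for the factor [N / (N - 1)]. *)
Lemma near_spare_messages : \forall n \near \oo, (1 < M n - K n)%N.
Proof.
near=> n.
have K0 : (0 < K n)%N by near: n; exact: near_num_users.
have Kp : 0 < (K n)%:R :> R by rewrite ltr0n.
have y1 : user_inv n < 1 by near: n; apply: (cvgr_lt 0) => //; exact: cvg_user_inv.
have x2 : 2 < book_ratio n by near: n; exact: near_book_ratio.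
have K1 : (1 < K n)%N by move: y1; rewrite /user_inv invf_lt1// ltr1n.
move: x2; rewrite /book_ratio ltr_pdivlMr// mulr_natl -mulrnA ltr_nat => h.
rewrite ltn_subRL addn1; apply: leq_ltn_trans h.
by rewrite muln2 -addnn -addn1 leq_add2l.
Unshelve. all: end_near. Qed.

End growth.

Section eventual_codes.
Context {R : realType} (mu M1 eps e : R).
Hypothesis mu_gt0 : 0 < mu.
Hypothesis M1_gt2 : 2 < M1.
Hypothesis eps_gt0 : 0 < eps.
Hypothesis eps_le : eps <= 1 - M1^-1.
Local Notation K := (num_users mu).
Local Notation M := (codebook_size mu M1).
Local Notation x_ := (book_ratio mu M1).
Local Notation y_ := (user_inv mu).
Local Notation r_ := (user_density mu).

Definition code_below n := exists E (c : @ra_code R n (M n) (K n)), E < e /\ is_code eps E c.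

Hypothesis codes : \forall n \near \oo, code_below n.

Let M1_gt0 : 0 < M1. Proof. exact: lt_trans M1_gt2. Qed.

Let M1_gt1 : 1 < M1. Proof. by apply: lt_trans M1_gt2; rewrite ltr1n. Qed.

Let M1B_gt0 : 0 < M1 - 1. Proof. by rewrite subr_gt0. Qed.

Let gt2_gt1 (z : R) : 2 < z -> 1 < z. Proof. by apply: lt_trans; rewrite ltr1n. Qed.

Let log2M1_gt0 : 0 < log2 M1. Proof. by rewrite /log2 divr_gt0// ln_gt0// ltr1n. Qed.

Let ln2_gt0 : 0 < ln (2 : R). Proof. by rewrite ln_gt0// ltr1n. Qed.

Let cx : x_ n @[n --> \oo] --> M1. Proof. exact: cvg_book_ratio. Qed.
Let cy : y_ n @[n --> \oo] --> (0 : R). Proof. exact: cvg_user_inv. Qed.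
Let cr : r_ n @[n --> \oo] --> mu. Proof. exact: cvg_user_density. Qed.

(** A codeword has nonnegative norm and the rate is eventually positive, so every admissible [E] is
    nonnegative. This also keeps [Estar] away from [-oo]. *)
Lemma energy_gt0 : 0 < e.
Proof.
near \oo => n.
have [E [c [Ee [_ pow]]]] : code_below n by near: n; exact: codes.
have MK : (1 < M n - K n)%N by near: n; exact: near_spare_messages.
have x2 : 2 < x_ n by near: n; exact: near_book_ratio.
have M0 : (0 < M n)%N by rewrite (leq_trans _ (leq_subr (K n) _))// ltnW.
have lx : 0 < log2 (x_ n) by rewrite /log2 divr_gt0// ln_gt0// gt2_gt1.
have := le_trans (sqnorm_ge0 _) (pow (Ordinal M0) point).
rewrite -/(x_ n) pmulr_lge0// => E0; exact: le_lt_trans Ee.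
Unshelve. all: end_near. Qed.

Definition good_code n := exists c : @ra_code R n (M n) (K n),
  [/\ per_user_error c <= eps, forall m u, sqnorm (enc c m u) <= e * log2 (x_ n),
     (1 < M n - K n)%N /\ (0 < K n)%N, (0 < n)%N & 2 < x_ n <= M1].

Lemma near_code : \forall n \near \oo, good_code n.
Proof.
near=> n.
have [E [c [Ee [perr pow]]]] : code_below n by near: n; exact: codes.
have x2 : 2 < x_ n by near: n; exact: near_book_ratio.
have K0 : (0 < K n)%N by near: n; exact: near_num_users.
have lx : 0 <= log2 (x_ n) by rewrite /log2 divr_ge0 ?(ltW ln2_gt0)// ln_ge0// ltW// gt2_gt1.
exists c; split => //.
- by move=> m u; apply: le_trans (pow m u) _; rewrite ler_wpM2r// ltW.
- by split=> //; near: n; exact: near_spare_messages.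
- by near: n; exact: nbhs_infty_gt.
- by rewrite x2; case/andP: (book_ratio_itv M1_gt2 K0).
Unshelve. all: end_near. Qed.

Let cln : ln (x_ n) @[n --> \oo] --> ln M1.
Proof. exact: (cvg_comp _ _ cx (continuous_ln M1_gt0)). Qed.

(** In the limit of [fano_code] the correction for sampling without replacement tends to 1, since
    [y_ n], the inverse of the number of users, vanishes. *)
Lemma fano_limit (theta cc : R) : 0 <= theta <= 1 -> 1 <= cc ->
  theta * ln M1 + ln (cc / (cc + M1 - 1)) - eps * ln cc <=
  mu^-1 * ln (1 + e * log2 M1 * mu * alpha (1 - theta) 1).
Proof.
move=> th cc1.
set a := alpha (1 - theta) 1.
have a0 : 0 <= a.
  have [b [_ _ _]] := exists_selector th; rewrite -/a => <-.
  by apply: ex_ge0 => z; rewrite mulr_ge0 ?sqc_ge0.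
have e0 := energy_gt0.
have l0 := log2M1_gt0.
have cc0 : 0 < cc by exact: lt_le_trans cc1.
have den : 0 < cc + M1 - 1 by rewrite -addrA addr_gt0.
have arg : 0 < 1 + e * log2 M1 * mu * a.
  exact: (ltr_pwDl ltr01 (mulr_ge0 (mulr_ge0 (mulr_ge0 (ltW e0) (ltW l0)) (ltW mu_gt0)) a0)).
pose u n := theta * ln (x_ n) + ln (cc / (cc + x_ n - 1)) - eps * ln cc.
pose v n := (r_ n)^-1 * ln (1 + (x_ n - 1) / (x_ n - 1 - y_ n) * (e * log2 (x_ n)) * r_ n * a).
apply: (ler_cvg_to (a := \oo) (f := u) (g := v)).
- rewrite /u; apply: cvgB; last exact: cvg_cst.
  apply: cvgD; first by apply: cvgM; [exact: cvg_cst|exact: cln].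
  have hA : cc / (cc + x_ n - 1) @[n --> \oo] --> cc / (cc + M1 - 1).
    apply: cvgM; first exact: cvg_cst.
    apply: cvgV; first by rewrite gt_eqF.
    apply: cvgB; last exact: cvg_cst.
    by apply: cvgD; [exact: cvg_cst|exact: cx].
  have A0 : 0 < cc / (cc + M1 - 1) by rewrite divr_gt0.
  exact: (cvg_comp _ _ hA (continuous_ln A0)).
- rewrite /v; apply: cvgM; first by apply: cvgV; [rewrite gt_eqF|exact: cr].
  have kap : (x_ n - 1) / (x_ n - 1 - y_ n) @[n --> \oo] --> (1 : R).
    have kapE : (M1 - 1) / (M1 - 1 - 0) = 1 by rewrite subr0 divff// gt_eqF.
    rewrite -[X in _ --> X]kapE.
    have cx1 : x_ n - 1 @[n --> \oo] --> M1 - 1 by apply: cvgB; [exact: cx|exact: cvg_cst].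
    apply: cvgM; first exact: cx1.
    apply: cvgV; first by rewrite subr0 gt_eqF.
    by apply: cvgB; [exact: cx1|exact: cy].
  have hB : 1 + (x_ n - 1) / (x_ n - 1 - y_ n) * (e * log2 (x_ n)) * r_ n * a @[n --> \oo] -->
      1 + 1 * (e * log2 M1) * mu * a.
    apply: cvgD; first exact: cvg_cst.
    apply: cvgM; last exact: cvg_cst.
    apply: cvgM; last exact: cr.
    apply: cvgM; first exact: kap.
    apply: cvgM; first exact: cvg_cst.
    by apply: cvgM; [exact: cln|exact: cvg_cst].
  rewrite mul1r in hB; exact: (cvg_comp _ _ hB (continuous_ln arg)).
- near=> n.
  have [c [perr pow [MK K0] n0 /andP[x2 _]]] : good_code n by near: n; exact: near_code.
  have P00 : 0 <= e * log2 (x_ n).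
    by rewrite mulr_ge0 ?(ltW e0)// /log2 divr_ge0 ?(ltW ln2_gt0)// ln_ge0// ltW// gt2_gt1.
  exact: (fano_code K0 pow perr erefl erefl n0 MK P00 th cc1 erefl).
Unshelve. all: end_near. Qed.

Lemma test_limit (tau : R) : Qfun tau = M1^-1 ->
  1 - eps <= ex cnormal_prob (fun z : R[i] => Qfun (tau - Num.sqrt (2 * (e * log2 M1) * sqc z))).
Proof.
move=> tauE; have e0 := energy_gt0.
have l0 := log2M1_gt0.
set Pi := e * log2 M1.
have Pi0 : 0 < Pi by rewrite mulr_gt0.
set qbar := ex _ _.
set lamb := ex cnormal_prob (test_level tau (fun z : R[i] => Num.sqrt (2 * Pi * sqc z))).
have lamb0 : 0 <= lamb by apply: ex_ge0 => z; exact: expR_ge0.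
have peak0 : 0 <= normal_peak (1 : R) by exact: normal_peak_ge0.
(* For fixed [t] the weak probability [p] does not depend on [n], so [sqrt (y_ n) / p] vanishes; [t]
   tends to 0 only afterwards. *)
have lim t : 0 < t -> 1 - eps <= lamb * ((M1 - 1)^-1 * (eps + normal_peak 1 * t) - M1^-1) + qbar.
  move=> t0; pose p := 1 - expR (- (t ^+ 2 / (2 * Pi))).
  pose v n := lamb * ((x_ n - 1 + y_ n)^-1 * (eps + Num.sqrt (y_ n) / p + normal_peak 1 * t + y_ n) - M1^-1) + qbar.
  apply: (ler_cvg_to (a := \oo) (f := fun=> 1 - eps) (g := v)); first exact: cvg_cst.
  - rewrite /v; apply: cvgD; last exact: cvg_cst.
    apply: cvgM; first exact: cvg_cst.
    apply: cvgB; last exact: cvg_cst.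
    apply: cvgM.
      apply: cvgV; first by rewrite gt_eqF.
      rewrite -[M1 - 1]addr0; apply: cvgD; last exact: cy.
      by apply: cvgB; [exact: cx|exact: cvg_cst].
    have -> : eps + normal_peak 1 * t = eps + Num.sqrt 0 / p + normal_peak 1 * t + 0.
      by rewrite sqrtr0 mul0r !addr0.
    apply: cvgD; last exact: cy.
    apply: cvgD; last exact: cvg_cst.
    apply: cvgD; first exact: cvg_cst.
    apply: cvgM; last exact: cvg_cst.
    exact: (cvg_comp _ _ cy (@sqrt_continuous R 0)).
  - near=> n.
    have [c [perr pow [MK K0] n0 /andP[x2 xM]]] : good_code n by near: n; exact: near_code.
    (* Rounding down gives [x_ n <= M1], so the power bound can be frozen at [Pi]; the averages over
       the fading are then the same for all [n]. *)
    have pow' m u : sqnorm (enc c m u) <= Pi.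
      apply: le_trans (pow m u) _; rewrite ler_wpM2l ?(ltW e0)// /log2.
      by rewrite ler_wpM2r ?invr_ge0 ?(ltW ln2_gt0)// ler_ln ?posrE// (lt_trans ltr01)// gt2_gt1.
    have KM : (K n <= M n)%N by rewrite ltnW// -subn_gt0 (leq_trans _ MK).
    by have := test_code K0 pow' perr erefl erefl tau Pi0 t0 erefl KM; rewrite tauE.
pose g t : R := lamb * ((M1 - 1)^-1 * (eps + normal_peak 1 * t) - M1^-1) + qbar.
have lim0 : 1 - eps <= g 0.
  apply/ler_addgt0Pr => s s0.
  pose k := lamb * ((M1 - 1)^-1 * normal_peak 1).
  have k0 : 0 <= k by rewrite !mulr_ge0 ?invr_ge0 ?(ltW M1B_gt0).
  have k1 : 0 < k + 1 by rewrite ltr_wpDl.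
  have t0 : 0 < s / (k + 1) by rewrite divr_gt0.
  apply: le_trans (lim _ t0) _.
  have -> : lamb * ((M1 - 1)^-1 * (eps + normal_peak 1 * (s / (k + 1))) - M1^-1) + qbar =
      g 0 + s * (k / (k + 1)) by rewrite /g /k; ring.
  by rewrite lerD2l -[leRHS]mulr1 ler_wpM2l ?(ltW s0)// ler_pdivrMr// mul1r lerDl.
(* The factor of [lamb] is [eps / (M1 - 1) - 1 / M1], nonpositive exactly when
   [eps <= 1 - 1 / M1]. *)
apply: le_trans lim0 _; rewrite /g mulr0 addr0 -[leRHS]add0r lerD2r.
rewrite mulr_ge0_le0// subr_le0 mulrC ler_pdivrMr; last by [].
by rewrite mulrBr mulVf ?gt_eqF// mulr1.
Unshelve. all: end_near. Qed.

Lemma Econv1_le : (Econv1 M1 mu eps <= e%:E)%E.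
Proof.
have l0 := log2M1_gt0.
have iM : 0 < M1^-1 by rewrite invr_gt0.
apply: ereal_inf_lbound; exists (e * (mu * log2 M1)).
  split; first exact: (mulr_gt0 energy_gt0 (mulr_gt0 mu_gt0 log2M1_gt0)).
  move=> theta th.
  (* For this [c], the condition [1 <= c] is equivalent to [eps <= 1 - 1 / M1]. *)
  have cc1 : 1 <= (1 - eps) * (M1 - 1) / eps.
    rewrite ler_pdivlMr// mul1r.
    have : M1^-1 <= 1 - eps by rewrite lerBrDl -lerBrDr.
    rewrite -(ler_pM2r M1_gt0) mulVf ?gt_eqF// => h.
    by rewrite mulrBr mulr1 lerBrDr addrC subrK.
  have := fano_limit th cc1.
  have e1 : 0 < 1 - eps by apply: lt_le_trans iM _; rewrite lerBrDl -lerBrDr.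
  (* With this [c] the normalization [A] is [1 - eps], and [ln A - eps * ln c] becomes minus the
     entropy of [eps] in nats, minus [eps * ln (M1 - 1)]. *)
  have -> : (1 - eps) * (M1 - 1) / eps / ((1 - eps) * (M1 - 1) / eps + M1 - 1) = 1 - eps.
    have -> : (1 - eps) * (M1 - 1) / eps + M1 - 1 = (M1 - 1) / eps by field; rewrite gt_eqF.
    by field; rewrite !gt_eqF.
  rewrite ln_div ?posrE ?mulr_gt0// lnM ?posrE// => h.
  rewrite /h2 /log2.
  rewrite [X in _ <= ln X / _](_ : _ = 1 + e * log2 M1 * mu * alpha (1 - theta) 1); last by rewrite /log2; ring.
  rewrite [leLHS](_ : _ = mu * (theta * ln M1 + ln (1 - eps) -
     eps * (ln (1 - eps) + ln (M1 - 1) - ln eps)) / ln 2); last by ring.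
  rewrite ler_wpM2r ?invr_ge0 ?(ltW ln2_gt0)//.
  by have := ler_wpM2l (ltW mu_gt0) h; rewrite mulVKf// gt_eqF.
by rewrite mulfK// gt_eqF// mulr_gt0.
Qed.

Lemma Econv2_le : (Econv2 M1 mu eps <= e%:E)%E.
Proof.
have l0 := log2M1_gt0.
apply: ereal_inf_lbound; exists (e * (mu * log2 M1)).
  split; first exact: (mulr_gt0 energy_gt0 (mulr_gt0 mu_gt0 log2M1_gt0)).
  have iM : 0 < M1^-1 < 1 by rewrite invr_gt0 M1_gt0 invf_lt1.
  have := test_limit (QfunK iM).
  rewrite unlock; set F := fun z => Qfun _ => h.
  have FE z : Qfun (Qinv M1^-1 - Num.sqrt (2 * (e * (mu * log2 M1)) / mu * Normc.normc z ^+ 2)) = F z.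
    have -> : 2 * (e * (mu * log2 M1)) / mu = 2 * (e * log2 M1) by field; rewrite gt_eqF.
    by rewrite -sqc_normc.
  have iF : intble cnormal_prob F.
    apply: intble01 => [|z]; last by rewrite Qfun_ge0 Qfun_le1.
    apply: (measurableT_comp (continuous_measurable_fun (@continuous_Qfun R))).
    apply: measurable_funB => //.
    apply: (measurableT_comp (continuous_measurable_fun (@sqrt_continuous R))).
    by apply: measurable_funM => //; exact: measurable_sqc.
  have IE := eq_integral (mu := cnormal_prob) (D := setT) _ _ (fun z _ => congr1 EFin (FE z)).
  rewrite IE (exE iF) lee_fin.
  by rewrite lerBlDr -lerBlDl.
by rewrite mulfK// gt_eqF// mulr_gt0.
Qed.

End eventual_codes.

Lemma limn_esup_lt (R : realType) (u : nat -> \bar R) (l : \bar R) :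
  (limn_esup u < l)%E -> \forall n \near \oo, (u n < l)%E.
Proof.
move=> /ereal_inf_lt[_ [V FV <-] hV]; apply: filterS FV => n Vn.
by apply: le_lt_trans hV; apply: ereal_sup_ubound; exists n.
Qed.

Theorem theoremB2 (R : realType) (mu M1 eps : R) (hmu : (0 < mu)%R)
    (hM1 : (2 < M1)%R) (heps : (0 < eps <= 1 - M1^-1)%R) :
  (Econv M1 mu eps <= Estar M1 mu eps)%E.
Proof.
have /andP[eps0 eps1] := heps.
have codes (e : R) : (Estar M1 mu eps < e%:E)%E -> \forall n \near \oo, code_below mu M1 eps e n.
  move=> /limn_esup_lt; apply: filterS => n /ereal_inf_lt[_ [E [c hc] <-]].
  by rewrite lte_fin => Ee; exists E, c.
have bound (e : R) : (Estar M1 mu eps < e%:E)%E -> (Econv M1 mu eps <= e%:E)%E.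
  move=> /codes h; rewrite /Econv ge_max; apply/andP; split.
    exact: Econv1_le h.
  exact: Econv2_le h.
case E : (Estar M1 mu eps) bound codes => [s| |] bound codes.
- apply/lee_addgt0Pr => d d0; rewrite -EFinD; apply: bound.
  by rewrite lte_fin ltrDl.
- exact: leey.
(* The value [-oo] would provide codes of energy below -1. *)
- have := energy_gt0 hmu hM1 (codes (-1) (ltNyr _)).
  by rewrite oppr_gt0 ltr10.
Qed.
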